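(* Let $R$ be a CGL extension over a field $\mathbb{K}$, with torus $H$. If $w$ and $w'$ are two Cauchon diagrams of $R$ with $w\subsetneq w'$, then $J_w\subsetneq J_{w'}$, where $J_w$ and $J_{w'}$ denote respectively the (unique) $H$-primes of $R$ associated to $w$ and $w'$.
   Context: **CGL extensions.** Let $R=\mathbb{K}[X_1][X_2;\sigma_2,\delta_2]\cdots[X_N;\sigma_N,\delta_N]$ be an iterated Ore extension, where $\sigma_j$ is a $\mathbb{K}$-algebra automorphism of $R_{j-1}=\mathbb{K}[X_1]\cdots[X_{j-1};\sigma_{j-1},\delta_{j-1}]$, $\delta_j$ is a $\mathbb{K}$-linear $\sigma_j$-derivation of $R_{j-1}$, and $X_ja=\sigma_j(a)X_j+\delta_j(a)$ for $a\in R_{j-1}$. $R$ is a CGL extension if: 1. each $\delta_j$ ($2\le j\le N$) is locally nilpotent; 2. for each $2\le j\le N$ there is $q_j\in\mathbb{K}^*$ with $\sigma_j\circ\delta_j=q_j\delta_j\circ\sigma_j$, and for each $i<j$ there is $\lambda_{j,i}\in\mathbb{K}^*$ with $\sigma_j(X_i)=\lambda_{j,i}X_i$; 3. no $q_j$ ($2\le j\le N$) is a root of unity; 4. there is a torus $H=(\mathbb{K}^* )^d$ acting rationally by $\mathbb{K}$-algebra automorphisms on $R$ such that: $X_1,\dots,X_N$ are $H$-eigenvectors; the set $\{\lambda\in\mathbb{K}^*\mid\exists h\in H,\ h\cdot X_1=\lambda X_1\}$ is infinite; for each $2\le j\le N$ there is $h_j\in H$ with $h_j\cdot X_i=\lambda_{j,i}X_i$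 for $1\le i<j$ and $h_j\cdot X_j=q_jX_j$. An $H$-prime of $R$ is a proper ideal $J$ that is $H$-invariant ($h\cdot J=J$ for all $h\in H$) and such that whenever $J$ contains a product of two $H$-invariant ideals it contains one of them. **Deleting derivations algorithm (Cauchon).** In the division ring of fractions of $R$ define $X_i^{(j)}$ ($1\le i\le N$, $2\le j\le N+1$) by $X_i^{(N+1)}=X_i$ and, for $j=N,\dots,2$, $X_i^{(j)}=X_i^{(j+1)}$ if $i\ge j$ and $$X_i^{(j)}=\sum_{k\ge0}\frac{(1-q_j)^{-k}}{[k]!_{q_j}}\,\delta_j^k\circ\sigma_j^{-k}(X_i^{(j+1)})\,(X_j^{(j+1)})^{-k}\quad\text{if } i<j,$$ where $[k]!_{q_j}=\prod_{l=1}^k(1+q_j+\cdots+q_j^{l-1})$. Here $\sigma_j,\delta_j$ are transported to the subalgebra generated by $X_1^{(j+1)},\dots,X_{j-1}^{(j+1)}$ along the isomorphism with $R_{j-1}$ sending $X_l^{(j+1)}$ to $X_l$. Let $R^{(j)}$ be the subalgebra generated by $X_1^{(j)},\dots,X_N^{(j)}$, so $R^{(N+1)}=R$. Cauchon proved that $R^{(j)}$ is isomorphic, via $X_i^{(j)}\mapsto Y_i$, to $\mathbb{K}[Y_1]\cdots[Y_{j-1};\sigma_{j-1},\delta_{j-1}][Y_j;\tau_j]\cdots[Y_N;\tau_N]$ with $\tau_l(Y_i)=\lambda_{l,i}Y_i$ for $i<l$; and that for $j\le N$ the set $S_j$ of powers of $X_j^{(j+1)}=X_j^{(j)}$ is an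 Ore set of regular elements in both $R^{(j)}$ and $R^{(j+1)}$ with $R^{(j)}S_j^{-1}=R^{(j+1)}S_j^{-1}$. Put $\overline{R}=R^{(2)}$ and $T_i=X_i^{(2)}$; $\overline{R}$ is the quantum affine space with relations $T_jT_i=\lambda_{j,i}T_iT_j$ ($i<j$). **Canonical embedding.** For $2\le j\le N$, $\varphi_j:\mathrm{Spec}(R^{(j+1)})\to\mathrm{Spec}(R^{(j)})$ is the injective map with $\varphi_j(P)=PS_j^{-1}\cap R^{(j)}$ if $X_j^{(j+1)}\notin P$, and $\varphi_j(P)=g_j^{-1}(P/(X_j^{(j+1)}))$ if $X_j^{(j+1)}\in P$, where $g_j:R^{(j)}\to R^{(j+1)}/(X_j^{(j+1)})$ is the surjective homomorphism $X_i^{(j)}\mapsto X_i^{(j+1)}+(X_j^{(j+1)})$. Put $\varphi=\varphi_2\circ\cdots\circ\varphi_N:\mathrm{Spec}(R)\to\mathrm{Spec}(\overline{R})$. **Cauchon diagrams of $R$ and $J_w$.** For $w\subseteq\{1,\dots,N\}$ let $K_w$ be the ideal of $\overline{R}$ generated by the $T_i$ with $i\in w$, and let $\mathrm{Spec}_{K_w}(\overline{R})=\{P\in\mathrm{Spec}(\overline{R})\mid P\cap\{T_1,\dots,T_N\}=\{T_i\mid i\in w\}\}$. A subset $w$ is a Cauchon diagram of $R$ if $\varphi^{-1}(\mathrm{Spec}_{K_w}(\overline{R}))\neq\emptyset$. Cauchon proved that for each Cauchon diagram $w$ there is a unique $H$-prime $J_w$ of $R$ with $\varphi(J_w)=K_w$,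 and that $w\mapsto J_w$ is a bijection from the set of Cauchon diagrams of $R$ onto the set of $H$-primes of $R$. Containment of Cauchon diagrams is containment of subsets of $\{1,\dots,N\}$. *)

(* Defs.v *)
From HB Require Import structures.
From mathcomp Require Import all_boot all_order all_algebra.
From mathcomp Require Import mathcomp_extra boolp classical_sets functions.
From mathcomp Require Import cardinality fsbigop.

Set Implicit Arguments.
Unset Strict Implicit.
Unset Printing Implicit Defensive.
Import GRing.Theory.
Local Open Scope classical_set_scope.
Local Open Scope ring_scope.

(* Generators are numbered from 0 to N - 1: the generator X_i of the literature
   is [X i] with i : 'I_N one less.  The level of the deleting derivations
   algorithm is shifted in the same way, see [cauchon_gen]. *)

(** * Subalgebras and two-sided ideals, as sets *)

Section Algebras.
Variables (K : fieldType) (A : algType K).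
Implicit Types S I J P G : set A.

Definition is_subalg S : Prop := GRing.subalg_closed [in S].

Definition subalg_gen G : set A := smallest is_subalg G.

(* I is a two-sided ideal of the subalgebra S. *)
Definition is_ideal S I : Prop :=
  [/\ I `<=` S, I 0,
      forall a b, I a -> I b -> I (a + b)
    & forall s a, S s -> I a -> I (s * a) /\ I (a * s)].

Definition ideal_gen S G : set A := smallest (is_ideal S) G.

Definition ideal_mul S I J : set A :=
  ideal_gen S [set a * b | a in I & b in J].

Definition proper_ideal S I : Prop := is_ideal S I /\ I <> S.

(* Spec S; the ring S need not be commutative, so a prime ideal need not be
   completely prime. *)
Definition is_prime_ideal S P : Prop :=
  proper_ideal S P /\
  forall I J, is_ideal S I -> is_ideal S J -> ideal_mul S I J `<=` P ->
    I `<=` P \/ J `<=` P.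

End Algebras.

(* The graph of the algebra morphism from the subalgebra of A generated by the
   f i, i \in D, to B that sends f i to g i: it is the subalgebra of A * B
   generated by the pairs (f i, g i).  It is a functional relation exactly when
   that morphism exists. *)
Definition morph_graph (K : fieldType) (A B : algType K) (I : Type) (D : set I)
    (f : I -> A) (g : I -> B) : set (A * B) :=
  subalg_gen [set (f i, g i) | i in D].

(** * Ore extensions *)

Section Ore.
Variables (K : fieldType) (T : algType K).
Implicit Types (A B : set T) (s t d : T -> T).

(* s restricts to a K-algebra automorphism of A, whose inverse is t. *)
Definition alg_automorphism_on A s t : Prop :=
  [/\ forall a, A a -> A (s a) /\ A (t a),
      forall a, A a -> t (s a) = a /\ s (t a) = a,
      forall c a b, A a -> A b -> s (c *: a + b) = c *: s a + s b,
      forall a b, A a -> A b -> s (a * b) = s a * s b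
    & s 1 = 1].

Definition skew_derivation_on A s d : Prop :=
  [/\ forall a, A a -> A (d a),
      forall c a b, A a -> A b -> d (c *: a + b) = c *: d a + d b
    & forall a b, A a -> A b -> d (a * b) = s a * d b + d a * b].

(* B = A[x; s, d], i.e. B is a free left A-module on the powers of x and
   x * a = s a * x + d a for a in A. *)
Definition ore_extension A B (x : T) s t d : Prop :=
  [/\ [/\ is_subalg A, is_subalg B, A `<=` B & B x],
      alg_automorphism_on A s t /\ skew_derivation_on A s d,
      forall a, A a -> x * a = s a * x + d a,
      forall b, B b -> exists n (a : nat -> T),
        (forall k, A (a k)) /\ b = \sum_(k < n) a k * x ^+ k
    & forall n (a : nat -> T), (forall k, A (a k)) ->
        \sum_(k < n) a k * x ^+ k = 0 -> forall k, (k < n)%N -> a k = 0].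

End Ore.

(** * Rational actions of the torus (K^* )^d *)

Section Torus.
Variables (K : fieldType) (d : nat).

Definition torus : set {ffun 'I_d -> K} := [set h | forall i, h i != 0].

Definition torus_one : {ffun 'I_d -> K} := [ffun=> 1].

Definition torus_mul (h h' : {ffun 'I_d -> K}) : {ffun 'I_d -> K} :=
  [ffun i => h i * h' i].

(* Regular functions on the torus, i.e. Laurent polynomials in the coordinates,
   given by a list of pairs (coefficient, exponents). *)
Definition regular_function (f : {ffun 'I_d -> K} -> K) : Prop :=
  exists s : seq (K * {ffun 'I_d -> int}), forall h, torus h ->
    f h = \sum_(t <- s) t.1 * \prod_(i < d) h i ^ (t.2 i).

Variable R : algType K.
Variable act : {ffun 'I_d -> K} -> R -> R.

(* The algebra endomorphisms act h are automorphisms, with inverse act h^-1. *)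
Definition acts_by_automorphisms : Prop :=
  [/\ forall a, act torus_one a = a,
      forall h h' a, torus h -> torus h' ->
        act (torus_mul h h') a = act h (act h' a)
    & forall h, torus h -> linear (act h) /\ monoid_morphism (act h)].

(* R is a directed union of finite-dimensional torus-stable subspaces, with
   bases v, on which the torus acts through matrices of regular functions.  As
   a finite sum of such subspaces is again one, it is enough that every element
   of R belong to one of them. *)
Definition rational_action : Prop :=
  forall a : R, exists n (v : 'I_n -> R)
      (M : 'I_n -> 'I_n -> {ffun 'I_d -> K} -> K),
    [/\ forall c : 'I_n -> K, \sum_k c k *: v k = 0 -> forall k, c k = 0,
        exists c : 'I_n -> K, a = \sum_k c k *: v k,
        forall k l, regular_function (M k l)
      & forall h l, torus h -> act h (v l) = \sum_k M k l h *: v k].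

Definition torus_invariant (J : set R) : Prop :=
  forall h, torus h -> act h @` J = J.

Definition torus_eigenvector (x : R) : Prop :=
  x != 0 /\ forall h, torus h -> exists c : K, act h x = c *: x.

Definition is_torus_prime (J : set R) : Prop :=
  [/\ proper_ideal setT J, torus_invariant J
    & forall I I', is_ideal setT I -> is_ideal setT I' ->
        torus_invariant I -> torus_invariant I' ->
        ideal_mul setT I I' `<=` J -> I `<=` J \/ I' `<=` J].

End Torus.

(** * CGL extensions *)

(* The subalgebra generated by the X i with i < j. *)
Definition initial_subalg (K : fieldType) (R : algType K) (N : nat)
    (X : 'I_N -> R) (j : nat) : set R :=
  subalg_gen [set X i | i in [set i : 'I_N | (i < j)%N]].

(* In [cgl_ore], j = 0 is the extension K[X_0] of K: any automorphism of the
   K-algebra K is the identity and any K-linear derivation of K is zero, so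
   K[X_0; sigma_0, delta_0] is a polynomial ring.  The fields [q j] and
   [lambda j i] carry no information when j = 0, resp. i >= j. *)
Record cgl_extension (K : fieldType) (R : algType K) (N : nat) := CGLExtension {
  cgl_X : 'I_N -> R;
  cgl_sigma : 'I_N -> R -> R;
  cgl_sigmaV : 'I_N -> R -> R;
  cgl_delta : 'I_N -> R -> R;
  cgl_q : 'I_N -> K;
  cgl_lambda : 'I_N -> 'I_N -> K;
  cgl_rank : nat;
  cgl_act : {ffun 'I_cgl_rank -> K} -> R -> R;
  cgl_N_gt0 : (0 < N)%N;
  cgl_full : initial_subalg cgl_X N = setT;
  cgl_ore : forall j : 'I_N,
    ore_extension (initial_subalg cgl_X j) (initial_subalg cgl_X j.+1)
      (cgl_X j) (cgl_sigma j) (cgl_sigmaV j) (cgl_delta j);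
  cgl_locally_nilpotent : forall j : 'I_N, (0 < j)%N ->
    forall a, initial_subalg cgl_X j a ->
    exists k, iter k (cgl_delta j) a = 0;
  cgl_q_neq0 : forall j : 'I_N, (0 < j)%N -> cgl_q j != 0;
  cgl_sigma_delta : forall j : 'I_N, (0 < j)%N ->
    forall a, initial_subalg cgl_X j a ->
    cgl_sigma j (cgl_delta j a) = cgl_q j *: cgl_delta j (cgl_sigma j a);
  cgl_lambda_neq0 : forall i j : 'I_N, (i < j)%N -> cgl_lambda j i != 0;
  cgl_sigma_X : forall i j : 'I_N, (i < j)%N ->
    cgl_sigma j (cgl_X i) = cgl_lambda j i *: cgl_X i;
  cgl_q_not_root_of_unity : forall j : 'I_N, (0 < j)%N ->
    forall k, (0 < k)%N -> cgl_q j ^+ k != 1;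
  cgl_acts : acts_by_automorphisms cgl_act;
  cgl_rational : rational_action cgl_act;
  cgl_eigenvectors : forall i, torus_eigenvector cgl_act (cgl_X i);
  cgl_infinite : forall i : 'I_N, val i = 0%N ->
    infinite_set [set c : K | c != 0 /\
      exists2 h, torus h & cgl_act h (cgl_X i) = c *: cgl_X i];
  cgl_torus_elt : forall j : 'I_N, (0 < j)%N ->
    exists2 h, torus h &
      (forall i : 'I_N, (i < j)%N ->
         cgl_act h (cgl_X i) = cgl_lambda j i *: cgl_X i) /\
      cgl_act h (cgl_X j) = cgl_q j *: cgl_X j }.

(** * The division ring of fractions *)

Definition division_ring_of_fractions (K : fieldType) (R : algType K)
    (D : unitAlgType K) (f : R -> D) : Prop :=
  [/\ linear f /\ monoid_morphism f,
      injective f,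
      forall x : D, x != 0 -> x \is a GRing.unit,
      forall x : D, exists a b, b != 0 /\ x = f a * (f b)^-1
    & forall x : D, exists a b, b != 0 /\ x = (f b)^-1 * f a].

(** * Deleting derivations and Cauchon diagrams *)

Definition qfact (K : fieldType) (q : K) (k : nat) : K :=
  \prod_(1 <= l < k.+1) \sum_(0 <= m < l) q ^+ m.

Section Cauchon.
Variables (K : fieldType) (R : algType K) (N : nat) (C : cgl_extension R N).
Variables (D : unitAlgType K) (f : R -> D).

Local Notation X := (cgl_X C).
Local Notation q := (cgl_q C).

(* The map u on the subalgebra generated by the X i, i < j, transported to the
   subalgebra generated by the Y i, i < j, along X i |-> Y i. *)
Definition transport (j : 'I_N) (Y : 'I_N -> D) (u : R -> R) (y : D) : D :=
  let theta := morph_graph [set i : 'I_N | (i < j)%N] X Y in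
  xget 0 [set z | exists2 a, theta (a, y) & theta (u a, z)].

(* The sum over k has finite support because delta_j is locally nilpotent. *)
Definition deleting_step (j : 'I_N) (Y : 'I_N -> D) (i : 'I_N) : D :=
  if (i < j)%N then
    \sum_(k \in [set: nat])
      ((1 - q j) ^- k / qfact (q j) k) *:
        (transport j Y (iter k (cgl_delta C j) \o iter k (cgl_sigmaV C j)) (Y i)
         * (Y j) ^- k)
  else Y i.

(* With generators and levels numbered from 1 this is X_(i+1)^(m+1):
   [cauchon_gen N] is the initial family and [cauchon_gen 1] the final one. *)
Definition cauchon_gen (m : nat) : 'I_N -> D :=
  foldr deleting_step (f \o X) [seq j : 'I_N <- enum 'I_N | (m <= j)%N].

Definition cauchon_alg (m : nat) : set D :=
  subalg_gen (range (cauchon_gen m)).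

Lemma cauchon_genN : cauchon_gen N = f \o X.
Proof.
rewrite /cauchon_gen (eq_in_filter (a2 := pred0)) ?filter_pred0 // => j _.
by rewrite leqNgt ltn_ord.
Qed.

Lemma cauchon_gen_ord (j : 'I_N) :
  cauchon_gen j = deleting_step j (cauchon_gen j.+1).
Proof.
rewrite /cauchon_gen.
suff -> : [seq i : 'I_N <- enum 'I_N | (j <= i)%N]
    = j :: [seq i : 'I_N <- enum 'I_N | (j < i)%N] by [].
have sltn (P : pred nat) : sorted ltn (map val [seq i : 'I_N <- enum 'I_N | P i]).
  by rewrite -(filter_map val P) val_enum_ord sorted_filter ?iota_ltn_sorted //;
     exact: ltn_trans.
apply: (inj_map val_inj); apply: (irr_sorted_eq ltn_trans ltnn).
- exact: (sltn (leq j)).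
- rewrite /= path_min_sorted; first exact: (sltn (ltn j)).
  by apply/allP => k /mapP[i]; rewrite mem_filter => /andP[ji _] ->.
move=> k; apply/mapP/idP => [[i]|].
  rewrite mem_filter => /andP[+ _] -> /=; rewrite inE leq_eqVlt.
  case/orP => [/eqP ->|ji]; first by rewrite eqxx.
  by rewrite map_f ?orbT // mem_filter ji mem_enum.
rewrite /= inE => /predU1P[->|/mapP[i]].
  by exists j => //; rewrite mem_filter leqnn mem_enum.
by rewrite mem_filter => /andP[ji _] ->; exists i; rewrite // mem_filter ltnW
  ?mem_enum.
Qed.

(* The coset of (X_j^(j+1)) that is the image of a under the morphism g_j;
   representatives of it are read off the graph of X_i^(j) |-> X_i^(j+1). *)
Definition g_coset (j : 'I_N) (a : D) : set D :=
  [set b | exists2 c,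
    morph_graph setT (cauchon_gen j) (cauchon_gen j.+1) (a, c) &
    ideal_gen (cauchon_alg j.+1) [set cauchon_gen j.+1 j] (b - c)].

(* The second case is the preimage of P/(X_j^(j+1)) under g_j: the coset of a
   is that of an element of P. *)
Definition spec_step (j : 'I_N) (P : set D) : set D :=
  let x := cauchon_gen j.+1 j in
  if `[< P x >] then [set a | cauchon_alg j a /\ exists2 p, P p & g_coset j a p]
  else [set a | cauchon_alg j a /\ exists2 p, P p & exists k, a = p * x ^- k].

(* The maps are applied from j = N - 1 down to j = 1. *)
Definition canonical_embedding (P : set R) : set D :=
  foldr spec_step (f @` P) [seq j : 'I_N <- enum 'I_N | (1 <= j)%N].

Definition quantum_space : set D := cauchon_alg 1.

Definition K_ideal (w : {set 'I_N}) : set D :=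
  ideal_gen quantum_space [set cauchon_gen 1 i | i in [set i | i \in w]].

Definition spec_stratum (w : {set 'I_N}) : set (set D) :=
  [set P | is_prime_ideal quantum_space P /\
    P `&` range (cauchon_gen 1) = [set cauchon_gen 1 i | i in [set i | i \in w]]].

Definition cauchon_diagram (w : {set 'I_N}) : Prop :=
  exists2 P : set R, is_prime_ideal setT P &
    spec_stratum w (canonical_embedding P).

(* J is the ideal J_w: the H-prime, in Spec R, that is sent to K_w. *)
Definition diagram_ideal (w : {set 'I_N}) (J : set R) : Prop :=
  [/\ is_torus_prime (@cgl_act _ _ _ C) J, is_prime_ideal setT J
    & canonical_embedding J = K_ideal w].

End Cauchon.

(* Main.v *)
(* Write R_(j) for the algebra at level j, x = T_j for the variable whose
   derivation is deleted between levels j + 1 and j, and P |-> Q for the map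
   from Spec R_(j+1) to Spec R_(j).  The inclusion of K_w into K_w' is lifted
   from the last level up to R, one level at a time.  When x lies in both or in
   neither of P and P', P is recovered monotonically from Q: as the inverse image
   of an image under g_j, or as Q[x^-1] intersected with R_(j+1).  When x is in P
   but not in P', Q is not contained in Q'.  The remaining case, x in P' but not
   in P, uses gradings.  K_w is homogeneous for the degree in each T_k, and this
   goes up along the levels, so that Q is homogeneous for the degree in x.  Write
   p in P as a Laurent polynomial in x over the deleted copy of the coefficients;
   its component p_0 of degree 0 is then in Q, hence in Q', and as derivations
   take their values in the ideal of x, g_j maps p_0 to the class of p modulo x.
   Hence p is in P'.

   Localization at x needs that elements r with r x^k in P are in P when P is
   prime and contains no power of x; this rests on the left noetherianity of
   R_(j+1).  That no power of x is in P when x is not comes from the last level: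
   otherwise the ideals from Q down to K_w would contain 1. *)
Require Import Defs.
From mathcomp Require Import all_boot all_order all_algebra.
From mathcomp Require Import boolp classical_sets cardinality fsbigop.
From mathcomp Require Import ring zify.

Set Implicit Arguments.
Unset Strict Implicit.
Unset Printing Implicit Defensive.
Import GRing.Theory.

(** * Subalgebras, subspaces and ideals *)

(** In the mixed case Q and Q' come from unrelated constructions, a contraction of a localization
    and a pullback from a quotient, and no map relates P to P'. Besides, an element p of P need not
    lie in R_(j), where g_j is defined. Its component of degree 0 does, and homogeneity puts it in
    Q.

    Degrees are detected by rescaling T_k by q_k: as q_k is not a root of unity, distinct degrees
    have distinct eigenvalues. Such a rescaling need not respect the derivations still present, but
    going up from level j to j + 1 only restores delta_j, which involves no T_k with k > j. So at
    level m homogeneity is kept for the T_k with k >= m, and the step from m to m + 1 consumes the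
    degree in T_m.

    All levels live in the one division ring D. Rescalings and g_j are only relations there until
    shown to be single-valued, so they are handled as subalgebras of D x D, and single-valuedness
    becomes a statement about the pairs (0, v).

    Strictness comes from the last level: J = J' would give K_w = K_w', while K_w contains no T_i
    with i outside the diagram w. *)

Section Subspaces.
Local Open Scope classical_set_scope.
Local Open Scope ring_scope.
Variables (K : fieldType) (A : algType K).
Implicit Types (S V I P : set A).

Definition is_subspace V : Prop :=
  V 0 /\ forall (c : K) u v, V u -> V v -> V (c *: u + v).

Lemma subspaceD V u v : is_subspace V -> V u -> V v -> V (u + v).
Proof. by case=> _ H Vu Vv; rewrite -[u]scale1r; apply: H. Qed.

Lemma subspaceZ V (c : K) u : is_subspace V -> V u -> V (c *: u).
Proof. by case=> V0 H Vu; rewrite -[_ *: _]addr0; apply: H. Qed.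

Lemma subspaceN V u : is_subspace V -> V u -> V (- u).
Proof. by move=> hV Vu; rewrite -scaleN1r; apply: subspaceZ. Qed.

Lemma subspaceB V u v : is_subspace V -> V u -> V v -> V (u - v).
Proof. by move=> hV Vu Vv; apply: subspaceD => //; apply: subspaceN. Qed.

Lemma subspace_sum V (T : Type) (r : seq T) (F : T -> A) (Q : pred T) :
  is_subspace V -> (forall i, Q i -> V (F i)) -> V (\sum_(i <- r | Q i) F i).
Proof.
move=> hV VF; apply: (big_ind V) => // [|u v]; first by case: hV.
exact: subspaceD.
Qed.

Lemma is_subalgP S : is_subalg S <->
  [/\ S 1, forall (c : K) u v, S u -> S v -> S (c *: u + v)
    & forall u v, S u -> S v -> S (u * v)].
Proof.
split=> [[S1 Sl SM]|[S1 Sl SM]]; split.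
- by move: S1; rewrite inE.
- by move=> c u v Su Sv; move: (Sl c u v); rewrite !inE; apply.
- by move=> u v Su Sv; move: (SM u v); rewrite !inE; apply.
- by rewrite inE.
- by move=> c u v; rewrite !inE; apply: Sl.
- by move=> u v; rewrite !inE; apply: SM.
Qed.

Lemma subalg_subspace S : is_subalg S -> is_subspace S.
Proof.
move=> /is_subalgP[S1 Sl _]; split=> //.
by have := Sl (-1) 1 1 S1 S1; rewrite scaleN1r addNr.
Qed.

Lemma subalg1 S : is_subalg S -> S 1.
Proof. by case/is_subalgP. Qed.

Lemma subalg0 S : is_subalg S -> S 0.
Proof. by case/subalg_subspace. Qed.

Lemma subalgM S u v : is_subalg S -> S u -> S v -> S (u * v).
Proof. by case/is_subalgP=> _ _; apply. Qed.

Lemma subalgX S u n : is_subalg S -> S u -> S (u ^+ n).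
Proof.
move=> hS Su; elim: n => [|n IHn]; first by rewrite expr0; apply: subalg1.
by rewrite exprS; apply: subalgM.
Qed.

Lemma subalgD S u v : is_subalg S -> S u -> S v -> S (u + v).
Proof. by move/subalg_subspace/subspaceD; apply. Qed.

Lemma subalgB S u v : is_subalg S -> S u -> S v -> S (u - v).
Proof. by move/subalg_subspace/subspaceB; apply. Qed.

Lemma subalgZ S (c : K) u : is_subalg S -> S u -> S (c *: u).
Proof. by move/subalg_subspace/subspaceZ; apply. Qed.

Lemma subalg_genP (G : set A) : is_subalg (subalg_gen G).
Proof.
apply/is_subalgP; split=> [M [hM _]|c u v Su Sv M hM|u v Su Sv M hM].
- exact: subalg1.
- by case: (hM) => /is_subalgP[_ + _] _; apply; [apply: Su|apply: Sv].
- by case: (hM) => /is_subalgP[_ _ +] _; apply; [apply: Su|apply: Sv].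
Qed.

Lemma mem_subalg_gen (G : set A) g : G g -> subalg_gen G g.
Proof. by move=> Gg M [_]; apply. Qed.

Lemma subalg_gen_sub (G S : set A) :
  is_subalg S -> G `<=` S -> subalg_gen G `<=` S.
Proof. by move=> hS GS b; apply; split. Qed.

Lemma ideal_subspace S I : is_subalg S -> is_ideal S I -> is_subspace I.
Proof.
move=> hS [_ I0 ID IM]; split=> // c u v Iu Iv; apply: ID => //.
rewrite -[c *: u]mul1r -scalerAr scalerAl.
by apply: (IM _ _ _ Iu).1; apply: subalgZ => //; apply: subalg1.
Qed.

Lemma ideal_genP S (G : set A) : is_subalg S -> G `<=` S ->
  is_ideal S (ideal_gen S G) /\ G `<=` ideal_gen S G.
Proof.
move=> hS GS; split; last by move=> g Gg M [_]; apply.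
split.
- move=> a; apply; split=> //; split=> //; first exact: subalg0.
    by move=> u v; apply: subalgD.
  by move=> s u Ss Su; split; apply: subalgM.
- by move=> M [[]].
- move=> a b Ia Ib M hM; case: (hM) => -[_ _ MD _] _.
  by apply: MD; [apply: Ia|apply: Ib].
- move=> s a Ss Ia; split=> M hM; case: (hM) => -[_ _ _ MM] _;
    by case: (MM s a Ss (Ia M hM)).
Qed.

Lemma ideal_gen_sub S (G I : set A) :
  is_ideal S I -> G `<=` I -> ideal_gen S G `<=` I.
Proof. by move=> hI GI b; apply; split. Qed.

End Subspaces.

Section Generators.
Local Open Scope classical_set_scope.
Local Open Scope ring_scope.
Variables (K : fieldType) (A : algType K) (N : nat) (Y : 'I_N -> A).

Lemma initial_subalgP j : is_subalg (initial_subalg Y j).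
Proof. exact: subalg_genP. Qed.

Lemma initial_subalg_gen j (i : 'I_N) : (i < j)%N -> initial_subalg Y j (Y i).
Proof. by move=> ij; apply: mem_subalg_gen; exists i. Qed.

Lemma initial_subalg_sub j (S : set A) : is_subalg S ->
  (forall i : 'I_N, (i < j)%N -> S (Y i)) -> initial_subalg Y j `<=` S.
Proof. by move=> hS SY; apply: subalg_gen_sub => // _ [i ij <-]; apply: SY. Qed.

Lemma initial_subalg_le j k :
  (j <= k)%N -> initial_subalg Y j `<=` initial_subalg Y k.
Proof.
move=> jk; apply: initial_subalg_sub; first exact: initial_subalgP.
by move=> i ij; apply: initial_subalg_gen; apply: leq_trans jk.
Qed.

Lemma initial_subalgS (j : 'I_N) : initial_subalg Y j.+1 =
  subalg_gen (initial_subalg Y j `|` [set Y j]).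
Proof.
apply/seteqP; split.
  apply: initial_subalg_sub; first exact: subalg_genP.
  move=> i; rewrite ltnS leq_eqVlt => /predU1P[/val_inj ->|ij];
    apply: mem_subalg_gen; [by right|by left; apply: initial_subalg_gen].
apply: subalg_gen_sub; first exact: initial_subalgP.
move=> _ [/(initial_subalg_le (leqnSn j)) //|->].
exact: initial_subalg_gen.
Qed.

Lemma initial_subalgN : initial_subalg Y N = subalg_gen (range Y).
Proof.
apply/seteqP; split.
  apply: initial_subalg_sub; first exact: subalg_genP.
  by move=> i _; apply: mem_subalg_gen; exists i.
apply: subalg_gen_sub; first exact: initial_subalgP.
by move=> _ [i _ <-]; apply: initial_subalg_gen.
Qed.

End Generators.

(** * Hilbert's basis theorem for skew polynomials *)

Section RightPolynomials.
Local Open Scope classical_set_scope.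
Local Open Scope ring_scope.
Variables (K : fieldType) (A : algType K) (S : set A) (z : A).
Hypothesis hS : is_subalg S.

(** Degree less than [n], with coefficients on the right, unlike in [ore_extension]. They need not
    be unique, so this also applies to relations inside a product algebra. *)
Definition rpoly n : set A := [set b | exists a : nat -> A,
  (forall k, S (a k)) /\ b = \sum_(k < n) z ^+ k * a k].

Lemma rpoly_subspace n : is_subspace (rpoly n).
Proof.
split.
  exists (fun=> 0); split=> [k|]; first exact: subalg0.
  by rewrite big1 // => k _; rewrite mulr0.
move=> c _ _ [a [Sa ->]] [b [Sb ->]]; exists (fun k => c *: a k + b k).
split=> [k|]; first by apply: subalgD => //; apply: subalgZ.
rewrite scaler_sumr -big_split; apply: eq_bigr => k _ /=.
by rewrite mulrDr scalerAr.
Qed.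

Lemma rpoly_term n k s : (k < n)%N -> S s -> rpoly n (z ^+ k * s).
Proof.
move=> kn Ss; exists (fun i => if i == k then s else 0); split=> [i|].
  by case: eqP => // _; apply: subalg0.
rewrite (bigD1 (Ordinal kn)) //= eqxx big1 ?addr0 // => i.
by rewrite -val_eqE /= => /negPf ->; rewrite mulr0.
Qed.

Lemma rpoly_le m n : (m <= n)%N -> rpoly m `<=` rpoly n.
Proof.
move=> mn _ [a [Sa ->]]; apply: subspace_sum; first exact: rpoly_subspace.
by move=> k _; apply: rpoly_term => //; apply: leq_trans mn.
Qed.

Lemma rpolyMr n b s : rpoly n b -> S s -> rpoly n (b * s).
Proof.
move=> [a [Sa ->]] Ss; exists (fun k => a k * s); split=> [k|].
  exact: subalgM.
by rewrite mulr_suml; apply: eq_bigr => k _; rewrite mulrA.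
Qed.

Lemma rpolyXl n b : rpoly n b -> rpoly n.+1 (z * b).
Proof.
move=> [a [Sa ->]]; rewrite mulr_sumr.
apply: subspace_sum; first exact: rpoly_subspace.
move=> k _; rewrite mulrA -exprS; apply: rpoly_term => //; exact: ltn_ord.
Qed.

Lemma rpolyS n b :
  rpoly n.+1 b -> exists s c, [/\ S s, rpoly n c & b = z ^+ n * s + c].
Proof.
move=> [a [Sa ->]]; exists (a n), (\sum_(k < n) z ^+ k * a k); split=> //.
  by exists a.
by rewrite big_ord_recr /= addrC.
Qed.

Hypothesis hSz : forall s, S s ->
  exists s1 s2, [/\ S s1, S s2 & s * z = z * s1 + s2].

Lemma rpolyXr n s : S s -> rpoly n.+1 (s * z ^+ n).
Proof.
elim: n s => [|n IHn] s Ss.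
  by rewrite expr0 mulr1 -[s]mul1r -(expr0 z); apply: rpoly_term.
have [s1 [s2 [Ss1 Ss2 e]]] := hSz Ss.
rewrite exprS mulrA e mulrDl -mulrA.
apply: subspaceD; first exact: rpoly_subspace.
  exact/rpolyXl/IHn.
by apply: (@rpoly_le n.+1) => //; apply: IHn.
Qed.

Lemma rpolyMl n s b : S s -> rpoly n b -> rpoly n (s * b).
Proof.
move=> Ss [a [Sa ->]]; rewrite mulr_sumr.
apply: subspace_sum; first exact: rpoly_subspace.
move=> k _; rewrite mulrA; apply: rpolyMr => //.
by apply: (@rpoly_le k.+1); [apply: ltn_ord|apply: rpolyXr].
Qed.

Lemma gen_rpoly b : subalg_gen (S `|` [set z]) b -> exists n, rpoly n b.
Proof.
move=> Gb; pose T := [set t | exists n, rpoly n t].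
have TD u v : T u -> T v -> T (u + v).
  move=> [m Tu] [n Tv]; exists (maxn m n).
  apply: subspaceD; first exact: rpoly_subspace.
    by apply: rpoly_le Tu; rewrite leq_maxl.
  by apply: rpoly_le Tv; rewrite leq_maxr.
have TZ (c : K) u : T u -> T (c *: u).
  by move=> [m Tu]; exists m; apply: subspaceZ => //; apply: rpoly_subspace.
suff /(_ 1) : forall t, T t -> T (b * t).
  by rewrite mulr1; apply; exists 1%N;
    rewrite -[1]mulr1 -{1}(expr0 z); apply: rpoly_term => //; exact: subalg1.
(* The multipliers of [T] form a subalgebra at once, so only [S] and [z] have to be tested, and no
   product of two polynomials is computed. *)
pose M := [set b | forall t, T t -> T (b * t)].
rewrite -/(M b); move: b Gb; apply: subalg_gen_sub.
  apply/is_subalgP; split=> [t|c u v Mu Mv t Tt|u v Mu Mv t Tt].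
  - by rewrite mul1r.
  - by rewrite mulrDl -scalerAl; apply: TD; [apply/TZ/Mu|apply: Mv].
  - by rewrite -mulrA; apply/Mu/Mv.
move=> s [Ss|->] t [n Tt]; first by exists n; apply: rpolyMl.
by exists n.+1; apply: rpolyXl.
Qed.

End RightPolynomials.

Section Noetherian.
Local Open Scope classical_set_scope.
Local Open Scope ring_scope.
Variables (K : fieldType) (A : algType K).
Implicit Types (S I J : set A).

Definition left_ideal S I : Prop :=
  [/\ I `<=` S, I 0, forall a b, I a -> I b -> I (a + b)
    & forall s a, S s -> I a -> I (s * a)].

(** Finite generation of left ideals, phrased without forming the left ideal generated by [g]. *)
Definition left_noetherian S : Prop := forall I, left_ideal S I ->
  exists2 g : seq A, (forall a, a \in g -> I a) &
    forall J, left_ideal S J -> (forall a, a \in g -> J a) -> I `<=` J.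

Lemma left_idealB S I a b :
  is_subalg S -> left_ideal S I -> I a -> I b -> I (a - b).
Proof.
move=> hS [_ _ ID IM] Ia Ib; apply: ID => //; rewrite -[b]mul1r -mulNr.
by apply: IM => //; rewrite -scaleN1r; apply: subalgZ => //; apply: subalg1.
Qed.

Lemma left_idealI S I J : left_ideal S I -> left_ideal S J ->
  left_ideal S (I `&` J).
Proof.
move=> [IS I0 ID IM] [JS J0 JD JM]; split=> [a []/IS//| |a b [? ?] [? ?]|s a Ss [? ?]].
- by split.
- by split; [apply: ID|apply: JD].
- by split; [apply: IM|apply: JM].
Qed.

Lemma exists_seq (T : eqType) (U : eqType) (g : seq T) (Q : T -> U -> Prop) :
  (forall a, a \in g -> exists t, Q a t) ->
  exists2 g' : seq U, (forall a, a \in g -> exists2 t, t \in g' & Q a t) &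
    forall t, t \in g' -> exists2 a, a \in g & Q a t.
Proof.
elim: g => [|x g IHg] gQ; first by exists [::].
have [|g' g1 g2] := IHg; first by move=> a ag; apply: gQ; rewrite inE ag orbT.
have [t Qt] := gQ x (mem_head _ _).
exists (t :: g') => [a|u]; rewrite inE => /predU1P[->|].
- by exists t => //; apply: mem_head.
- by move=> /g1[u ug Qu]; exists u => //; rewrite inE ug orbT.
- by exists x => //; apply: mem_head.
- by move=> /g2[a ag Qa]; exists a => //; rewrite inE ag orbT.
Qed.

Section Hilbert.
Variables (S : set A) (x : A).
Hypothesis hS : is_subalg S.
Hypothesis hSx : forall s, S s ->
  exists s1 s2, [/\ S s1, S s2 & s * x = x * s1 + s2].
Hypothesis hxS : forall s, S s ->
  exists s1 s2, [/\ S s1, S s2 & x * s = s1 * x + s2].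

Let T := subalg_gen (S `|` [set x]).
Let hT : is_subalg T := subalg_genP _.

Let TS s : S s -> T s.
Proof. by move=> Ss; apply: mem_subalg_gen; left. Qed.

Let Tx : T x.
Proof. by apply: mem_subalg_gen; right. Qed.

(** To multiply a leading coefficient by [s], an element of the ideal is multiplied by an s' that
    becomes [s] once moved past x^n, up to lower degree. *)
Lemma rpoly_swap n s : S s ->
  exists2 s', S s' & rpoly S x n (s' * x ^+ n - x ^+ n * s).
Proof.
elim: n s => [|n IHn] s Ss.
  by exists s => //; rewrite expr0 mulr1 mul1r subrr; exists (fun=> 0);
    split=> [_|]; rewrite ?big_ord0 //; apply: subalg0.
have [s' Ss' r] := IHn s Ss; have [s1 [s2 [Ss1 Ss2 e]]] := hxS Ss'.
exists s1 => //.
have -> : s1 * x ^+ n.+1 - x ^+ n.+1 * s =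
    x * (s' * x ^+ n - x ^+ n * s) - s2 * x ^+ n.
  by rewrite mulrBr !mulrA e exprS mulrDl !mulrA -exprS addrAC addrK.
apply: subspaceB; [exact: rpoly_subspace|exact: rpolyXl|exact: rpolyXr].
Qed.

Definition lead_ideal I n : set A :=
  [set a | S a /\ exists2 t, I t & rpoly S x n (t - x ^+ n * a)].

Lemma lead_left_ideal I n : left_ideal T I -> left_ideal S (lead_ideal I n).
Proof.
move=> hI; have [IT I0 ID IM] := hI; have hr := rpoly_subspace x hS n.
split=> [a []//| |a b [Sa [t It rt]] [Sb [u Iu ru]]|s a Ss [Sa [t It rt]]].
- split; first exact: subalg0.
  by exists 0; rewrite ?mulr0 ?subrr //; case: hr.
- split; first exact: subalgD.
  exists (t + u); first exact: ID.
  by rewrite mulrDr opprD addrACA; apply: subspaceD.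
- split; first exact: subalgM.
  have [s' Ss' rs] := rpoly_swap n Ss.
  exists (s' * t); first by apply: IM => //; apply: TS.
  have -> : s' * t - x ^+ n * (s * a) =
     s' * (t - x ^+ n * a) + (s' * x ^+ n - x ^+ n * s) * a.
    by rewrite mulrBr mulrBl !mulrA addrA subrK.
  by apply: subspaceD => //; [apply: rpolyMl|apply: rpolyMr].
Qed.

Lemma lead_idealS I n m : left_ideal T I -> (n <= m)%N ->
  lead_ideal I n `<=` lead_ideal I m.
Proof.
move=> [_ _ _ IM] /subnKC <-; elim: (m - n)%N => [|d IHd] a Ia.
  by rewrite addn0.
have [Sa [t It rt]] := IHd a Ia.
split=> //; exists (x * t); first exact: IM.
by rewrite addnS exprS -mulrA -mulrBr; apply: rpolyXl.
Qed.

(** Subtracting an element of J with the same leading coefficient lowers the degree; taking it in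
    [J] and [I] keeps the difference in [I]. *)
Lemma lead_ideal_step I J n : left_ideal T I -> left_ideal T J ->
  (forall t, I t -> rpoly S x n t -> J t) ->
  lead_ideal I n `<=` lead_ideal (J `&` I) n ->
  forall t, I t -> rpoly S x n.+1 t -> J t.
Proof.
move=> hI hJ IJ LL t It /rpolyS[a [c [Sa rc te]]].
have [_ [u [Ju Iu] ru]] : lead_ideal (J `&` I) n a.
  by apply: LL; split=> //; exists t => //; rewrite te addrC addKr.
rewrite -(subrK u t); case: (hJ) => _ _ JD _; apply: (JD) => //.
apply: IJ; first exact: (left_idealB hT hI It Iu).
have -> : t - u = c - (u - x ^+ n * a).
  by rewrite te opprB addrA [c + _]addrC.
by apply: subspaceB => //; apply: rpoly_subspace.
Qed.

(* Right coefficients make the leading coefficients of degree n of a left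
   ideal a left ideal of S without any twist by an automorphism. *)
Lemma hilbert_basis : left_noetherian S -> left_noetherian T.
Proof.
move=> nS I hI.
(* Low degrees get generators of their own, since there the leading ideals may be smaller than their
   union [L] below. *)
have bounded n : exists2 g : seq A, (forall a, a \in g -> I a) &
    forall J, left_ideal T J -> (forall a, a \in g -> J a) ->
      forall t, I t -> rpoly S x n t -> J t.
  elim: n => [|n [g gI gJ]].
    exists [::] => // J [_ J0 _ _] _ t _ [a [_ ->]].
    by rewrite big_ord0.
  have [h hL hJ] := nS _ (lead_left_ideal n hI).
  have [|h' h1 h2] := @exists_seq _ A h
    (fun a t => I t /\ rpoly S x n (t - x ^+ n * a)).
    by move=> a /hL[_ [t]]; exists t.
  exists (g ++ h') => [a|J lJ gh].
    by rewrite mem_cat => /orP[/gI //|/h2[b _ []]].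
  apply: lead_ideal_step => //.
    by apply: gJ => // a ag; apply: gh; rewrite mem_cat ag.
  apply: hJ => [|a ah]; first exact/lead_left_ideal/left_idealI.
  split; first by case: (hL a ah).
  have [t th' [It rt]] := h1 a ah; exists t => //; split=> //.
  by apply: gh; rewrite mem_cat th' orbT.
(* The leading ideals increase with the degree, so finitely many generators of their union all occur
   at one degree [M]. *)
pose L := [set a | exists n, lead_ideal I n a].
have hL : left_ideal S L.
  split=> [a [n []]//| |a b [n La] [m Lb]|s a Ss [n La]].
  - by exists 0%N; case: (lead_left_ideal 0 hI).
  - exists (maxn n m); have [_ _ LD _] := lead_left_ideal (maxn n m) hI.
    by apply: LD; [apply: lead_idealS La|apply: lead_idealS Lb];
      rewrite // ?leq_maxl ?leq_maxr.
  - by exists n; have [_ _ _ LM] := lead_left_ideal n hI; apply: LM.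
have [h hLh hJ] := nS _ hL.
have [M hM] : exists M, forall a, a \in h -> lead_ideal I M a.
  elim: h hLh {hJ} => [|a h IHh] hLh; first by exists 0%N.
  have [|M hM] := IHh; first by move=> b bh; apply: hLh; rewrite inE bh orbT.
  have [n La] := hLh a (mem_head _ _).
  exists (maxn n M) => b; rewrite inE => /predU1P[->|/hM Lb].
    by apply: lead_idealS La; rewrite ?leq_maxl.
  by apply: lead_idealS Lb; rewrite ?leq_maxr.
have [g gI gJ] := bounded M.
have [|h' h1 h2] := @exists_seq _ A h
  (fun a t => I t /\ rpoly S x M (t - x ^+ M * a)).
  by move=> a /hM[_ [t]]; exists t.
exists (g ++ h') => [a|J lJ gh].
  by rewrite mem_cat => /orP[/gI //|/h2[b _ []]].
suff IJ n t : I t -> rpoly S x (M + n) t -> J t.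
  move=> t It; have [|n rt] := @gen_rpoly _ _ S x hS hSx t;
    first by case: hI => /(_ t It).
  by apply: (IJ n) => //; apply: rpoly_le rt => //; apply: leq_addl.
(* From degree [M] on, the lifts [h'] of the generators of [L], multiplied by powers of [x], supply
   every leading coefficient. *)
elim: n t => [t It|n IHn]; first rewrite addn0.
  by apply: gJ It => // a ag; apply: gh; rewrite mem_cat ag.
rewrite addnS; apply: lead_ideal_step => // a La.
have /(hJ _) /(_ _ a) : left_ideal S (lead_ideal (J `&` I) (M + n)).
  exact/lead_left_ideal/left_idealI.
apply; last by exists (M + n)%N.
move=> b bh; apply: (@lead_idealS _ M); rewrite ?leq_addr //.
  exact: left_idealI.
split; first by case: (hM b bh).
have [t th' [It rt]] := h1 b bh; exists t => //; split=> //.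
by apply: gh; rewrite mem_cat th' orbT.
Qed.

End Hilbert.

Lemma left_noetherian_scalars : left_noetherian [set c%:A | c in [set: K]].
Proof.
move=> I [IS I0 ID IM].
have [[c c0 Ic]|Inc] := pselect (exists2 c : K, c != 0 & I (c%:A)).
  exists [:: c%:A] => [a|J [_ _ _ JM] Jc a /IS[d _ <-]]; rewrite ?inE.
    by move=> /eqP ->.
  have -> : d%:A = (d / c)%:A * (c%:A : A).
    by rewrite -scalerAl mul1r scalerA divfK.
  by apply: JM; [exists (d / c)|apply/Jc/mem_head].
exists [::] => // J [_ J0 _ _] _ a Ia; have [d _ da] := IS a Ia.
have [d0|d0] := eqVneq d 0; first by rewrite -da d0 scale0r.
by case: Inc; exists d; rewrite // da.
Qed.

End Noetherian.

(** * Prime ideals in terms of elements *)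

Section ElementwisePrime.
Local Open Scope classical_set_scope.
Local Open Scope ring_scope.
Variables (K : fieldType) (A : algType K).
Implicit Types B P : set A.

(** This form of primeness passes easily through localizations and pullbacks along relations.
    Properness is followed separately, as the absence of 1 at the last level. *)
Definition elt_prime B P : Prop :=
  is_ideal B P /\ forall a b, B a -> B b ->
    (forall s, B s -> P (a * s * b)) -> P a \/ P b.

Lemma prime_elt_prime P : is_prime_ideal setT P -> elt_prime setT P.
Proof.
have hT : is_subalg [set: A] by apply/is_subalgP.
move=> [[hP _] prP]; have [_ P0 PD PM] := hP; split=> // a b _ _ Pasb.
have [ha aa] := ideal_genP hT (@subsetT _ [set a]).
have [hb bb] := ideal_genP hT (@subsetT _ [set b]).
have Ub u s : ideal_gen setT [set a] u -> P (u * s * b).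
  (* [U] is an ideal containing [a], hence the ideal that [a] generates; the same is then done on
     the side of [b] with [V]. *)
  move=> Iu; pose U := [set u | forall s, P (u * s * b)].
  suff : U u by apply.
  apply: ideal_gen_sub Iu => [|_ -> s']; last exact: Pasb.
  split=> // [s'|v v' Uv Uv' s'|r v _ Uv]; first by rewrite !mul0r.
    by rewrite !mulrDl; apply: PD.
  split=> s'; last by rewrite -[v * r * s']mulrA; apply: Uv.
  by rewrite -!mulrA; apply: (PM _ _ I _).1; rewrite mulrA; apply: Uv.
case: (prP _ _ ha hb) => [|aP|bP]; [|by left; apply: aP; apply: aa|by right;
  apply: bP; apply: bb].
apply: ideal_gen_sub => // _ [u Iu [v Iv <-]].
pose V := [set v | forall s, P (u * s * v)].
suff /(_ 1) : V v by rewrite mulr1.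
apply: ideal_gen_sub Iv => [|_ -> s']; last exact: Ub.
split=> // [s'|z z' Vz Vz' s'|r z _ Vz]; first by rewrite mulr0.
  by rewrite mulrDr; apply: PD.
split=> s'; first by rewrite mulrA -[u * s' * r]mulrA; apply: Vz.
by rewrite mulrA; apply: (PM _ _ I _).2; apply: Vz.
Qed.

End ElementwisePrime.

(** * Maps that are linear or multiplicative on a subalgebra *)

Section OnMorphisms.
Local Open Scope classical_set_scope.
Local Open Scope ring_scope.
Variables (K : fieldType) (R B : algType K) (A : set R) (f : R -> B).

(** Relative to [A], because the sigma_j and delta_j of a CGL extension are arbitrary functions
    outside R_j. *)
Definition linear_on : Prop :=
  forall (c : K) a b, A a -> A b -> f (c *: a + b) = c *: f a + f b.

Definition morphism_on : Prop :=
  [/\ linear_on, forall a b, A a -> A b -> f (a * b) = f a * f b & f 1 = 1].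

Hypothesis hA : is_subalg A.
Hypothesis hf : linear_on.

Lemma linear_on0 : f 0 = 0.
Proof.
have A0 := subalg0 hA.
by have := hf (-1) A0 A0; rewrite scaler0 addr0 scaleN1r addNr.
Qed.

Lemma linear_onD a b : A a -> A b -> f (a + b) = f a + f b.
Proof. by move=> Aa Ab; rewrite -[in LHS](scale1r a) hf // scale1r. Qed.

Lemma linear_onZ c a : A a -> f (c *: a) = c *: f a.
Proof.
by move=> Aa; rewrite -[c *: a]addr0 hf ?linear_on0 ?addr0 //; apply: subalg0.
Qed.

Lemma linear_onB a b : A a -> A b -> f (a - b) = f a - f b.
Proof. by move=> Aa Ab; rewrite addrC -scaleN1r hf // scaleN1r addrC. Qed.

Lemma linear_on_sum n (F : nat -> R) : (forall i, A (F i)) ->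
  f (\sum_(i < n) F i) = \sum_(i < n) f (F i).
Proof.
move=> AF; elim: n => [|n IHn]; first by rewrite !big_ord0 linear_on0.
rewrite !big_ord_recr /= linear_onD ?IHn //.
by apply: subspace_sum => //; apply: subalg_subspace.
Qed.

End OnMorphisms.

Lemma sum_trunc (V : zmodType) (m n : nat) (F : nat -> V) : (m <= n)%N ->
  (forall k, (m <= k)%N -> F k = 0%R) ->
  (\sum_(k < n) F k = \sum_(k < m) F k)%R.
Proof.
move=> /subnKC <- F0; elim: (n - m)%N => [|d IHd]; first by rewrite addn0.
by rewrite addnS big_ord_recr /= IHd F0 ?leq_addr // addr0.
Qed.

Lemma sum_triangle (V : zmodType) (n : nat) (F : nat -> nat -> V) :
  (\sum_(m < n) \sum_(i < m.+1) F i (m - i)%N =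
   \sum_(i < n) \sum_(l < n - i) F i l)%R.
Proof.
elim: n => [|n IHn]; first by rewrite !big_ord0.
rewrite big_ord_recr /= IHn.
rewrite [RHS](eq_bigr (fun i : 'I_n.+1 =>
  (\sum_(l < n - i) F i l + F i (n - i)%N)%R)); last first.
  by move=> i _; rewrite subSn ?big_ord_recr //= -ltnS.
rewrite big_split /= [X in _ = (X + _)%R]big_ord_recr /= subnn big_ord0.
by rewrite addr0.
Qed.

(** * Sums of eigenvectors of a linear relation *)

Section EigenSums.
Local Open Scope classical_set_scope.
Local Open Scope ring_scope.
Variables (K : fieldType) (A : algType K) (G : set (A * A)).
Hypothesis hG : is_subspace G.

(** [G] plays the role of the graph of a linear operator, possibly partial or multivalued. The list
    pairs eigenvalues with eigenvectors, and eigenvalues may repeat. *)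
Definition eigensum (Q : K -> Prop) : set A := [set y | exists s : seq (K * A),
  y = \sum_(t <- s) t.2 /\
  forall t, t \in s -> Q t.1 /\ G (t.2, t.1 *: t.2)].

Lemma eigensum1 (Q : K -> Prop) c v : Q c -> G (v, c *: v) -> eigensum Q v.
Proof.
move=> Qc Gv; exists [:: (c, v)]; rewrite big_seq1; split=> // t.
by rewrite inE => /eqP ->.
Qed.

Lemma eigensum_subspace Q : is_subspace (eigensum Q).
Proof.
split; first by exists [::]; rewrite big_nil.
move=> c _ _ [s [-> hs]] [r [-> hr]].
exists ([seq (t.1, c *: t.2) | t <- s] ++ r); split.
  by rewrite big_cat big_map scaler_sumr.
move=> t; rewrite mem_cat => /orP[/mapP[u us ->]|/hr //] /=.
have [Qu Gu] := hs u us; split=> //.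
by have := subspaceZ c hG Gu; rewrite scalerA mulrC -scalerA.
Qed.

Lemma eigensum_map (Q Q' : K -> Prop) (h : A -> A) y :
  {morph h : a b / a + b} -> h 0 = 0 -> (forall c, Q c -> exists2 c', Q' c' &
    forall v, G (v, c *: v) -> G (h v, c' *: h v)) ->
  eigensum Q y -> eigensum Q' (h y).
Proof.
move=> hD h0 QQ' [s [-> hs]].
rewrite (big_morph h hD h0) big_seq; apply: subspace_sum.
  exact: eigensum_subspace.
move=> t ts; have [/QQ'[c' Qc' GG'] Gt] := hs t ts.
by apply: eigensum1 Qc' _; apply: GG'.
Qed.

Lemma eigensumM (Q : K -> Prop) y z : is_subalg G ->
  (forall c d, Q c -> Q d -> Q (c * d)) ->
  eigensum Q y -> eigensum Q z -> eigensum Q (y * z).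
Proof.
move=> hGa QM [s [-> hs]] [r [-> hr]].
have eP := eigensum_subspace Q.
rewrite mulr_suml big_seq; apply: subspace_sum => // t ts.
rewrite mulr_sumr big_seq; apply: subspace_sum => // u ur.
have [Qt Gt] := hs t ts; have [Qu Gu] := hr u ur.
apply: (@eigensum1 _ (t.1 * u.1)); first exact: QM.
have := subalgM hGa Gt Gu.
suff -> : (t.2 * u.2, (t.1 * u.1) *: (t.2 * u.2)) =
  (t.2, t.1 *: t.2) * (u.2, u.1 *: u.2) :> A * A by [].
by congr pair; rewrite /= -scalerAl -scalerAr scalerA.
Qed.

Variable V : set A.
Hypothesis hV : is_subspace V.
Hypothesis VG : forall a b, G (a, b) -> V a -> V b.

(** A stable subspace is stable under polynomials in the operator, and these act on eigenvectors
    through the values of [p]. *)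
Lemma eigensum_poly (s : seq (K * A)) (p : {poly K}) :
  (forall t, t \in s -> G (t.2, t.1 *: t.2)) ->
  V (\sum_(t <- s) t.2) -> V (\sum_(t <- s) p.[t.1] *: t.2).
Proof.
move=> Gs Vs.
have Vi i : V (\sum_(t <- s) t.1 ^+ i *: t.2).
  elim: i => [|i IHi]; first by under eq_bigr do rewrite scale1r.
  apply: VG IHi.
  suff -> : (\sum_(t <- s) t.1 ^+ i *: t.2, \sum_(t <- s) t.1 ^+ i.+1 *: t.2) =
      \sum_(t <- s) ((t.1 ^+ i *: t.2, t.1 ^+ i.+1 *: t.2) : A * A).
    rewrite big_seq; apply: subspace_sum => // t ts.
    have := subspaceZ (t.1 ^+ i) hG (Gs t ts).
    by rewrite exprSr -scalerA.
  by elim: (s) => [|t r IHr]; rewrite ?big_nil // !big_cons -IHr.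
under eq_bigr do rewrite horner_coef scaler_suml.
rewrite exchange_big /=; apply: subspace_sum => // i _.
under eq_bigr do rewrite -scalerA.
by rewrite -scaler_sumr; apply: subspaceZ.
Qed.

(** The polynomial [p] vanishes at the eigenvalues occurring in [y] but not at [c], so it sends v +
    y to a nonzero multiple of [v]. *)
Lemma eigensum_separate (Q : K -> Prop) c v y :
  ~ Q c -> G (v, c *: v) -> eigensum Q y -> V (v + y) -> V v.
Proof.
move=> nQc Gv [s [-> hs]] Vvy; pose p := \prod_(a <- [seq t.1 | t <- s]) ('X - a%:P).
have pc : p.[c] != 0.
  rewrite horner_prod big_map prodf_seq_neq0; apply/allP => t ts /=.
  rewrite hornerXsubC subr_eq0; apply: contra_notN nQc => /eqP ->.
  by case: (hs t ts).
have ps : \sum_(t <- s) p.[t.1] *: t.2 = 0.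
  rewrite big1_seq // => t /andP[_ ts]; rewrite (_ : p.[t.1] = 0) ?scale0r //.
  by apply/eqP; rewrite -[_ == 0]/(root p t.1) root_prod_XsubC map_f.
have := @eigensum_poly ((c, v) :: s) p; rewrite !big_cons ps addr0 /=.
move=> VV; rewrite -[v]scale1r -(mulVf pc) -scalerA; apply: subspaceZ => //.
by apply: VV => // t; rewrite inE => /predU1P[->|/hs[]].
Qed.

(** If [g] vanishes at all the eigenvalues and g(0) is nonzero, then 1 - g/g(0) = p X. So [p] takes
    the value 1/c at each eigenvalue c, and the inverse operator is a polynomial in the operator. *)
Lemma eigensum_inv (s : seq (K * A)) n :
  (forall t, t \in s -> t.1 != 0 /\ G (t.2, t.1 *: t.2)) ->
  V (\sum_(t <- s) t.2) -> V (\sum_(t <- s) t.1 ^- n *: t.2).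
Proof.
move=> hs Vs; pose g := \prod_(a <- [seq t.1 | t <- s]) ('X - a%:P).
have g0 : g.[0] != 0.
  rewrite horner_prod big_map prodf_seq_neq0; apply/allP => t ts /=.
  by rewrite hornerXsubC sub0r oppr_eq0; case: (hs t ts).
have /factor_theorem[p gp] : root (1 - g.[0]^-1 *: g) 0.
  by rewrite /root !hornerE mulVf ?subrr.
have pV t : t \in s -> p.[t.1] = t.1^-1.
  move=> ts; have [t0 _] := hs t ts; apply: (mulIf t0); rewrite mulVf //.
  have := congr1 (horner^~ t.1) gp.
  rewrite /= !hornerE (_ : g.[t.1] = 0) ?mulr0 ?subr0 => [->|] //.
  by apply/eqP; rewrite -[_ == 0]/(root g t.1) root_prod_XsubC map_f.
have := @eigensum_poly s (p ^+ n) (fun t ts => (hs t ts).2) Vs.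
rewrite big_seq; under eq_bigr => t ts do rewrite horner_exp pV // exprVn.
by rewrite -big_seq.
Qed.

End EigenSums.

(** * Cauchon's deleting derivation map *)

Section DeletingMap.
Local Open Scope classical_set_scope.
Local Open Scope ring_scope.
Variables (K : fieldType) (R : algType K) (D : unitAlgType K) (A : set R).
Variables (s t d : R -> R) (q : K) (psi : R -> D) (x : D).
Hypothesis hA : is_subalg A.
Hypothesis hs : alg_automorphism_on A s t.
Hypothesis hd : skew_derivation_on A s d.
Hypothesis d_nilp : forall a, A a -> exists k, iter k d a = 0.
Hypothesis sd : forall a, A a -> s (d a) = q *: d (s a).
Hypothesis q_neq0 : q != 0.
Hypothesis q_nroot : forall k, (0 < k)%N -> q ^+ k != 1.
Hypothesis hpsi : morphism_on A psi.
Hypothesis xu : x \is a GRing.unit.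
Hypothesis xpsi : forall a, A a -> x * psi a = psi (s a) * x + psi (d a).

Let As a : A a -> A (s a).
Proof. by move=> Aa; case: hs => /(_ a Aa)[]. Qed.
Let At a : A a -> A (t a).
Proof. by move=> Aa; case: hs => /(_ a Aa)[]. Qed.
Let Ad a : A a -> A (d a).
Proof. by case: hd => H _ _; apply: H. Qed.
Let ts a : A a -> t (s a) = a.
Proof. by move=> Aa; case: hs => _ /(_ a Aa)[]. Qed.
Let st a : A a -> s (t a) = a.
Proof. by move=> Aa; case: hs => _ /(_ a Aa)[]. Qed.
Let s_lin : linear_on A s.
Proof. by case: hs. Qed.
Let d_lin : linear_on A d.
Proof. by case: hd. Qed.
Let sM a b : A a -> A b -> s (a * b) = s a * s b.
Proof. by case: hs => _ _ _ H _; apply: H. Qed.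
Let dM a b : A a -> A b -> d (a * b) = s a * d b + d a * b.
Proof. by case: hd => _ _; apply. Qed.
Let psi_lin : linear_on A psi.
Proof. by case: hpsi. Qed.
Let psiM a b : A a -> A b -> psi (a * b) = psi a * psi b.
Proof. by case: hpsi => _ H _; apply: H. Qed.

Let s_inj a b : A a -> A b -> s a = s b -> a = b.
Proof. by move=> Aa Ab /(congr1 t); rewrite !ts. Qed.

Let t_lin : linear_on A t.
Proof.
move=> c a b Aa Ab; have Ata := At Aa; have Atb := At Ab.
have AL u v : A u -> A v -> A (c *: u + v).
  by move=> Au Av; apply: subalgD => //; apply: subalgZ.
by apply: s_inj; [exact/At/AL|exact: AL|rewrite st ?s_lin ?st //; apply: AL].
Qed.

Let tM a b : A a -> A b -> t (a * b) = t a * t b.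
Proof.
have AM := subalgM hA.
by move=> Aa Ab; apply: s_inj; rewrite ?sM ?st; auto.
Qed.

Let dt a : A a -> d (t a) = q *: t (d a).
Proof.
move=> Aa; apply: s_inj; [by auto|by apply: subalgZ; auto|].
by rewrite (linear_onZ hA s_lin) ?st ?sd ?st; auto.
Qed.

Definition del_coef k : K := (1 - q) ^- k / qfact q k.

Lemma del_coef0 : del_coef 0 = 1.
Proof. by rewrite /del_coef /qfact big_geq // expr0 invr1 mulr1. Qed.

(** Since (1 - q)(1 + q + ... + q^k) = 1 - q^(k+1). This recurrence is what makes the sums below
    telescope. *)
Lemma del_coefS k : del_coef k = (1 - q ^+ k.+1) * del_coef k.+1.
Proof.
rewrite /del_coef /qfact [\prod_(1 <= l < k.+2) _]big_nat_recr // big_mkord.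
have e : 1 - q ^+ k.+1 = (1 - q) * \sum_(i < k.+1) q ^+ i.
  by rewrite -opprB subrX1 -mulNr opprB.
have : 1 - q ^+ k.+1 != 0 by rewrite subr_eq0 eq_sym q_nroot.
rewrite e mulf_eq0 negb_or => /andP[u v].
rewrite exprS !invfM; move: ((1 - q) ^- k) ((\prod_(1 <= l < k.+1) _)^-1) => y z.
by field; rewrite u v.
Qed.

Definition del_term k a : R := del_coef k *: iter k d (iter k t a).
Local Notation E := del_term.

Lemma iter_closed (u : R -> R) k a :
  (forall b, A b -> A (u b)) -> A a -> A (iter k u a).
Proof. by move=> Au Aa; elim: k => //= k; apply: Au. Qed.

Lemma del_term_closed k a : A a -> A (E k a).
Proof.
by move=> Aa; apply: subalgZ => //; do 2!(apply: iter_closed => //).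
Qed.

Let iter_lin (u : R -> R) k :
  (forall b, A b -> A (u b)) -> linear_on A u -> linear_on A (iter k u).
Proof.
move=> Au lu c a b Aa Ab; elim: k => //= k ->.
by rewrite lu //; apply: iter_closed.
Qed.

Lemma del_term_lin k : linear_on A (E k).
Proof.
move=> c a b Aa Ab; rewrite /E (iter_lin k At t_lin) //.
by rewrite (iter_lin _ Ad d_lin) ?scalerDr ?scalerA 1?mulrC //; apply: iter_closed.
Qed.

Lemma del_term0 a : E 0 a = a.
Proof. by rewrite /E del_coef0 scale1r. Qed.

Let iter_ds k a : A a -> s (iter k d a) = q ^+ k *: iter k d (s a).
Proof.
move=> Aa; elim: k => [|k IHk] /=; first by rewrite scale1r.
have Ak b := @iter_closed d k b Ad.
rewrite sd; last exact: Ak.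
by rewrite IHk (linear_onZ hA d_lin) ?scalerA -?exprS //; auto.
Qed.

Let iter_st k a : A a -> s (iter k t a) = iter k t (s a).
Proof.
move=> Aa; case: k => // k; rewrite iterS st ?iterSr ?ts //.
exact: iter_closed.
Qed.

Lemma s_del_term k a : A a -> s (E k a) = q ^+ k *: E k (s a).
Proof.
move=> Aa; have At' b := @iter_closed t k b At; have Ad' b := @iter_closed d k b Ad.
rewrite /E (linear_onZ hA s_lin); last by auto.
by rewrite iter_ds ?iter_st; [rewrite !scalerA mulrC|auto..].
Qed.

(** The [s] supplies the extra [t] required by the next term. With [s_del_term], this drives both
    the commutation rule and the product rule. *)
Lemma d_del_term k a : A a -> d (E k a) = (1 - q ^+ k.+1) *: E k.+1 (s a).
Proof.
move=> Aa; have At' b := @iter_closed t k b At; have Ad' b := @iter_closed d k b Ad.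
rewrite /E (linear_onZ hA d_lin); last by auto.
by rewrite scalerA -del_coefS iterS iterSr ts.
Qed.

Let nilp_t k n a : A a -> iter n d a = 0 -> iter n d (iter k t a) = 0.
Proof.
move=> Aa na; elim: k => //= k IHk.
have e b : A b -> iter n d (t b) = q ^+ n *: t (iter n d b).
  move=> Ab; elim: (n) => [|m IHm] /=; first by rewrite scale1r.
  have Am c := @iter_closed d m c Ad.
  by rewrite IHm (linear_onZ hA d_lin) ?dt ?scalerA -?exprSr; auto.
by rewrite e ?IHk ?(linear_on0 hA t_lin) ?scaler0 //; apply: iter_closed.
Qed.

Let nilp_le m n a : A a -> iter m d a = 0 -> (m <= n)%N -> iter n d a = 0.
Proof.
move=> Aa ma /subnK <-; rewrite iterD ma; elim: (n - m)%N => //= k ->.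
exact: linear_on0 hA d_lin.
Qed.

Lemma del_term_eq0 n k a : A a -> iter n d a = 0 -> (n <= k)%N -> E k a = 0.
Proof.
by move=> Aa na nk; rewrite /E (nilp_le _ (nilp_t k Aa na) nk) ?scaler0 //;
   apply: iter_closed.
Qed.

(* The divided q-Leibniz rule: with [E k = del_coef k *: d^k t^k], both
   q-binomial coefficients and powers of q cancel. *)
Lemma del_term_mul n a b : A a -> A b ->
  E n (a * b) = \sum_(i < n.+1) E i a * E (n - i) (iter i t b).
Proof.
elim: n a b => [|n IHn] a b Aa Ab.
  by rewrite big_ord_recr big_ord0 /= !del_term0 add0r.
have AM := subalgM hA; have AE := del_term_closed.
have Ait i b' : A b' -> A (iter i t b') by apply: iter_closed.
have nz : 1 - q ^+ n.+1 != 0 by rewrite subr_eq0 eq_sym q_nroot.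
apply: (scalerI nz).
(* This lets the product rule at n + 1 follow by applying [d] to the rule at n. *)
have -> : (1 - q ^+ n.+1) *: E n.+1 (a * b) = d (E n (t a * t b)).
  by rewrite d_del_term -?tM ?st; auto.
pose H i := E i a * E (n.+1 - i) (iter i t b).
rewrite IHn; [|auto..].
rewrite (linear_on_sum hA d_lin n.+1 (F := fun i =>
  E i (t a) * E (n - i) (iter i t (t b)))); last by auto 6.
(* Once both sums are padded by a zero term, H_i has weights q^i - q^(n+1) and 1 - q^i, which add up
   to 1 - q^(n+1). *)
have -> : \sum_(i < n.+1) d (E i (t a) * E (n - i) (iter i t (t b))) =
    \sum_(i < n.+1) (q ^+ i - q ^+ n.+1) *: H i +
    \sum_(i < n.+1) (1 - q ^+ i.+1) *: H i.+1.
  rewrite -big_split; apply: eq_bigr => i _ /=.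
  have lein : (i <= n)%N by rewrite -ltnS.
  rewrite dM; [|auto..].
  rewrite s_del_term ?d_del_term ?st; [|auto..].
  rewrite iter_st ?st; [|auto..].
  rewrite -iterSr /H subSS subSn //; congr (_ + _).
    rewrite -scalerAl -scalerAr scalerA.
    by rewrite mulrBr mulr1 -exprD addnS subnKC.
  by rewrite -scalerAl.
have -> : \sum_(i < n.+1) (1 - q ^+ i.+1) *: H i.+1 =
    \sum_(i < n.+2) (1 - q ^+ i) *: H i.
  by rewrite [RHS]big_ord_recl expr0 subrr scale0r add0r.
have -> : \sum_(i < n.+1) (q ^+ i - q ^+ n.+1) *: H i =
    \sum_(i < n.+2) (q ^+ i - q ^+ n.+1) *: H i.
  by rewrite [RHS]big_ord_recr /= subrr scale0r addr0.
rewrite -big_split scaler_sumr; apply: eq_bigr => i _ /=.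
by rewrite -scalerDl; congr (_ *: _); ring.
Qed.

Definition del_map a : D := \sum_(k \in [set: nat]) psi (E k a) * x ^- k.
Local Notation theta := del_map.

Lemma del_mapE n a : A a -> iter n d a = 0 ->
  theta a = \sum_(k < n) psi (E k a) * x ^- k.
Proof.
move=> Aa na; rewrite (fsbig_ord _ _ (fun k => psi (E k a) * x ^- k)).
apply/esym/fsbig_widen => // k [_ /= /negP]; rewrite -leqNgt => nk.
by rewrite (del_term_eq0 Aa na nk) (linear_on0 hA psi_lin) mul0r.
Qed.

Let nilp2 a b : A a -> A b -> exists n, iter n d a = 0 /\ iter n d b = 0.
Proof.
move=> Aa Ab; have [m ma] := d_nilp Aa; have [n nb] := d_nilp Ab.
exists (maxn m n); split.
  exact: nilp_le ma (leq_maxl _ _).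
exact: nilp_le nb (leq_maxr _ _).
Qed.

Lemma del_map_lin : linear_on A theta.
Proof.
move=> c a b Aa Ab; have [n [na nb]] := nilp2 Aa Ab.
have nab : iter n d (c *: a + b) = 0.
  by rewrite (iter_lin _ Ad d_lin) // na nb scaler0 addr0.
have AE := del_term_closed.
rewrite !(@del_mapE n) //; last by apply: subalgD => //; apply: subalgZ.
rewrite scaler_sumr -big_split; apply: eq_bigr => k _ /=.
by rewrite del_term_lin // psi_lin; auto; rewrite mulrDl scalerAl.
Qed.

(** The derivation is absorbed: the k-th term receives q^k from [s] and 1 - q^k from [d] applied to
    the previous term. *)
Lemma del_map_commute a : A a -> x * theta a = theta (s a) * x.
Proof.
move=> Aa; have [n na] := d_nilp Aa.
have nsa : iter n d (s a) = 0.
  have := iter_ds n Aa; rewrite na (linear_on0 hA s_lin) => /esym/eqP.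
  by rewrite scaler_eq0 expf_eq0 (negPf q_neq0) andbF => /eqP.
have AE := del_term_closed.
rewrite !(@del_mapE n); [|auto..].
pose F k := psi (E k (s a)) * x ^- k * x.
have cxk k : GRing.comm x (x ^- k) by apply/commrV/commrX.
rewrite mulr_suml mulr_sumr.
have -> : \sum_(k < n) x * (psi (E k a) * x ^- k) =
    \sum_(k < n) q ^+ k *: F k + \sum_(k < n) (1 - q ^+ k.+1) *: F k.+1.
  rewrite -big_split; apply: eq_bigr => k _ /=.
  rewrite mulrA xpsi ?s_del_term ?d_del_term //; auto.
  rewrite (linear_onZ hA psi_lin _ (AE k _ (As Aa))).
  rewrite (linear_onZ hA psi_lin _ (AE k.+1 _ (As Aa))).
  rewrite mulrDl -!scalerAl /F; congr (_ *: _ + _ *: _).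
    by rewrite -!mulrA; congr (_ * _); apply: cxk.
  by rewrite exprS invrM ?unitrX // -!mulrA mulVr // mulr1.
have -> : \sum_(k < n) (1 - q ^+ k.+1) *: F k.+1 =
    \sum_(k < n.+1) (1 - q ^+ k) *: F k.
  by rewrite [RHS]big_ord_recl expr0 subrr scale0r add0r.
rewrite big_ord_recr /= [F n]/F (del_term_eq0 _ nsa) //; last by auto.
rewrite (linear_on0 hA psi_lin) !mul0r scaler0 addr0 -big_split.
by apply: eq_bigr => k _ /=; rewrite -scalerDl addrC subrK scale1r.
Qed.

Lemma del_map_commuteX k a : A a -> x ^+ k * theta a = theta (iter k s a) * x ^+ k.
Proof.
move=> Aa; elim: k => [|k IHk]; first by rewrite !expr0 mul1r mulr1.
rewrite exprS -mulrA IHk mulrA del_map_commute ?mulrA //.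
exact: iter_closed.
Qed.

Lemma del_map_commuteV k a : A a -> x ^- k * theta a = theta (iter k t a) * x ^- k.
Proof.
move=> Aa; have Ak := @iter_closed t k _ At Aa.
apply: (mulrI (unitrX k xu)); apply: (mulIr (unitrX k xu)).
rewrite !mulrA divrr ?unitrX // mul1r del_map_commuteX //.
rewrite divrK ?unitrX //; congr (theta _ * _).
elim: (k) => [//|m IHm]; rewrite iterSr iterS st -?IHm //.
by apply: iter_closed.
Qed.

Lemma del_map1 : theta 1 = 1.
Proof.
have A1 := subalg1 hA; have s1 : s 1 = 1 by case: hs.
have d1 : d 1 = 0.
  have := dM A1 A1; rewrite !mulr1 s1 mul1r => /eqP.
  by rewrite -{1}[d 1]addr0 (inj_eq (addrI _)) eq_sym => /eqP.
rewrite (@del_mapE 1) // big_ord_recr big_ord0 /= del_term0 add0r.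
by case: hpsi => _ _ ->; rewrite expr0 invr1 mulr1.
Qed.

Lemma del_mapM a b : A a -> A b -> theta (a * b) = theta a * theta b.
Proof.
move=> Aa Ab; have [n [na nb]] := nilp2 Aa Ab.
have [m nab] := d_nilp (subalgM hA Aa Ab).
have AE := del_term_closed; have AM := subalgM hA.
have Ait i b' : A b' -> A (iter i t b') by apply: iter_closed.
(* [M] bounds the nilpotency order of a b, and the triangle i + l < M contains the square i, l < n
   outside which [F] vanishes. *)
pose M := (maxn m (n + n))%N.
have nM : (n + n <= M)%N by apply: leq_maxr.
pose F i l := psi (E i a) * psi (E l (iter i t b)) * x ^- (i + l).
have F0 i l : (n <= i)%N || (n <= l)%N -> F i l = 0.
  move=> /orP[ni|nl]; first by
    rewrite /F (del_term_eq0 Aa na ni) (linear_on0 hA psi_lin) !mul0r.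
  by rewrite /F (del_term_eq0 _ (nilp_t i Ab nb) nl) ?(linear_on0 hA psi_lin)
    ?mulr0 ?mul0r //; auto.
rewrite (@del_mapE M); [|by auto|by apply: nilp_le nab (leq_maxl _ _); auto].
transitivity (\sum_(k < M) \sum_(i < k.+1) F i (k - i)%N).
  apply: eq_bigr => k _; rewrite del_term_mul //.
  rewrite (linear_on_sum hA psi_lin k.+1 (F := fun i =>
    E i a * E (k - i) (iter i t b))); last by auto.
  rewrite mulr_suml; apply: eq_bigr => i _; rewrite psiM /F; auto.
  by rewrite subnKC // -ltnS.
rewrite sum_triangle (@sum_trunc _ n _ (fun i => \sum_(l < M - i) F i l)); first last.
- by move=> k nk; rewrite big1 // => i _; rewrite F0 ?nk.
- by rewrite (leq_trans _ nM) ?leq_addr.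
rewrite (@del_mapE n a) // mulr_suml; apply: eq_bigr => i _.
rewrite (@sum_trunc _ n _ (F i)); first last.
- by move=> k nk; rewrite F0 ?nk ?orbT.
- by have := ltn_ord i; lia.
rewrite -mulrA del_map_commuteV // (@del_mapE n); [|auto..].
rewrite mulr_suml mulr_sumr; apply: eq_bigr => l _.
by rewrite /F -!mulrA -invrM ?unitrX // -exprD.
Qed.

Lemma del_map_morphism : morphism_on A theta.
Proof. by split; [exact: del_map_lin|exact: del_mapM|exact: del_map1]. Qed.

(** Here [y] is a later generator and [u] its automorphism. The factor l^k from moving [u] past d^k
    cancels the l^-k from moving [y] past x^-k. *)
Lemma del_map_twist (y : D) (u : R -> R) (l : K) : l != 0 -> linear_on A u ->
  (forall a, A a -> [/\ A (u a), u (t a) = t (u a), u (d a) = l *: d (u a)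
    & y * psi a = psi (u a) * y]) ->
  y * x = l *: (x * y) -> forall a, A a -> y * theta a = theta (u a) * y.
Proof.
move=> l0 u_lin hu yx a Aa; have AE := del_term_closed.
have Ait i b' : A b' -> A (iter i t b') by apply: iter_closed.
have Aid i b' : A b' -> A (iter i d b') by apply: iter_closed.
have Au b : A b -> A (u b) by move=> /hu[].
have [n [na nua]] := nilp2 Aa (Au _ Aa).
have uE k : u (E k a) = l ^+ k *: E k (u a).
  rewrite /E (linear_onZ hA u_lin); last by auto.
  rewrite [RHS]scalerA [_ * del_coef k]mulrC -[RHS]scalerA; congr (_ *: _).
  have -> : iter k t (u a) = u (iter k t a).
    by elim: (k) => //= i ->; case: (hu (iter i t a)); auto.
  have := Ait k a Aa; move: (iter k t a) => b Ab.
  elim: (k) => /= [|i IHi]; first by rewrite scale1r.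
  have Aib := Aid i b Ab; case: (hu _ Aib) => _ _ -> _.
  by rewrite IHi (linear_onZ hA d_lin) ?scalerA -?exprS //; auto.
have yxV k : y * x ^- k = l ^- k *: (x ^- k * y).
  apply: (mulIr (unitrX k xu)); rewrite divrK ?unitrX //.
  apply: (mulrI (unitrX k xu)); rewrite -scalerAl -scalerAr !mulrA.
  rewrite divrr ?unitrX // mul1r.
  suff -> : y * x ^+ k = l ^+ k *: (x ^+ k * y).
    by rewrite scalerA mulVf ?scale1r // expf_neq0.
  elim: (k) => [|i IHi]; first by rewrite !expr0 mulr1 mul1r scale1r.
  rewrite [x ^+ i.+1]exprSr mulrA IHi -scalerAl -[_ * y * x]mulrA yx.
  by rewrite -scalerAr scalerA mulrA -!exprSr.
rewrite !(@del_mapE n); [|by auto..].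
rewrite mulr_suml mulr_sumr; apply: eq_bigr => k _.
case: (hu (E k a)) => [|_ _ _ e]; first by auto.
rewrite mulrA e -mulrA yxV uE (linear_onZ hA psi_lin); last by auto.
rewrite -scalerAr -scalerAl scalerA mulVf ?scale1r ?mulrA //.
by rewrite expf_neq0.
Qed.

(* The inverse formula psi a = theta a + sum_(k > 0) theta (b k) * x ^- k, with
   all the b k in the image of d. *)
Lemma del_map_inverse (V : set D) n a : is_subspace V -> A a ->
  iter n d a = 0 ->
  (forall k b, (0 < k < n)%N -> A b -> V (theta (d b) * x ^- k)) ->
  V (psi a - theta a).
Proof.
move: {2}n (leqnn n) => m; elim: m n a V => [|m IHm] n a V nm hV Aa na VV.
  move: nm na; rewrite leqn0 => /eqP -> /= ->.
  by rewrite (linear_on0 hA psi_lin) (linear_on0 hA del_map_lin) subrr;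
    case: hV.
case: n => [|n] in nm na VV *.
  rewrite /= in na; rewrite na.
  by rewrite (linear_on0 hA psi_lin) (linear_on0 hA del_map_lin) subrr;
    case: hV.
have AE := del_term_closed.
rewrite (del_mapE Aa na) big_ord_recl expr0 invr1 mulr1 del_term0.
rewrite opprD addrA subrr add0r; apply: subspaceN => //.
apply: subspace_sum => // k _ /=; rewrite /bump /= add1n.
(* The witness inverts [d_del_term], applied to [t a]. *)
have [b Ab eb] : exists2 b, A b & E k.+1 a = d b.
  exists ((1 - q ^+ k.+1)^-1 *: E k (t a)); first by apply: subalgZ; auto.
  rewrite (linear_onZ hA d_lin) ?d_del_term ?st; [|by auto..].
  by rewrite scalerA mulVf ?scale1r // subr_eq0 eq_sym q_nroot.
(* The correction terms have a smaller nilpotency order, so they can be expanded by induction; [W]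
   below carries the factor x^-(k+1). *)
have nE : iter (n - k) d (E k.+1 a) = 0.
  have Ait i b' : A b' -> A (iter i t b') by apply: iter_closed.
  have Aid i b' : A b' -> A (iter i d b') by apply: iter_closed.
  rewrite /E (linear_onZ hA (iter_lin _ Ad d_lin)); last by auto.
  rewrite -iterD (_ : (n - k + k.+1 = n.+1)%N); last by have := ltn_ord k; lia.
  by rewrite (nilp_t _ Aa na) scaler0.
rewrite -[psi _](subrK (theta (E k.+1 a))) mulrDl.
apply: subspaceD => //; last first.
  rewrite eb. apply: (VV k.+1) => //; exact: ltn_ord.
pose W := [set e | V (e * x ^- k.+1)].
rewrite -/(W _); apply: (IHm _ _ W _ _ (AE k.+1 a Aa) nE).
- by rewrite (leq_trans (leq_subr _ _)).
- split; first by rewrite /W /= mul0r; case: hV.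
  by move=> c u v Wu Wv; rewrite /W /= mulrDl -scalerAl; case: hV => _; apply.
move=> i c ik Ac; rewrite /W /= -mulrA -invrM ?unitrX // -exprD.
by apply: VV => //; have := ltn_ord k; lia.
Qed.

Lemma psi_in_del_alg (S : set D) a : is_subalg S -> S x ->
  (forall b, A b -> S (theta b)) -> A a -> exists n, S (psi a * x ^+ n).
Proof.
move=> hS Sx St Aa; have [n na] := d_nilp Aa; exists n.
rewrite -[psi a](subrK (theta a)) mulrDl; apply: subalgD => //; last first.
  by apply: subalgM; auto; apply: subalgX.
pose W := [set e | S (e * x ^+ n)]; rewrite -/(W _).
apply: (@del_map_inverse W n a _ Aa na) => [|k b /andP[_ kn] Ab].
  split; first by rewrite /W /= mul0r; apply: subalg0.
  move=> c u v Wu Wv; rewrite /W /= mulrDl -scalerAl.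
  by apply: subalgD => //; apply: subalgZ.
rewrite /W /= -mulrA -(subnKC (ltnW kn)) exprD mulKr ?unitrX //.
by apply: subalgM; auto; apply: subalgX.
Qed.

(** [theta a] and [psi a] differ by negative powers of [x]. After multiplication by a large x^M, the
    theta-sum has the leading term of the psi-sum, so the top coefficient vanishes. *)
Lemma del_map_free :
  (forall n (a : nat -> R), (forall k, A (a k)) ->
     \sum_(k < n) psi (a k) * x ^+ k = 0 -> forall k, (k < n)%N -> a k = 0) ->
  forall n (a : nat -> R), (forall k, A (a k)) ->
     \sum_(k < n) theta (a k) * x ^+ k = 0 -> forall k, (k < n)%N -> a k = 0.
Proof.
move=> free; elim=> [//|n IHn] a Aa e0.
have [M hM] : exists M, forall k, (k < n.+1)%N -> iter M d (a k) = 0.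
  elim: (n.+1) => [|m [M hM]]; first by exists 0%N.
  have [i ia] := d_nilp (Aa m); exists (maxn i M) => k.
  rewrite ltnS leq_eqVlt => /predU1P[->|/hM na].
    exact: nilp_le ia (leq_maxl _ _).
  exact: nilp_le na (leq_maxr _ _).
have AE := del_term_closed.
pose L m : set D := [set e | exists b : nat -> R,
  (forall k, A (b k)) /\ e = \sum_(k < m) psi (b k) * x ^+ k].
have Lsub m : is_subspace (L m).
  split.
    exists (fun=> 0); split=> [k|]; first exact: subalg0.
    by rewrite big1 // => k _; rewrite (linear_on0 hA psi_lin) mul0r.
  move=> c _ _ [b [Ab ->]] [b' [Ab' ->]]; exists (fun k => c *: b k + b' k).
  split=> [k|]; first by apply: subalgD => //; apply: subalgZ.
  rewrite scaler_sumr -big_split; apply: eq_bigr => k _ /=.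
  by rewrite psi_lin // mulrDl scalerAl.
have Lterm m k b : (k < m)%N -> A b -> L m (psi b * x ^+ k).
  move=> km Ab; exists (fun i => if i == k then b else 0); split=> [i|].
    by case: eqP => // _; apply: subalg0.
  rewrite (bigD1 (Ordinal km)) //= eqxx big1 ?addr0 // => i.
  by rewrite -val_eqE /= => /negPf ->; rewrite (linear_on0 hA psi_lin) mul0r.
have low k : (k < n.+1)%N -> L (k + M)%N ((theta (a k) - psi (a k)) * x ^+ (k + M)).
  move=> kn; rewrite (del_mapE (Aa k) (hM k kn)).
  case: M => [|M] in hM *.
    rewrite big_ord0 -(del_term0 (a k)) (del_term_eq0 (Aa k) (hM k kn)) //.
    by rewrite (linear_on0 hA psi_lin) subrr mul0r; case: (Lsub (k + 0)%N).
  rewrite big_ord_recl expr0 invr1 mulr1 del_term0 addrC addKr mulr_suml.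
  apply: subspace_sum => // i _ /=; rewrite /bump /= add1n -mulrA.
  have le : (i.+1 <= k + M.+1)%N.
    by rewrite (leq_trans _ (leq_addl _ _)) // ltnS ltnW.
  rewrite -{2}(subnKC le) exprD mulKr ?unitrX //; apply: Lterm; auto.
  by rewrite ltn_subrL /= addnS.
have an : a n = 0.
  have [b [Ab eb]] : L (n + M)%N (- (psi (a n) * x ^+ (n + M))).
    rewrite -[- _]add0r -(mul0r (x ^+ M)) -e0 big_ord_recr /= mulrDl.
    rewrite -addrA -[theta _ * _ * _]mulrA -exprD -mulrBl mulr_suml.
    apply: subspaceD => //; last exact: low.
    apply: subspace_sum => // k _; rewrite -mulrA -exprD.
    rewrite -[theta _](subrK (psi (a k))) mulrDl.
    apply: subspaceD => //; last first.
      by apply: Lterm => //; rewrite ltn_add2r.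
    have [|b [Ab ->]] := low k; first by rewrite ltnS ltnW.
    apply: subspace_sum => // i _; apply: Lterm => //.
    by rewrite (leq_trans (ltn_ord i)) // leq_add2r ltnW.
  have := @free (n + M).+1 (fun k => if k == (n + M)%N then a n else b k).
  move=> /(_ _ _ (n + M)%N); rewrite eqxx; apply=> //.
    by move=> k; case: eqP.
  rewrite big_ord_recr /= eqxx; apply/eqP; rewrite addr_eq0 eb; apply/eqP.
  apply: eq_bigr => k _; rewrite ifN // neq_ltn.
  by rewrite ltn_ord.
move=> k; rewrite ltnS leq_eqVlt => /predU1P[->//|kn].
apply: IHn kn => //.
by move: e0; rewrite big_ord_recr /= an (linear_on0 hA del_map_lin) mul0r addr0.
Qed.

End DeletingMap.

(** * The levels of the algorithm *)

Section Levels.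
Local Open Scope classical_set_scope.
Local Open Scope ring_scope.
Variables (K : fieldType) (R : algType K) (N : nat) (C : cgl_extension R N).
Variables (D : unitAlgType K).
Hypothesis D_field : forall y : D, y != 0 -> y \is a GRing.unit.

Local Notation X := (cgl_X C).
Local Notation sigma := (cgl_sigma C).
Local Notation sigmaV := (cgl_sigmaV C).
Local Notation delta := (cgl_delta C).
Local Notation q := (cgl_q C).
Local Notation lambda := (cgl_lambda C).
Local Notation Rm := (initial_subalg X).

Let RmP m : is_subalg (Rm m) := initial_subalgP X m.

Let RmS (j : 'I_N) a : Rm j a -> Rm j.+1 a.
Proof. exact: initial_subalg_le. Qed.

Let RX (j : 'I_N) : Rm j.+1 (X j).
Proof. exact: initial_subalg_gen. Qed.

Lemma sigma_auto (j : 'I_N) :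
  alg_automorphism_on (Rm j) (sigma j) (sigmaV j).
Proof. by case: (cgl_ore C j) => _ []. Qed.

Lemma delta_der (j : 'I_N) : skew_derivation_on (Rm j) (sigma j) (delta j).
Proof. by case: (cgl_ore C j) => _ []. Qed.

Lemma oreX (j : 'I_N) a : Rm j a -> X j * a = sigma j a * X j + delta j a.
Proof. by case: (cgl_ore C j) => _ _ H _ _; apply: H. Qed.

Lemma sigma_morphism (j : 'I_N) : morphism_on (Rm j) (sigma j).
Proof. by case: (sigma_auto j). Qed.

Lemma sigma_initial (l : 'I_N) m a :
  (m <= l)%N -> Rm m a -> Rm m (sigma l a).
Proof.
move=> ml Ra; have [slin sM s1] := sigma_morphism l.
suff : [set a | Rm l a /\ Rm m (sigma l a)] a by case.
move: a Ra; apply: initial_subalg_sub => [|i im].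
  apply/is_subalgP; split=> [|c u v [Ru su] [Rv sv]|u v [Ru su] [Rv sv]].
  - by rewrite /= s1; split; apply: (subalg1 (initial_subalgP _ _)).
  - split; first by apply: (subalgD (initial_subalgP _ _)) => //;
      apply: (subalgZ _ (initial_subalgP _ _)).
    by rewrite slin //; apply: (subalgD (initial_subalgP _ _)) => //;
      apply: (subalgZ _ (initial_subalgP _ _)).
  - by split; [apply: (subalgM (initial_subalgP _ _))|rewrite sM //;
      apply: (subalgM (initial_subalgP _ _))].
have il : (i < l)%N by apply: leq_trans ml.
split; first exact: initial_subalg_gen.
by rewrite cgl_sigma_X //; apply: (subalgZ _ (initial_subalgP _ _)) => //;
  apply: initial_subalg_gen.
Qed.

Lemma sigma_comm (j l : 'I_N) a : (j < l)%N -> Rm j a ->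
  sigma l (sigma j a) = sigma j (sigma l a).
Proof.
move=> jl Ra; have [jlin jM j1] := sigma_morphism j.
have [llin lM l1] := sigma_morphism l.
have jR b : Rm j b -> Rm j (sigma j b) by apply: sigma_initial.
have lR b : Rm j b -> Rm j (sigma l b) by apply: sigma_initial; apply: ltnW.
have up b : Rm j b -> Rm l b by apply: initial_subalg_le; apply: ltnW.
suff : [set a | Rm j a /\ sigma l (sigma j a) = sigma j (sigma l a)] a by case.
move: a Ra; apply: initial_subalg_sub => [|i ij].
  apply/is_subalgP; split=> [|c u v [Ru su] [Rv sv]|u v [Ru su] [Rv sv]].
  - by rewrite /= j1 l1 j1; split=> //; apply: (subalg1 (initial_subalgP _ _)).
  - split; first by apply: (subalgD (initial_subalgP _ _)) => //;
      apply: (subalgZ _ (initial_subalgP _ _)).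
    by rewrite jlin // !llin ?jlin ?su ?sv //; auto.
  - split; first exact: (subalgM (initial_subalgP _ _)).
    by rewrite jM // !lM ?jM ?su ?sv //; auto.
have RXi : Rm j (X i) by apply: initial_subalg_gen.
have il := ltn_trans ij jl.
split=> //; rewrite !cgl_sigma_X //.
rewrite (linear_onZ (RmP l) llin) ?(linear_onZ (RmP j) jlin) //; auto.
by rewrite !cgl_sigma_X // !scalerA mulrC.
Qed.

(** Apply [sigma l] to the relation between X_j and [a], and compare with the relation between X_j
    and [sigma l a]. *)
Lemma sigma_delta_comm (j l : 'I_N) a : (j < l)%N -> Rm j a ->
  sigma l (delta j a) = lambda l j *: delta j (sigma l a).
Proof.
move=> jl Ra; have [llin lM l1] := sigma_morphism l.
have up b : Rm j b -> Rm l b by apply: initial_subalg_le; apply: ltnW.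
have lR b : Rm j b -> Rm j (sigma l b) by apply: sigma_initial; apply: ltnW.
have RlX : Rm l (X j) by apply: initial_subalg_gen.
have jR b : Rm j b -> Rm j (sigma j b) by apply: sigma_initial.
have dR : Rm j (delta j a) by case: (delta_der j) => H _ _; apply: H.
have := congr1 (sigma l) (oreX Ra).
rewrite lM ?(linear_onD llin) ?lM //; auto; last first.
  by apply: (subalgM (initial_subalgP _ _)); auto.
rewrite cgl_sigma_X // -scalerAl oreX; last exact: lR.
by rewrite scalerDr -scalerAr (sigma_comm jl Ra) => /addrI.
Qed.

(* The structure at level m of the deleting derivations algorithm: psi identifies
   R_m with the algebra generated by the first m generators, over which the
   remaining ones form an iterated Ore extension without derivations. *)
Record level m (Y : 'I_N -> D) (psi : R -> D) : Prop := Level {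
  level_morphism : morphism_on (Rm m) psi;
  level_inj : forall a, Rm m a -> psi a = 0 -> a = 0;
  level_gen : forall i : 'I_N, (i < m)%N -> Y i = psi (X i);
  level_comm : forall l i : 'I_N, (m <= l)%N -> (i < l)%N ->
    Y l * Y i = lambda l i *: (Y i * Y l);
  level_free : forall l : 'I_N, (m <= l)%N -> forall n (u : nat -> D),
    (forall k, initial_subalg Y l (u k)) ->
    \sum_(k < n) Y l ^+ k * u k = 0 -> forall k, (k < n)%N -> u k = 0 }.

Lemma initial_image m (Y : 'I_N -> D) psi : morphism_on (Rm m) psi ->
  (forall i : 'I_N, (i < m)%N -> Y i = psi (X i)) ->
  forall b, initial_subalg Y m b <-> exists2 a, Rm m a & b = psi a.
Proof.
move=> [plin pM p1] YX b; split.
  move: b; apply: (@initial_subalg_sub _ _ _ Y m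
    [set b | exists2 a, Rm m a & b = psi a]).
    apply/is_subalgP; split=> [|c _ _ [u Ru ->] [v Rv ->]|_ _ [u Ru ->] [v Rv ->]].
    - by exists 1; rewrite ?p1 //; apply: (subalg1 (initial_subalgP _ _)).
    - exists (c *: u + v); last by rewrite plin.
      by apply: (subalgD (initial_subalgP _ _)) => //;
        apply: (subalgZ _ (initial_subalgP _ _)).
    - by exists (u * v); rewrite ?pM //; apply: (subalgM (initial_subalgP _ _)).
  by move=> i im; exists (X i); [exact: initial_subalg_gen|exact: YX].
move=> [a Ra ->].
suff : [set a | Rm m a /\ initial_subalg Y m (psi a)] a by case.
move: a Ra; apply: initial_subalg_sub => [|i im].
  apply/is_subalgP; split=> [|c u v [Ru su] [Rv sv]|u v [Ru su] [Rv sv]].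
  - by rewrite /= p1; split; apply: (subalg1 (initial_subalgP _ _)).
  - split; first by apply: (subalgD (initial_subalgP _ _)) => //;
      apply: (subalgZ _ (initial_subalgP _ _)).
    by rewrite plin //; apply: (subalgD (initial_subalgP _ _)) => //;
      apply: (subalgZ _ (initial_subalgP _ _)).
  - by split; [apply: (subalgM (initial_subalgP _ _))|rewrite pM //;
      apply: (subalgM (initial_subalgP _ _))].
split; first exact: initial_subalg_gen.
by rewrite -YX //; apply: initial_subalg_gen.
Qed.

Lemma level_initialP m Y psi : level m Y psi ->
  forall b, initial_subalg Y m b <-> exists2 a, Rm m a & b = psi a.
Proof.
by move=> hl; apply: initial_image; [apply: level_morphism hl|apply: level_gen hl].
Qed.

Lemma level_twist m Y psi (l : 'I_N) a : level m Y psi -> (m <= l)%N ->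
  Rm m a -> Y l * psi a = psi (sigma l a) * Y l.
Proof.
move=> hl ml Ra; have [plin pM p1] := level_morphism hl.
have [llin lM l1] := sigma_morphism l.
have up b : Rm m b -> Rm l b by apply: initial_subalg_le.
have lR b : Rm m b -> Rm m (sigma l b) by apply: sigma_initial.
suff : [set a | Rm m a /\ Y l * psi a = psi (sigma l a) * Y l] a by case.
move: a Ra; apply: initial_subalg_sub => [|i im].
  apply/is_subalgP; split=> [|c u v [Ru su] [Rv sv]|u v [Ru su] [Rv sv]].
  - by rewrite /= l1 p1 mulr1 mul1r; split=> //; apply: (subalg1 (initial_subalgP _ _)).
  - split; first by apply: (subalgD (initial_subalgP _ _)) => //;
      apply: (subalgZ _ (initial_subalgP _ _)).
    rewrite llin ?plin; auto.
    by rewrite mulrDl mulrDr -scalerAl -scalerAr su sv.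
  - split; first exact: (subalgM (initial_subalgP _ _)).
    by rewrite lM ?pM; auto; rewrite mulrA su -mulrA sv mulrA.
have RXi : Rm m (X i) by apply: initial_subalg_gen.
split=> //; have il := leq_trans im ml.
rewrite cgl_sigma_X // (linear_onZ (RmP m) plin) // -(level_gen hl) //.
by rewrite (level_comm hl) // scalerAl.
Qed.

(** * Deleting one derivation: from level j + 1 to level j *)

Section Step.
Variables (j : 'I_N) (Y : 'I_N -> D) (psi : R -> D).
Hypothesis j_gt0 : (0 < j)%N.
Hypothesis hl : level j.+1 Y psi.

Local Notation x := (Y j).
Local Notation A := (Rm j).

Lemma step_X_neq0 : x != 0.
Proof.
apply/eqP; rewrite (level_gen hl) // => /(level_inj hl (@RX j)) /eqP.
by case: (cgl_eigenvectors C j) => /negPf ->.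
Qed.

Lemma step_unit : x \is a GRing.unit.
Proof. exact/D_field/step_X_neq0. Qed.

Lemma step_psi_morphism : morphism_on A psi.
Proof.
have [plin pM p1] := level_morphism hl.
by split=> // [c a b Aa Ab|a b Aa Ab]; [apply: plin|apply: pM]; apply: RmS.
Qed.

Lemma step_psiX a : A a -> x * psi a = psi (sigma j a) * x + psi (delta j a).
Proof.
move=> Aa; have [plin pM p1] := level_morphism hl.
have dR : A (delta j a) by case: (delta_der j) => H _ _; apply: H.
have sR : A (sigma j a) by apply: sigma_initial.
rewrite (level_gen hl) // -!pM; auto.
by rewrite oreX // (linear_onD plin); auto; apply: (subalgM (initial_subalgP _ _));
  auto.
Qed.

Definition step_map : R -> D := del_map (sigmaV j) (delta j) (q j) psi x.
Local Notation theta := step_map.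
Definition step_gen : 'I_N -> D := deleting_step C j Y.
Local Notation Y' := step_gen.

Let nilpj a : A a -> exists k, iter k (delta j) a = 0.
Proof. exact: cgl_locally_nilpotent. Qed.
Let sdj a : A a -> sigma j (delta j a) = q j *: delta j (sigma j a).
Proof. exact: cgl_sigma_delta. Qed.
Let q0j : q j != 0.
Proof. exact: cgl_q_neq0. Qed.
Let qnj k : (0 < k)%N -> q j ^+ k != 1.
Proof. exact: cgl_q_not_root_of_unity. Qed.

Lemma step_map_morphism : morphism_on A theta.
Proof.
exact: (del_map_morphism (RmP j) (sigma_auto j) (delta_der j) nilpj sdj q0j qnj
  step_psi_morphism step_unit step_psiX).
Qed.

Lemma step_map_commute a : A a -> x * theta a = theta (sigma j a) * x.
Proof.
exact: (del_map_commute (RmP j) (sigma_auto j) (delta_der j) nilpj sdj q0j qnj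
  step_psi_morphism step_unit step_psiX).
Qed.

Lemma step_map_commuteX k a :
  A a -> x ^+ k * theta a = theta (iter k (sigma j) a) * x ^+ k.
Proof.
exact: (del_map_commuteX (RmP j) (sigma_auto j) (delta_der j) nilpj sdj q0j qnj
  step_psi_morphism step_unit step_psiX).
Qed.

Lemma step_psi_free n (a : nat -> R) : (forall k, A (a k)) ->
  \sum_(k < n) psi (a k) * x ^+ k = 0 -> forall k, (k < n)%N -> a k = 0.
Proof.
move=> Aa e; have [plin pM p1] := level_morphism hl.
have RjX : Rm j.+1 (X j) := @RX j.
have RXk k : Rm j.+1 (X j ^+ k) := subalgX k (RmP _) RjX.
have pX k : psi (X j ^+ k) = x ^+ k.
  elim: k => [|k IHk]; first by rewrite !expr0.
  by rewrite !exprS pM // IHk (level_gen hl).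
have [_ _ _ _ free] := cgl_ore C j; apply: (free n) => //.
have RaX k : Rm j.+1 (a k * X j ^+ k).
  by apply: (subalgM (initial_subalgP _ _)) => //; apply: RmS.
apply: (level_inj hl).
  by apply: (subspace_sum _ (subalg_subspace (RmP _))).
rewrite (linear_on_sum (RmP _) plin n (F := fun k => a k * X j ^+ k)) //.
rewrite -[RHS]e; apply: eq_bigr => k _.
by rewrite pM ?pX //; apply: RmS.
Qed.

Lemma step_map_free n (a : nat -> R) : (forall k, A (a k)) ->
  \sum_(k < n) theta (a k) * x ^+ k = 0 -> forall k, (k < n)%N -> a k = 0.
Proof.
exact: (del_map_free (RmP j) (sigma_auto j) (delta_der j) nilpj sdj
  step_psi_morphism step_unit step_psi_free).
Qed.

Lemma step_psi_denom (S : set D) a : is_subalg S -> S x ->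
  (forall b, A b -> S (theta b)) -> A a -> exists n, S (psi a * x ^+ n).
Proof.
exact: (psi_in_del_alg (RmP j) (sigma_auto j) (delta_der j) nilpj sdj q0j qnj
  step_psi_morphism step_unit).
Qed.

Lemma step_map_inverse (V : set D) a : is_subspace V -> A a ->
  (forall k b, (0 < k)%N -> A b -> V (theta (delta j b) * x ^- k)) ->
  V (psi a - theta a).
Proof.
move=> hV Aa hVt; have [n na] := nilpj Aa.
apply: (del_map_inverse (RmP j) (sigma_auto j) (delta_der j) nilpj sdj q0j qnj
  step_psi_morphism step_unit hV Aa na) => k b /andP[k0 _] Ab.
exact: hVt.
Qed.

Lemma step_graphP a b :
  morph_graph [set i : 'I_N | (i < j)%N] X Y (a, b) <-> A a /\ b = psi a.
Proof.
have [plin pM p1] := step_psi_morphism.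
split.
  pose S : set (R * D) := [set ab | A ab.1 /\ ab.2 = psi ab.1].
  suff /(_ (a, b)) : morph_graph [set i : 'I_N | (i < j)%N] X Y `<=` S by [].
  apply: subalg_gen_sub.
    apply/is_subalgP; split=> [|c [u u'] [v v'] [/= Ru ->] [/= Rv ->]|
        [u u'] [v v'] [/= Ru ->] [/= Rv ->]].
    - by split=> /=; rewrite ?p1 //; apply: (subalg1 (RmP j)).
    - split=> /=; last by rewrite plin.
      by apply: (subalgD (RmP j)) => //; apply: (subalgZ _ (RmP j)).
    - by split=> /=; rewrite ?pM //; apply: (subalgM (RmP j)).
  move=> _ [i ij <-]; split; first exact: initial_subalg_gen.
  by apply: (level_gen hl); apply: leqW.
move=> [Aa ->].
suff : [set a | A a /\ morph_graph [set i : 'I_N | (i < j)%N] X Y (a, psi a)] a.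
  by case.
pose G := [set (X i, Y i) | i in [set i : 'I_N | (i < j)%N]].
have GP := subalg_genP G.
move: a Aa; apply: initial_subalg_sub => [|i ij].
  apply/is_subalgP; split=> [|c u v [Ru su] [Rv sv]|u v [Ru su] [Rv sv]].
  - by rewrite /= p1; split; [apply: (subalg1 (initial_subalgP _ _))|
      exact: (subalg1 GP)].
  - split; first by apply: (subalgD (initial_subalgP _ _)) => //;
      apply: (subalgZ _ (initial_subalgP _ _)).
    by rewrite plin //; exact: (subalgD GP (subalgZ c GP su) sv).
  - by split; [apply: (subalgM (initial_subalgP _ _))|rewrite pM //;
      exact: (subalgM GP su sv)].
split; first exact: initial_subalg_gen.
apply: mem_subalg_gen; exists i => //; rewrite (level_gen hl) //.
exact: leqW.
Qed.

Lemma step_genE (i : 'I_N) : (i < j)%N -> Y' i = theta (X i).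
Proof.
move=> ij; have [plin pM p1] := step_psi_morphism.
rewrite /Y' /deleting_step ij /theta /del_map.
apply: eq_fsbigr => k _.
have AX : A (X i) by apply: initial_subalg_gen.
have sR b : A b -> A (sigmaV j b) by case: (sigma_auto j) => H _ _ _ _ /H[].
have dR b : A b -> A (delta j b) by case: (delta_der j) => H _ _; apply: H.
have AE : A (iter k (delta j) (iter k (sigmaV j) (X i))).
  exact: (iter_closed k dR (iter_closed k sR AX)).
rewrite /del_term (linear_onZ (RmP j) plin) // -scalerAl; congr (_ *: (_ * _)).
(* The choice is forced: the relation is the graph of the injective map [psi], so [X i] is the only
   element sent to [Y i]. *)
rewrite /transport; apply: xget_unique => [|z /=].
  exists (X i); apply/step_graphP; split=> //=.
  by apply: (level_gen hl); apply: leqW.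
move=> [a /step_graphP[Aa ya] /step_graphP[_ /= ->]].
suff -> : a = X i by [].
apply/eqP; rewrite -subr_eq0; apply/eqP/(level_inj hl).
  by apply: RmS; apply: (subalgB (RmP j)).
by rewrite (linear_onB plin) // -ya (level_gen hl) ?subrr // leqW.
Qed.

Lemma step_gen_ge (i : 'I_N) : (j <= i)%N -> Y' i = Y i.
Proof. by move=> ji; rewrite /Y' /deleting_step ltnNge ji. Qed.

Lemma step_comm (l i : 'I_N) : (j <= l)%N -> (i < l)%N ->
  Y' l * Y' i = lambda l i *: (Y' i * Y' l).
Proof.
move=> jl il; have [tlin _ _] := step_map_morphism.
rewrite (step_gen_ge jl).
have [ij|ji] := ltnP i j; last first.
  rewrite (step_gen_ge ji) (level_comm hl) //.
  exact: leq_ltn_trans il.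
have AX : A (X i) by apply: initial_subalg_gen.
rewrite step_genE //.
suff -> : Y l * theta (X i) = theta (sigma l (X i)) * Y l.
  by rewrite cgl_sigma_X // (linear_onZ (RmP j) tlin) // scalerAl.
have [lj|lj] := eqVneq l j; first by rewrite lj step_map_commute.
have {lj}jl : (j < l)%N by rewrite ltn_neqAle jl andbT eq_sym.
have up b : A b -> Rm l b by apply: initial_subalg_le; apply: ltnW.
have [llin lM l1] := sigma_morphism l.
have lR b : A b -> A (sigma l b) by apply: sigma_initial; apply: ltnW.
apply: (del_map_twist (RmP j) (sigma_auto j) (delta_der j) nilpj sdj
  step_psi_morphism step_unit (cgl_lambda_neq0 C jl) _ _ (level_comm hl jl jl)) => //.
  by move=> c a b Aa Ab; apply: llin; auto.
move=> a Aa; split; [by auto| |exact: sigma_delta_comm|]; last first.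
  by apply: (level_twist hl) => //; apply: RmS.
have [sR sK _ _ _] := sigma_auto j.
have Ata : A (sigmaV j a) by case: (sR a Aa).
rewrite -(sK _ (lR _ Ata)).1; congr (sigmaV j _).
by rewrite -sigma_comm // (sK a Aa).2.
Qed.

(** After the deletion [x] commutes with every generator up to a scalar. Moving powers of [x] across
    elements of the lower level rests on this. *)
Lemma step_normal (i : 'I_N) :
  exists2 mu, mu != 0 & x * Y' i = mu *: (Y' i * x).
Proof.
have xY : Y' j = x by apply: step_gen_ge.
have [ij|ji|ij] := ltngtP i j.
- exists (lambda j i); first exact: cgl_lambda_neq0.
  by rewrite -{1}xY step_comm // xY.
- exists (lambda i j)^-1; first by rewrite invr_eq0 cgl_lambda_neq0.
  rewrite -xY (step_comm (ltnW ji) ji) scalerA mulVf ?scale1r //.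
  exact: cgl_lambda_neq0.
- by exists 1; rewrite ?oner_eq0 // (val_inj ij) xY scale1r.
Qed.

(* Membership in M is arranged so as to be stable under products: the
   denominators of a left factor get absorbed in the conjugation of the right
   one. *)
Lemma step_gen_denom l b : (j < l)%N -> initial_subalg Y' l b ->
  exists n, initial_subalg Y l (b * x ^+ n).
Proof.
move=> jl; set L := initial_subalg Y l => Lb.
have hL : is_subalg L := initial_subalgP Y l.
have Lx : L x by apply: initial_subalg_gen.
have ux := step_unit; have LX n : L (x ^+ n) := subalgX n hL Lx.
pose M := [set b | forall k, exists n, L (x ^- k * b * x ^+ (k + n))].
suff /(_ b Lb 0%N)[n] : initial_subalg Y' l `<=` M.
  by rewrite expr0 invr1 mul1r; exists n.
apply: initial_subalg_sub => [|i il k].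
  apply/is_subalgP; split=> [k|c u v Mu Mv k|u v Mu Mv k].
  - by exists 0%N; rewrite mulr1 addn0 mulVr ?unitrX //; apply: (subalg1 hL).
  - have [m Lu] := Mu k; have [n Lv] := Mv k; exists (m + n)%N.
    rewrite mulrDr mulrDl -scalerAr -scalerAl.
    apply: (subalgD hL) => //; first apply: (subalgZ _ hL) => //.
      by rewrite addnA exprD mulrA; apply: (subalgM hL).
    by rewrite [(m + n)%N]addnC addnA exprD mulrA; apply: (subalgM hL).
  - have [m Lu] := Mu k; have [n Lv] := Mv (k + m)%N; exists (m + n)%N.
    rewrite (_ : _ * _ = x ^- k * u * x ^+ (k + m) *
      (x ^- (k + m) * v * x ^+ (k + m + n))); first exact: (subalgM hL).
    by rewrite addnA !mulrA mulrK ?unitrX.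
have [mu mu0 xY] := step_normal i.
have [n Ln] : exists n, L (Y' i * x ^+ n).
  have [ij|ji] := ltnP i j; last first.
    exists 0%N; rewrite mulr1 step_gen_ge //.
    exact: initial_subalg_gen.
  have AX : A (X i) by apply: initial_subalg_gen.
  have [n na] := nilpj AX; exists n.
  rewrite step_genE // /theta (del_mapE x (RmP j) (sigma_auto j) (delta_der j) sdj
    step_psi_morphism AX na) mulr_suml.
  apply: (subspace_sum _ (subalg_subspace hL)) => m _.
  have -> : x ^+ n = x ^+ m * x ^+ (n - m) by rewrite -exprD subnKC // ltnW.
  rewrite -mulrA mulKr ?unitrX //.
  apply: (subalgM hL) => //; rewrite /L.
  apply: (@initial_subalg_le _ _ _ Y _ _ jl).
  apply/(level_initialP hl); eexists; last by [].
  by apply: RmS; apply: (del_term_closed (q j) (RmP j) (sigma_auto j) (delta_der j)).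
exists n.
have -> : x ^- k * Y' i = mu ^- k *: (Y' i * x ^- k).
  elim: k => [|k IHk]; first by rewrite !expr0 !invr1 mul1r mulr1 scale1r.
  rewrite exprSr invrM ?unitrX // -mulrA IHk -scalerAr mulrA.
  have -> : x^-1 * Y' i = mu^-1 *: (Y' i * x^-1).
    apply: (mulrI ux); apply: (mulIr ux).
    rewrite mulVKr // -scalerAr -scalerAl [x * (_ * _)]mulrA divrK //.
    by rewrite xY scalerA mulVf // scale1r.
  by rewrite -scalerAl scalerA -invfM -exprSr !mulrA.
rewrite -scalerAl; apply: (subalgZ _ hL) => //.
by rewrite exprD -mulrA mulKr ?unitrX.
Qed.

Lemma step_level : level j Y' theta.
Proof.
have [tlin tM t1] := step_map_morphism.
have tinj a : A a -> theta a = 0 -> a = 0.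
  move=> Aa ta; apply: (@step_map_free 1 (fun=> a) _ _ 0%N) => //.
  by rewrite big_ord_recr big_ord0 /= add0r expr0 mulr1.
split=> //.
- exact: step_genE.
- exact: step_comm.
move=> l jl n u Lu e k kn.
have [lj|lj] := eqVneq l j; last first.
  have {lj}jl : (j < l)%N by rewrite ltn_neqAle jl andbT eq_sym.
  (* A common power of [x] brings the coefficients back to the upper level, where freeness over them
     is known. *)
  have [M hM] : exists M, forall i, (i < n)%N ->
      initial_subalg Y l (u i * x ^+ M).
    elim: (n) => [|m [M hM]]; first by exists 0%N.
    have [i iL] := step_gen_denom jl (Lu m); exists (i + M)%N => i'.
    have hL := initial_subalgP Y l.
    have LX p : initial_subalg Y l (x ^+ p).
      by apply: (subalgX _ (initial_subalgP _ _)) => //; apply: initial_subalg_gen.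
    rewrite ltnS leq_eqVlt => /predU1P[->|/hM].
      by rewrite exprD mulrA => ?; apply: (subalgM (initial_subalgP _ _)).
    by rewrite addnC exprD mulrA => ?; apply: (subalgM (initial_subalgP _ _)).
  apply: (mulIr (unitrX M step_unit)); rewrite mul0r.
  pose v i := if (i < n)%N then u i * x ^+ M else 0.
  suff : v k = 0 by rewrite /v kn.
  have Lv i : initial_subalg Y l (v i).
    rewrite /v; have := hM i; case: (i < n)%N => [H|_]; first exact (H isT).
    exact (subalg0 (initial_subalgP Y l)).
  apply: (level_free hl jl Lv) kn; rewrite /v.
  transitivity ((\sum_(i < n) Y' l ^+ i * u i) * x ^+ M); last first.
    by rewrite e mul0r.
  rewrite mulr_suml; apply: eq_bigr => i _.
  by rewrite ltn_ord (step_gen_ge (ltnW jl)) mulrA.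
have {}Lu i : exists a, A a /\ u i = theta a.
  have := Lu i; rewrite lj.
  move: (u i); apply: (@initial_subalg_sub _ _ _ Y' j
    [set b | exists a, A a /\ b = theta a]).
    apply/is_subalgP; split=> [|
      c _ _ [a [Ra ->]] [b [Rb ->]]|_ _ [a [Ra ->]] [b [Rb ->]]].
    - by exists 1; split; rewrite ?t1 //; apply: (subalg1 (initial_subalgP _ _)).
    - exists (c *: a + b); split; last by rewrite tlin.
      by apply: (subalgD (initial_subalgP _ _)) => //;
        apply: (subalgZ _ (initial_subalgP _ _)).
    - by exists (a * b); split; rewrite ?tM //; apply: (subalgM (initial_subalgP _ _)).
  move=> i' im; exists (X i'); split; first exact: initial_subalg_gen.
  exact: step_genE.
have [a Aa] := choice Lu.
have sR i b : A b -> A (iter i (sigma j) b).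
  by apply: (@iter_closed _ _ (Rm j)) => c; apply: sigma_initial.
(* Freeness of [theta] is about left coefficients; moving them across x^k twists them by the k-th
   power of [sigma j]. *)
have ska : iter k (sigma j) (a k) = 0.
  apply: (step_map_free (a := fun k => iter k (sigma j) (a k))) kn.
    by move=> i; apply: sR; case: (Aa i).
  rewrite -[RHS]e; apply: eq_bigr => i _; rewrite lj (step_gen_ge (leqnn j)).
  by have [Ai ->] := Aa i; rewrite step_map_commuteX.
have [Ak ->] := Aa k.
have [_ sK slin _ _] := sigma_auto j.
suff -> : a k = 0 by apply: (linear_on0 (RmP j) tlin).
have A0 : A 0 by apply: (subalg0 (RmP j)).
move: (a k) Ak ska => b Ab; elim: (k) => //= i IHi si; apply: IHi.
rewrite -(sK _ (sR i _ Ab)).1 si.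
by rewrite -{1}(linear_on0 (RmP j) slin) (sK 0 A0).1.
Qed.

End Step.

Section Top.
Variable f : R -> D.
Hypothesis f_lin : linear f.
Hypothesis f_mon : monoid_morphism f.
Hypothesis f_inj : injective f.

Lemma level_top : level N (f \o X) f.
Proof.
have [f1 fM] := f_mon.
have fl : linear_on (Rm N) f by move=> c a b _ _; apply: f_lin.
split=> [|a _ fa|//|l i|l]; last 2 first.
- by rewrite leqNgt ltn_ord.
- by rewrite leqNgt ltn_ord.
- by split=> // a b _ _; apply: fM.
- by apply: f_inj; rewrite fa (linear_on0 (RmP N) fl).
Qed.

Lemma cauchon_level m : (0 < m <= N)%N ->
  exists psi, level m (cauchon_gen C f m) psi.
Proof.
move=> /andP[m0 mN]; rewrite -(subKn mN).
have : (N - m < N)%N by rewrite ltn_subrL m0 (leq_trans m0).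
elim: (N - m)%N => [|d IHd] dN.
  by exists f; rewrite subn0 cauchon_genN; apply: level_top.
have jN : (N - d.+1 < N)%N by lia.
have e : (N - d = (Ordinal jN).+1)%N by rewrite /=; lia.
have [psi] := IHd (ltnW dN); rewrite e => hl.
exists (step_map (Ordinal jN) (cauchon_gen C f (Ordinal jN).+1) psi).
rewrite -[(N - d.+1)%N]/(val (Ordinal jN)) cauchon_gen_ord.
by apply: step_level hl => /=; lia.
Qed.

End Top.

End Levels.

(** * Morphisms as graphs *)

Section Graphs.
Local Open Scope classical_set_scope.
Local Open Scope ring_scope.
Variables (K : fieldType) (N : nat) (A B : algType K).
Variables (Y : 'I_N -> A) (Z : 'I_N -> B).

Lemma rpoly_pair n (z : A * B) (a : nat -> A * B) :
  \sum_(k < n) z ^+ k * a k =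
  (\sum_(k < n) z.1 ^+ k * (a k).1, \sum_(k < n) z.2 ^+ k * (a k).2).
Proof.
have zX k : z ^+ k = (z.1 ^+ k, z.2 ^+ k).
  by elim: k => [|k IHk]; rewrite ?expr0 // !exprS IHk.
elim: n => [|n IHn]; first by rewrite !big_ord0.
by rewrite !big_ord_recr /= IHn zX.
Qed.

Lemma graphP : is_subalg (morph_graph setT Y Z : set (A * B)).
Proof. exact: subalg_genP. Qed.

Lemma graph_gen i : morph_graph setT Y Z (Y i, Z i).
Proof. by apply: mem_subalg_gen; exists i. Qed.

Lemma graph_sub (S : set (A * B)) : is_subalg S ->
  (forall i, S (Y i, Z i)) -> morph_graph setT Y Z `<=` S.
Proof. by move=> hS SYZ; apply: subalg_gen_sub => // _ [i _ <-]. Qed.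

Lemma graph_dom a b : morph_graph setT Y Z (a, b) ->
  initial_subalg Y N a /\ initial_subalg Z N b.
Proof.
have hY := initial_subalgP Y N; have hZ := initial_subalgP Z N.
pose S : set (A * B) := [set p | initial_subalg Y N p.1 /\ initial_subalg Z N p.2].
move=> Gab; suff : S (a, b) by [].
apply: graph_sub Gab => [|i]; last by split; apply: initial_subalg_gen.
apply/is_subalgP; split=> [|c [u u'] [v v'] [/= ? ?] [/= ? ?]|
  [u u'] [v v'] [/= ? ?] [/= ? ?]].
- by split; [exact (subalg1 hY)|exact (subalg1 hZ)].
- by split; [apply: (subalgD hY) => //; apply: (subalgZ _ hY)
            |apply: (subalgD hZ) => //; apply: (subalgZ _ hZ)].
- by split; [apply: (subalgM hY)|apply: (subalgM hZ)].
Qed.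

Lemma graph_ex a : initial_subalg Y N a -> exists b, morph_graph setT Y Z (a, b).
Proof.
move: a; apply: (@initial_subalg_sub _ _ _ Y N
  [set a | exists b, morph_graph setT Y Z (a, b)]); last first.
  by move=> i _; exists (Z i); apply: graph_gen.
apply/is_subalgP; split=> [|c u v [u' Gu] [v' Gv]|u v [u' Gu] [v' Gv]].
- by exists 1; exact (subalg1 graphP).
- exists (c *: u' + v'); exact (subalgD graphP (subalgZ c graphP Gu) Gv).
- exists (u' * v'); exact (subalgM graphP Gu Gv).
Qed.

Lemma graph_surj b : initial_subalg Z N b -> exists a, morph_graph setT Y Z (a, b).
Proof.
move: b; apply: (@initial_subalg_sub _ _ _ Z N
  [set b | exists a, morph_graph setT Y Z (a, b)]); last first.
  by move=> i _; exists (Y i); apply: graph_gen.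
apply/is_subalgP; split=> [|c u v [u' Gu] [v' Gv]|u v [u' Gu] [v' Gv]].
- by exists 1; exact (subalg1 graphP).
- exists (c *: u' + v'); exact (subalgD graphP (subalgZ c graphP Gu) Gv).
- exists (u' * v'); exact (subalgM graphP Gu Gv).
Qed.

End Graphs.

Section LevelGraphs.
Local Open Scope classical_set_scope.
Local Open Scope ring_scope.
Variables (K : fieldType) (R : algType K) (N : nat) (C : cgl_extension R N).
Variables (D : unitAlgType K).

Local Notation X := (cgl_X C).
Local Notation sigma := (cgl_sigma C).
Local Notation sigmaV := (cgl_sigmaV C).
Local Notation delta := (cgl_delta C).
Local Notation lambda := (cgl_lambda C).
Local Notation Rm := (initial_subalg X).

(* The morphism Y i |-> Z i modulo I is well defined, because normally ordered
   expressions in the Y i are unique. *)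
Lemma graph_kernel m (Y Z : 'I_N -> D) (psi rho : R -> D) (B I : set D) :
  (m <= N)%N -> level C m Y psi -> morphism_on (Rm m) rho ->
  (forall i : 'I_N, (i < m)%N -> Z i = rho (X i)) ->
  is_subalg B -> (forall i, B (Z i)) -> is_ideal B I ->
  (forall l i : 'I_N, (m <= l)%N -> (i < l)%N ->
    I (Z i * Z l - (lambda l i)^-1 *: (Z l * Z i))) ->
  forall v, morph_graph setT Y Z (0, v) -> I v.
Proof.
move=> mN hl hrho Zrho hB BZ hI ZI v Gv.
have hIs := ideal_subspace hB hI.
(* The pairs (0, b) with b in [I] are adjoined because the [Z i] commute up to scalars only modulo
   [I]; they absorb the remainders [s2] in [Gz]. *)
pose G l : set (D * D) := subalg_gen
  ([set (Y i, Z i) | i in [set i : 'I_N | (i < l)%N]] `|` [set (0, b) | b in I]).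
have GP l : is_subalg (G l) by exact: subalg_genP.
have GI l b : I b -> G l (0, b).
  by move=> Ib; apply: mem_subalg_gen; right; exists b.
have GY l (i : 'I_N) : (i < l)%N -> G l (Y i, Z i).
  by move=> il; apply: mem_subalg_gen; left; exists i.
have Gsub l (S : set (D * D)) : is_subalg S ->
    (forall i : 'I_N, (i < l)%N -> S (Y i, Z i)) -> (forall b, I b -> S (0, b)) ->
    G l `<=` S.
  move=> hS SY SI; apply: subalg_gen_sub => // _ [[i il <-]|[b Ib <-]].
    exact: SY.
  exact: SI.
have G1 l p : G l p -> initial_subalg Y l p.1.
  have hY := initial_subalgP Y l; move: p.
  apply: (Gsub l [set p | initial_subalg Y l p.1]) => [|i il|b _].
  - apply/is_subalgP; split=> [|c [u u'] [v1 v'] /= ? ?|[u u'] [v1 v'] /= ? ?].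
    + exact (subalg1 hY).
    + by apply: (subalgD hY) => //; apply: (subalgZ _ hY).
    + exact: (subalgM hY).
  - exact: initial_subalg_gen.
  - exact (subalg0 hY).
have base t : G m (0, t) -> I t.
  move=> Gu.
  have [plin pM p1] := level_morphism hl; have [rlin rM r1] := hrho.
  have hR := initial_subalgP X m.
  pose S : set (D * D) := [set p | exists a, [/\ Rm m a, B (rho a), p.1 = psi a &
    I (p.2 - rho a)]].
  have SG : G m `<=` S.
    apply: Gsub => [|i im|b Ib].
    - have [IB _ _ IM] := hI.
      apply/is_subalgP; split=> [|c [u u'] [v1 v'] [a [Ra Ba /= -> Iu]]
          [b [Rb Bb /= -> Iv]]|[u u'] [v1 v'] [a [Ra Ba /= -> Iu]]
          [b [Rb Bb /= -> Iv]]].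
      + exists 1; rewrite r1 p1 subrr; split=> //; [exact (subalg1 hR)
          |exact (subalg1 hB)|by case: hIs].
      + exists (c *: a + b); rewrite rlin //; split.
        * exact (subalgD hR (subalgZ c hR Ra) Rb).
        * exact (subalgD hB (subalgZ c hB Ba) Bb).
        * by rewrite plin.
        * rewrite /= opprD addrACA -scalerBr; apply: subspaceD => //.
          exact: subspaceZ.
      + exists (a * b); rewrite rM //; split.
        * exact (subalgM hR Ra Rb).
        * exact (subalgM hB Ba Bb).
        * by rewrite pM.
        * rewrite /= (_ : _ - _ = (u' - rho a) * v' + rho a * (v' - rho b)).
            apply: subspaceD => //; last by apply: (IM _ _ Ba Iv).1.
            have Bv : B v' by rewrite -(subrK (rho b) v'); apply: subalgD => //;
              apply: IB.
            by apply: (IM _ _ Bv Iu).2.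
          by rewrite mulrBl mulrBr addrA subrK.
    - exists (X i); rewrite -Zrho // subrr -(level_gen hl) //; split=> //.
        exact: initial_subalg_gen.
      by case: hIs.
    - exists 0; rewrite (linear_on0 hR rlin) (linear_on0 hR plin) subr0.
      by split=> //; [exact (subalg0 hR)|exact (subalg0 hB)].
  have [a [Ra _ /= /esym pa]] := SG _ Gu.
  by rewrite (level_inj hl Ra pa) (linear_on0 hR rlin) subr0.
suff GN d : (m + d <= N)%N -> forall u, G (m + d)%N (0, u) -> I u.
  apply: (GN (N - m)%N); rewrite subnKC //.
  by apply: graph_sub Gv => // i; apply: GY.
elim: d => [|d IHd]; first by rewrite addn0 => _; apply: base.
rewrite addnS; move: (m + d)%N (leq_addr d m) IHd => l ml IHl lN {v Gv} v Gv.
pose lo := Ordinal lN; pose z : D * D := (Y lo, Z lo).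
have IHl' u : G l (0, u) -> I u by apply: IHl; rewrite ltnW.
have Gz s : G l s -> exists s1 s2, [/\ G l s1, G l s2 & s * z = z * s1 + s2].
  move=> Gs; pose S : set (D * D) := [set s | G l s /\
    exists s1 s2, [/\ G l s1, G l s2 & s * z = z * s1 + s2]].
  suff : S s by case.
  move: s Gs; apply: Gsub => [|i il|b Ib].
  - apply/is_subalgP; split=> [|c s t [Gs [s1 [s2 [Gs1 Gs2 es]]]]
      [Gt [t1 [t2 [Gt1 Gt2 et]]]]|s t [Gs [s1 [s2 [Gs1 Gs2 es]]]]
      [Gt [t1 [t2 [Gt1 Gt2 et]]]]].
    + split; first exact (subalg1 (GP l)).
      exists 1, 0; split; [exact (subalg1 (GP l))|exact (subalg0 (GP l))|].
      by rewrite mul1r mulr1 addr0.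
    + split; first exact (subalgD (GP l) (subalgZ c (GP l) Gs) Gt).
      exists (c *: s1 + t1), (c *: s2 + t2); split.
      * exact (subalgD (GP l) (subalgZ c (GP l) Gs1) Gt1).
      * exact (subalgD (GP l) (subalgZ c (GP l) Gs2) Gt2).
      * by rewrite mulrDl -scalerAl es et mulrDr -scalerAr scalerDr addrACA.
    + split; first exact (subalgM (GP l) Gs Gt).
      exists (s1 * t1), (s2 * t1 + s * t2); split.
      * exact (subalgM (GP l) Gs1 Gt1).
      * exact (subalgD (GP l) (subalgM (GP l) Gs2 Gt1) (subalgM (GP l) Gs Gt2)).
      * by rewrite -mulrA et mulrDr mulrA es mulrDl -mulrA addrA.
  - split; first exact: GY.
    have la0 := cgl_lambda_neq0 C (il : (i < lo)%N).
    exists ((lambda lo i)^-1 *: (Y i, Z i)),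
      (0, Z i * Z lo - (lambda lo i)^-1 *: (Z lo * Z i)); split.
    + exact (subalgZ _ (GP l) (GY l i il)).
    + exact: (GI l _ (ZI lo i ml il)).
    + congr pair; last by rewrite /= -scalerAr addrC subrK.
      rewrite /= addr0 -scalerAr (@level_comm _ _ _ _ _ _ _ _ hl lo i ml il).
      by rewrite scalerA mulVf ?scale1r.
  - split; first exact: GI.
    exists 0, (0, b * Z lo); split; first exact (subalg0 (GP l)).
      by apply: GI; case: hI => _ _ _ /(_ (Z lo) b (BZ lo) Ib)[].
    by rewrite mulr0 add0r; congr pair; rewrite /= mul0r.
have [n [a [Ga e]]] : exists n, rpoly (G l) z n (0, v).
  apply: (gen_rpoly (GP l) Gz).
  move: (0, v) Gv; apply: Gsub => [|i|b Ib]; first exact: subalg_genP.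
    rewrite ltnS leq_eqVlt => /predU1P[il|il].
      by rewrite (_ : i = lo); [apply: mem_subalg_gen; right|apply: val_inj].
    by apply: mem_subalg_gen; left; apply: GY.
  by apply: mem_subalg_gen; left; apply: GI.
move: e; rewrite rpoly_pair => -[/esym e1 ->].
(* Freeness of [Y lo] kills the first components, and the second ones then fall under the induction
   hypothesis. *)
have a1 k : (k < n)%N -> (a k).1 = 0.
  apply: (level_free hl (l := lo) ml (n := n) (u := fun k => (a k).1)) => //.
  by move=> i; apply: G1.
apply: subspace_sum => // k _.
have Ik : I (a k).2.
  by apply: IHl'; rewrite -(a1 k) // -surjective_pairing.
case: hI => _ _ _ IM; apply: (IM _ _ _ Ik).1.
by apply: (subalgX k hB); apply: BZ.
Qed.

End LevelGraphs.

(** * Ideals at two consecutive levels *)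

Section LevelIdeals.
Local Open Scope classical_set_scope.
Local Open Scope ring_scope.
Variables (K : fieldType) (R : algType K) (N : nat) (C : cgl_extension R N).
Variables (D : unitAlgType K).
Hypothesis D_field : forall y : D, y != 0 -> y \is a GRing.unit.

Local Notation X := (cgl_X C).
Local Notation sigma := (cgl_sigma C).
Local Notation sigmaV := (cgl_sigmaV C).
Local Notation delta := (cgl_delta C).
Local Notation lambda := (cgl_lambda C).
Local Notation Rm := (initial_subalg X).

Lemma normal_initial (Y : 'I_N -> D) (z : D) l s :
  (forall i : 'I_N, (i < l)%N -> exists2 mu : K, mu != 0 & z * Y i = mu *: (Y i * z)) ->
  initial_subalg Y l s ->
  (exists2 s', initial_subalg Y l s' & s * z = z * s') /\
  (exists2 s', initial_subalg Y l s' & z * s = s' * z).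
Proof.
move=> zY; have hS := initial_subalgP Y l; set S := initial_subalg Y l in hS *.
move: s; apply: (@initial_subalg_sub _ _ _ Y l [set s |
  (exists2 s', S s' & s * z = z * s') /\ (exists2 s', S s' & z * s = s' * z)]).
  apply/is_subalgP; split=> [|c u v [[u1 Su1 e1] [u2 Su2 e2]]
    [[v1 Sv1 f1] [v2 Sv2 f2]]|u v [[u1 Su1 e1] [u2 Su2 e2]]
    [[v1 Sv1 f1] [v2 Sv2 f2]]].
  - by split; exists 1; rewrite ?mulr1 ?mul1r //; apply: (subalg1 hS).
  - split; [exists (c *: u1 + v1)|exists (c *: u2 + v2)];
      rewrite ?mulrDl ?mulrDr -?scalerAl -?scalerAr ?e1 ?f1 ?e2 ?f2 //;
      by apply: (subalgD hS) => //; apply: (subalgZ _ hS).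
  - split.
      exists (u1 * v1); first exact: (subalgM hS).
      by rewrite -mulrA f1 mulrA e1 -mulrA.
    exists (u2 * v2); first exact: (subalgM hS).
    by rewrite mulrA e2 -[u2 * z * v]mulrA f2 mulrA.
move=> i il; have [mu mu0 e] := zY i il.
have SY : S (Y i) by apply: initial_subalg_gen.
split.
  exists (mu^-1 *: Y i); first exact: (subalgZ _ hS).
  by rewrite -scalerAr e scalerA mulVf ?scale1r.
exists (mu *: Y i); first exact: (subalgZ _ hS).
by rewrite e scalerAl.
Qed.

Lemma level_noetherian m (Y : 'I_N -> D) psi : level C m Y psi ->
  left_noetherian (initial_subalg Y N).
Proof.
move=> hl; suff noeth l : (l <= N)%N -> left_noetherian (initial_subalg Y l).
  exact: noeth.
elim: l => [_|l IHl lN].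
  rewrite (_ : initial_subalg Y 0 = [set c%:A | c in [set: K]]).
    exact: left_noetherian_scalars.
  apply/seteqP; split=> [|_ [c _ <-]]; last first.
    by apply: (subalgZ _ (initial_subalgP _ _)); exact (subalg1 (initial_subalgP _ _)).
  apply: initial_subalg_sub => //; apply/is_subalgP.
  split=> [|c _ _ [a _ <-] [b _ <-]|_ _ [a _ <-] [b _ <-]].
  - by exists 1; rewrite ?scale1r.
  - by exists (c * a + b); rewrite // scalerDl -scalerA.
  - by exists (a * b); rewrite // -scalerAl mul1r scalerA.
pose lo := Ordinal lN; have hS := initial_subalgP Y l.
rewrite -[l.+1]/(lo.+1) initial_subalgS.
have [lm|ml] := ltnP l m; last first.
  have zY (i : 'I_N) : (i < lo)%N ->
      exists2 mu : K, mu != 0 & Y lo * Y i = mu *: (Y i * Y lo).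
    move=> il; exists (lambda lo i); first exact: cgl_lambda_neq0.
    exact: (level_comm hl).
  have S0 := subalg0 hS.
  apply: hilbert_basis (IHl (ltnW lN)) => // s /(normal_initial zY)
    [[s1 Ss1 e1] [s2 Ss2 e2]].
    by exists s1, 0; rewrite addr0.
  by exists s2, 0; rewrite addr0.
have [plin pM p1] := level_morphism hl.
have up a : Rm lo a -> Rm m a by apply: initial_subalg_le; apply: ltnW.
have RX : Rm m (X lo) by apply: initial_subalg_gen.
have YX : Y lo = psi (X lo) by apply: (level_gen hl).
have hR := initial_subalgP X m.
have lmor : morphism_on (Rm lo) psi.
  by split=> // [c a b Ra Rb|a b Ra Rb]; [apply: plin|apply: pM]; apply: up.
have Yl (i : 'I_N) : (i < lo)%N -> Y i = psi (X i).
  by move=> il; apply: (level_gen hl); apply: ltn_trans lm.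
have im := initial_image lmor Yl.
have [sR sK _ _ _] := sigma_auto C lo; have [dR _ _] := delta_der C lo.
apply: hilbert_basis (IHl (ltnW lN)) => // s /im[a Ra ->].
  have [_ Rt] := sR a Ra; have dt := dR _ Rt.
  have [ma mt md] := And3 (up _ Ra) (up _ Rt) (up _ dt).
  (* Right coefficients come from the Ore relation applied to the preimage of [a] under
     [sigma lo]. *)
  exists (psi (sigmaV lo a)), (- psi (delta lo (sigmaV lo a))); split.
  - by apply/im; exists (sigmaV lo a).
  - apply: (subspaceN (subalg_subspace hS)); apply/im.
    by exists (delta lo (sigmaV lo a)).
  have := congr1 psi (oreX Rt); rewrite (sK a Ra).2 (linear_onD plin) //; last first.
    exact: (subalgM hR).
  by rewrite !pM // YX => ->; rewrite addrK.
have [Rs _] := sR a Ra; have da := dR _ Ra.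
have [ma ms md] := And3 (up _ Ra) (up _ Rs) (up _ da).
exists (psi (sigma lo a)), (psi (delta lo a)); split.
- by apply/im; exists (sigma lo a).
- by apply/im; exists (delta lo a).
have := congr1 psi (oreX Ra); rewrite (linear_onD plin) //; last first.
  exact: (subalgM hR).
by rewrite !pM // YX.
Qed.

(** Rescaling of the generators, kept as a relation: where derivations remain it need not define a
    map. *)
Definition gamma (Y : 'I_N -> D) (t : 'I_N -> K) : set (D * D) :=
  morph_graph setT Y (fun i => t i *: Y i).

Lemma gammaP Y t : is_subalg (gamma Y t).
Proof. exact: graphP. Qed.

Lemma gamma_gen Y t i : gamma Y t (Y i, t i *: Y i).
Proof. exact (@graph_gen _ _ _ _ Y (fun i => t i *: Y i) i). Qed.

Lemma gamma_fix Y t i : t i = 1 -> gamma Y t (Y i, Y i).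
Proof. by move=> ti; have := @gamma_gen Y t i; rewrite ti scale1r. Qed.

Lemma gamma_dom Y t a b : gamma Y t (a, b) ->
  initial_subalg Y N a /\ initial_subalg Y N b.
Proof.
move=> /graph_dom[Ya Zb]; split=> //; move: b Zb.
apply: initial_subalg_sub => [|i _]; first exact: initial_subalgP.
by apply: (subalgZ _ (initial_subalgP _ _)); apply: initial_subalg_gen.
Qed.

Lemma gamma_ex Y t a : initial_subalg Y N a -> exists b, gamma Y t (a, b).
Proof. exact (@graph_ex _ _ _ _ Y (fun i => t i *: Y i) a). Qed.

(** The derivations surviving at level [m] involve only the generators below [m], which the
    rescaling fixes; [graph_kernel] then applies with the zero ideal. *)
Lemma gamma_fun m Y psi t a b b' : (m <= N)%N -> level C m Y psi ->
  (forall i : 'I_N, (i < m)%N -> t i = 1) ->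
  gamma Y t (a, b) -> gamma Y t (a, b') -> b = b'.
Proof.
move=> mN hl t1 Gb Gb'; apply/eqP; rewrite -subr_eq0; apply/eqP.
have hB := initial_subalgP Y N.
have BY i : initial_subalg Y N (Y i) by apply: initial_subalg_gen.
apply: (graph_kernel mN hl (level_morphism hl) _ hB _ (I := [set 0])
  (Z := fun i => t i *: Y i)).
- by move=> i im; rewrite t1 // scale1r (level_gen hl).
- by move=> i; apply: (subalgZ _ hB).
- split=> //= [_ ->|a' c -> ->|s a' _ ->]; [exact (subalg0 hB)|by rewrite addr0|].
  by rewrite mulr0 mul0r.
- move=> l i ml il /=; rewrite -!scalerAl -!scalerAr !scalerA.
  rewrite (@level_comm _ _ _ _ _ _ _ _ hl l i ml il) scalerA.
  have l0 := cgl_lambda_neq0 C il.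
  by rewrite [X in _ - X *: _](_ : _ = t i * t l) ?subrr //; field.
have := subalgB (gammaP Y t) Gb Gb'.
by rewrite (_ : (a, b) - (a, b') = (0, b - b')) //; congr pair; rewrite /= subrr.
Qed.

Definition gamma_stable Y t (P : set D) : Prop :=
  forall a b, gamma Y t (a, b) -> P a -> P b.

(** * Rescalings and ideals across one step *)

Section Step.
Variables (j : 'I_N) (Y : 'I_N -> D) (psi : R -> D).
Hypothesis j_gt0 : (0 < j)%N.
Hypothesis hl : level C j.+1 Y psi.

Local Notation x := (Y j).
Local Notation Y' := (step_gen C j Y).
Local Notation theta := (step_map C j Y psi).
Local Notation B := (initial_subalg Y N).
Local Notation B' := (initial_subalg Y' N).

Let hB : is_subalg B := initial_subalgP Y N.
Let hB' : is_subalg B' := initial_subalgP Y' N.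
Let ux : x \is a GRing.unit := step_unit D_field hl.
Let uX n : x ^+ n \is a GRing.unit := unitrX n ux.
Let hl' : level C j Y' theta := step_level D_field j_gt0 hl.
Let Y'j : Y' j = x := step_gen_ge C Y (leqnn j).
Let Bx : B x. Proof. by apply: initial_subalg_gen. Qed.
Let BX n : B (x ^+ n) := subalgX n hB Bx.
Let B'x : B' x. Proof. by rewrite -Y'j; apply: initial_subalg_gen. Qed.
Let B'X n : B' (x ^+ n) := subalgX n hB' B'x.
Let jN : (j <= N)%N := ltnW (ltn_ord j).

Lemma step_denom b : B' b -> exists n, B (b * x ^+ n).
Proof. exact: (step_gen_denom D_field j_gt0 hl (ltn_ord j)). Qed.

Let mulXV n (a : D) : a * x ^- n * x ^+ n = a.
Proof. by rewrite divrK. Qed.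
Let mulXK n (a : D) : a * x ^+ n * x ^- n = a.
Proof. by rewrite mulrK. Qed.

Lemma step_conjV i n : exists mu : K, x ^- n * Y' i * x ^+ n = mu *: Y' i.
Proof.
have [mu mu0 e] := step_normal D_field j_gt0 hl i.
exists (mu ^- n); apply: (mulrI (uX n)); rewrite !mulrA divrr // mul1r.
elim: n => [|n IHn]; first by rewrite !expr0 invr1 scale1r mul1r mulr1.
have e' : Y' i * x = mu^-1 *: (x * Y' i) by rewrite e scalerA mulVf ?scale1r.
rewrite [x ^+ n.+1]exprSr mulrA IHn -!scalerAr -scalerAl -[_ * _ * x]mulrA e'.
by rewrite -scalerAr scalerA -invfM mulrA -!exprSr.
Qed.

Lemma gamma_conjV t a b n : gamma Y' t (a, b) ->
  gamma Y' t (x ^- n * a * x ^+ n, x ^- n * b * x ^+ n).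
Proof.
have hG := gammaP Y' t => Gab.
pose S : set (D * D) := [set p |
  gamma Y' t (x ^- n * p.1 * x ^+ n, x ^- n * p.2 * x ^+ n)].
suff : S (a, b) by [].
apply: graph_sub Gab => [|i].
  apply/is_subalgP; split=> [|c [u u'] [v v'] /= Su Sv|[u u'] [v v'] /= Su Sv].
  - by rewrite /S /= !mulr1 mulVr //; exact (subalg1 hG).
  - have := subalgD hG (subalgZ c hG Su) Sv.
    rewrite (_ : _ + _ = (x ^- n * (c *: u + v) * x ^+ n,
      x ^- n * (c *: u' + v') * x ^+ n)) //.
    by congr pair; rewrite /= mulrDr mulrDl -scalerAr -scalerAl.
  - have := subalgM hG Su Sv.
    rewrite (_ : _ * _ = (x ^- n * (u * v) * x ^+ n,
      x ^- n * (u' * v') * x ^+ n)) //.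
    by congr pair; rewrite /= !mulrA mulrK.
have [mu e] := step_conjV i n.
rewrite /S /= -scalerAr -scalerAl e scalerA mulrC -scalerA.
exact (subalgZ mu hG (@gamma_gen Y' t i)).
Qed.

Lemma alg_conjV b n : B' b -> B' (x ^- n * b * x ^+ n).
Proof.
(* The trivial rescaling serves only to reuse [gamma_conjV]: what matters is the domain of the
   relation. *)
move=> /(@gamma_ex Y' (fun=> 1))[b' Gb].
by have /gamma_dom[] := gamma_conjV n Gb.
Qed.

Definition fixed_alg t : set D := [set b | gamma Y' t (b, b)].

Lemma fixed_algP t : is_subalg (fixed_alg t).
Proof.
have hG := gammaP Y' t.
apply/is_subalgP; split=> [|c u v Su Sv|u v Su Sv].
- exact (subalg1 hG).
- exact (subalgD hG (subalgZ c hG Su) Sv).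
- exact (subalgM hG Su Sv).
Qed.

Lemma fixed_alg_theta t a : (forall i : 'I_N, (i < j)%N -> t i = 1) ->
  Rm j a -> fixed_alg t (theta a).
Proof.
move=> t1 Ra; have /(level_initialP hl') : exists2 b, Rm j b & theta a = theta b.
  by exists a.
move: (theta a); apply: initial_subalg_sub; first exact: fixed_algP.
by move=> i ij; exact (@gamma_fix Y' t i (t1 i ij)).
Qed.

(** As the rescaling fixes [x] and every [theta a], one power of [x] clears the denominators of both
    components compatibly. *)
Lemma gamma_denom t a b : (forall i : 'I_N, (i <= j)%N -> t i = 1) ->
  gamma Y t (a, b) -> exists n, gamma Y' t (a * x ^+ n, b * x ^+ n).
Proof.
move=> t1 Gab; have hG := gammaP Y' t; have hF := fixed_algP t.
have Fx : fixed_alg t x.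
  by have := @gamma_fix Y' t j (t1 j (leqnn j)); rewrite Y'j.
have FX n : gamma Y' t (x ^+ n, x ^+ n) by exact: (subalgX n hF Fx).
pose S : set (D * D) := [set p | exists n, gamma Y' t (p.1 * x ^+ n, p.2 * x ^+ n)].
suff : S (a, b) by [].
apply: graph_sub Gab => [|i].
  apply/is_subalgP; split=> [|c [u u'] [v v'] [m /= Su] [n /= Sv]|
    [u u'] [v v'] [m /= Su] [n /= Sv]].
  - by exists 0%N; rewrite /= mulr1; exact (subalg1 hG).
  - exists (m + n)%N; have := subalgD hG (subalgZ c hG (subalgM hG Su (FX n)))
      (subalgM hG Sv (FX m)).
    rewrite (_ : _ + _ = ((c *: u + v) * x ^+ (m + n),
      (c *: u' + v') * x ^+ (m + n))) //.
    by congr pair; rewrite /= !mulrDl -!mulrA -!exprD [(n + m)%N]addnC -scalerAl.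
  - exists (m + n)%N; have := subalgM hG Su (gamma_conjV m Sv).
    rewrite (_ : _ * _ = (u * v * x ^+ (m + n), u' * v' * x ^+ (m + n))) //.
    by congr pair; rewrite /= !mulrA mulrK // addnC exprD !mulrA.
rewrite /S /=; have [ij|ji] := ltnP i j; last first.
  exists 0%N; rewrite /= !mulr1 -(step_gen_ge C Y ji); exact (@gamma_gen Y' t i).
have Ra : Rm j (X i) by apply: initial_subalg_gen.
rewrite t1 ?scale1r; last exact: ltnW.
rewrite (level_gen hl); last exact: leqW.
have [b' Rb'|n Fn] := step_psi_denom D_field j_gt0 hl hF Fx _ Ra.
  by apply: fixed_alg_theta => // i' i'j; apply/t1/ltnW.
by exists n.
Qed.

Lemma alg_denom s : B s -> exists n, B' (s * x ^+ n).
Proof.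
move=> /(@gamma_ex Y (fun=> 1))[b /gamma_denom[//|n /gamma_dom[? _]]].
by exists n.
Qed.

(** This makes g_j well defined: modulo [x] the relations involving T_j become trivial, and those of
    later generators are the same at both levels. *)
Lemma step_graph_kernel v : morph_graph setT Y' Y (0, v) ->
  ideal_gen B [set x] v.
Proof.
have [hI Ix] : is_ideal B (ideal_gen B [set x]) /\ [set x] `<=` ideal_gen B [set x].
  by apply: ideal_genP => // _ ->.
have xI : ideal_gen B [set x] x by apply: Ix.
have BY i : B (Y i) by apply: initial_subalg_gen.
apply: (graph_kernel jN hl' (step_psi_morphism hl) _ hB BY hI) => [i ij|l i jl il].
  by rewrite (level_gen hl) // leqW.
have [lj|lj] := eqVneq l j.
  have [IB I0 ID IM] := hI; rewrite lj.
  apply: (subspaceB (ideal_subspace hB hI)); first by case: (IM (Y i) x).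
  by apply: (subspaceZ _ (ideal_subspace hB hI)); case: (IM (Y i) x).
have {lj}jl : (j < l)%N by rewrite ltn_neqAle jl andbT eq_sym.
rewrite (@level_comm _ _ _ _ _ _ _ _ hl l i jl il) scalerA mulVf ?scale1r ?subrr.
  by case: hI.
exact: cgl_lambda_neq0.
Qed.

Definition conj_rel : set (D * D) := [set p | p.2 = x * p.1 * x^-1].

Lemma conj_relP : is_subalg conj_rel.
Proof.
apply/is_subalgP; split=> [|c [u u'] [v v']|[u u'] [v v']]; rewrite /conj_rel /=.
- by rewrite mulr1 divrr.
- by move=> -> ->; rewrite mulrDr mulrDl -scalerAr -scalerAl.
- by move=> -> ->; rewrite !mulrA mulrVK.
Qed.

Lemma conj_eigensum b : B' b -> eigensum conj_rel (fun c => c != 0) b.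
Proof.
have hE := eigensum_subspace (subalg_subspace conj_relP) (fun c => c != 0).
move: b; apply: initial_subalg_sub => [|i _].
  apply/is_subalgP; split=> [|c u v Eu Ev|u v].
  - apply: (@eigensum1 _ _ _ _ 1); first exact: oner_neq0.
    by rewrite /conj_rel /= scale1r mulr1 divrr.
  - by apply: (subspaceD hE) => //; apply: (subspaceZ _ hE).
  - apply: (eigensumM (subalg_subspace conj_relP) conj_relP).
    by move=> c d; apply: mulf_neq0.
have [mu mu0 e] := step_normal D_field j_gt0 hl i.
apply: (@eigensum1 _ _ _ _ mu) => //.
by rewrite /conj_rel /= e -scalerAl mulrK.
Qed.

(* Conjugation by x is diagonalizable on B' with nonzero eigenvalues, hence its
   inverse acts on each element as a polynomial in it. *)
Lemma conj_stableV (V : set D) b n : is_subspace V ->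
  (forall a, V a -> V (x * a * x^-1)) -> B' b -> V b ->
  V (x ^- n * b * x ^+ n).
Proof.
move=> hV Vx /conj_eigensum[s [-> hs]] Vb.
rewrite mulr_sumr mulr_suml.
rewrite (_ : \sum_(t <- s) _ = \sum_(t <- s) t.1 ^- n *: t.2).
  apply: (eigensum_inv (subalg_subspace conj_relP) hV _ n hs Vb).
  by move=> a c; rewrite /conj_rel /= => -> /Vx.
rewrite big_seq [RHS]big_seq; apply: eq_bigr => t /hs[t0].
rewrite /conj_rel /= => e.
apply: (mulrI (uX n)); rewrite !mulrA divrr // mul1r -scalerAr.
have {}e : t.2 * x = t.1^-1 *: (x * t.2).
  apply: (scalerI t0); rewrite scalerA divff // scale1r scalerAl e.
  by rewrite mulrVK.
elim: (n) => [|m IHm]; first by rewrite !expr0 invr1 scale1r mul1r mulr1.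
rewrite [x ^+ m.+1]exprSr mulrA IHm -scalerAl -mulrA e -scalerAr scalerA.
by rewrite -invfM mulrA -!exprSr.
Qed.

Definition step_ext (P : set D) : set D :=
  [set e | exists2 p, P p & exists k, e = p * x ^- k].

(** [step_out] and [step_in] are the branches of [spec_step] in which [x] is outside P, respectively
    in P. *)
Definition step_out (P : set D) : set D := [set a | B' a /\ step_ext P a].

Definition step_in (P : set D) : set D := [set a | B' a /\ exists2 p, P p &
  exists2 c, morph_graph setT Y' Y (a, c) & ideal_gen B [set x] (p - c)].

(** * Ideals containing x *)

Section In.
Variable P : set D.
Hypothesis hP : is_ideal B P.
Hypothesis xP : P x.

Let Ix : ideal_gen B [set x] `<=` P.
Proof. by apply: ideal_gen_sub => // _ ->. Qed.

Let PB : is_subspace P := ideal_subspace hB hP.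

Lemma step_inP a c : morph_graph setT Y' Y (a, c) -> step_in P a <-> P c.
Proof.
have hG := graphP Y' Y.
move=> Gac; split=> [[_ [p Pp [c' Gac' /Ix Ppc]]]|Pc].
  have Pc' : P c' by rewrite -(subKr p c'); apply: subspaceB.
  have /step_graph_kernel/Ix Pcc : morph_graph setT Y' Y (0, c - c').
    have := subalgB hG Gac Gac'.
    by rewrite (_ : _ - _ = (0, c - c')) //; congr pair; rewrite /= subrr.
  by rewrite -(subrK c' c); apply: subspaceD.
split; first by case: (graph_dom Gac).
exists c => //; exists c => //; rewrite subrr.
by move=> M [[]].
Qed.

Lemma step_in_prime : elt_prime B P -> elt_prime B' (step_in P).
Proof.
have hG := graphP Y' Y; have [PsB P0 PD PM] := hP.
move=> [_ prP]; split.
  split=> [a []//| |a b Ia Ib|s a Bs Ia].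
  - by apply/(step_inP (subalg0 hG)).
  - have [a' Ga] := graph_ex Y (proj1 Ia).
    have [b' Gb] := graph_ex Y (proj1 Ib).
    have /step_inP -> := subalgD hG Ga Gb.
    by apply: PD; [apply/(step_inP Ga)|apply/(step_inP Gb)].
  - have [a' Ga] := graph_ex Y (proj1 Ia).
    have [s' Gs] := graph_ex Y Bs.
    have Pa := (step_inP Ga).1 Ia; have [_ Bs'] := graph_dom Gs.
    by split; [have /step_inP -> := subalgM hG Gs Ga
              |have /step_inP -> := subalgM hG Ga Gs]; case: (PM s' a').
move=> a b B'a B'b asb.
have [a' Ga] := graph_ex Y B'a; have [b' Gb] := graph_ex Y B'b.
have [_ Ba] := graph_dom Ga; have [_ Bb] := graph_dom Gb.
case: (prP a' b' Ba Bb) => [s' Bs'|Pa|Pb].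
- have [s Gs] := graph_surj Y' Bs'; have [B's _] := graph_dom Gs.
  exact: ((step_inP (subalgM hG (subalgM hG Ga Gs) Gb)).1 (asb s B's)).
- by left; apply/(step_inP Ga).
- by right; apply/(step_inP Gb).
Qed.

End In.

(** * Prime ideals containing no power of x *)

Section Out.
Variable P : set D.
Hypothesis hP : elt_prime B P.
Hypothesis XP : forall n, ~ P (x ^+ n).

Let hPi : is_ideal B P. Proof. by case: hP. Qed.
Let PB : P `<=` B. Proof. by case: hPi. Qed.
Let P0 : P 0. Proof. by case: hPi. Qed.
Let PD a b : P a -> P b -> P (a + b).
Proof. by case: hPi => _ _ H _; apply: H. Qed.
Let PMl s a : B s -> P a -> P (s * a).
Proof. by case: hPi => _ _ _ H Bs Pa; case: (H s a Bs Pa). Qed.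
Let PMr s a : B s -> P a -> P (a * s).
Proof. by case: hPi => _ _ _ H Bs Pa; case: (H s a Bs Pa). Qed.

Lemma step_extXr e n : step_ext P e -> step_ext P (e * x ^+ n).
Proof.
move=> [p Pp [k ->]]; exists (p * x ^+ n); first exact: PMr.
by exists k; rewrite -!mulrA; congr (_ * _); apply/commrX/commr_sym/commrV/commrX.
Qed.

Lemma step_extVr e n : step_ext P e -> step_ext P (e * x ^- n).
Proof.
move=> [p Pp [k ->]]; exists p => //; exists (n + k)%N.
by rewrite -mulrA -invrM // -exprD.
Qed.

Lemma step_ext_subspace : is_subspace (step_ext P).
Proof.
have Ps := ideal_subspace hB hPi.
split; first by exists 0 => //; exists 0%N; rewrite mul0r.
move=> c _ _ [p Pp [k ->]] [r Pr [m ->]].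
exists (c *: (p * x ^+ m) + r * x ^+ k).
  by apply: PD; [apply: (subspaceZ _ Ps)|]; apply: PMr.
exists (m + k)%N; apply: (mulIr (uX (m + k))); rewrite mulXV mulrDl -scalerAl.
by rewrite {1}[(m + k)%N]addnC !exprD !mulrA !mulXV.
Qed.

Lemma step_extXl e : step_ext P e -> step_ext P (x * e).
Proof.
move=> [p Pp [k ->]]; exists (x * p); first exact: PMl.
by exists k; rewrite mulrA.
Qed.

(** Conjugation by [x] visibly preserves [step_ext P]. The inverse direction follows from
    [conj_stableV], once p x^m has been put in the lower level. *)
Lemma step_extXVl e n : step_ext P e -> step_ext P (x ^- n * e).
Proof.
move=> [p Pp [k ->]]; have [m B'p] := alg_denom (PB Pp).
have : step_ext P (x ^- n * (p * x ^+ m) * x ^+ n).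
  apply: conj_stableV => //; first exact: step_ext_subspace.
    by move=> a Ea; rewrite -[x^-1]/(x ^- 1); apply/step_extVr/step_extXl.
  by exists (p * x ^+ m); [exact: PMr|exists 0%N; rewrite invr1 mulr1].
move=> /(step_extVr n)/(step_extVr m)/(step_extVr k).
by rewrite mulXK mulrA mulXK mulrA.
Qed.

Lemma step_extMl s e : B s \/ B' s -> step_ext P e -> step_ext P (s * e).
Proof.
have BM u f : B u -> step_ext P f -> step_ext P (u * f).
  move=> Bu [p Pp [k ->]]; exists (u * p); first exact: PMl.
  by exists k; rewrite mulrA.
case=> [|B's Ee]; first exact: BM.
have [n Bs] := step_denom B's.
have := BM _ _ Bs (step_extXVl n Ee).
by rewrite mulrA mulXK.
Qed.

Lemma step_extMr s e : B s \/ B' s -> step_ext P e -> step_ext P (e * s).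
Proof.
have BM u f : B' u -> step_ext P f -> step_ext P (f * u).
  move=> Bu [p Pp [k ->]]; have [n Bn] := step_denom (alg_conjV k Bu).
  exists (p * (x ^- k * u * x ^+ k * x ^+ n)); first exact: PMr.
  by exists (k + n)%N; rewrite exprD invrM // !mulrA !mulXK.
case=> [Bs Ee|]; last exact: BM.
have [n B's] := alg_denom Bs.
have := step_extVr n (BM _ _ B's Ee).
by rewrite mulrA mulXK.
Qed.

(* Left noetherianity gives one power of x that multiplies the whole ideal
   step_ext P /\ B into P; primeness then concludes. *)
Lemma step_ext_inv r : B r -> step_ext P r -> P r.
Proof.
move=> Br Er; pose I := [set r | B r /\ step_ext P r].
have hI : left_ideal B I.
  split=> [a []//| |a b [Ba Ea] [Bb Eb]|s a Bs [Ba Ea]].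
  - by split; [exact (subalg0 hB)|case: step_ext_subspace].
  - by split; [exact: (subalgD hB)|apply: (subspaceD step_ext_subspace)].
  - by split; [exact: (subalgM hB)|apply: step_extMl => //; left].
have [g gI gJ] := level_noetherian hl hI.
have [n gn] : exists n, forall a, a \in g -> P (a * x ^+ n).
  elim: g gI {gJ} => [|a g IHg] gI; first by exists 0%N.
  have [|n gn] := IHg; first by move=> b bg; apply: gI; rewrite inE bg orbT.
  have [_ [p Pp [k e]]] := gI a (mem_head _ _).
  exists (k + n)%N => b; rewrite inE => /predU1P[->|/gn Pb].
    by rewrite exprD mulrA e mulXV; apply: PMr.
  by rewrite addnC exprD mulrA; apply: PMr.
have IP a : I a -> P (a * x ^+ n).
  move=> Ia; suff [] : [set r | B r /\ P (r * x ^+ n)] a by [].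
  apply: gJ Ia => [|b bg]; last by split; [case: (gI b bg)|apply: gn].
  split=> [b []//| |b c [Bb Pb] [Bc Pc]|s b Bs [Bb Pb]].
  - by split; [exact (subalg0 hB)|rewrite mul0r].
  - by split; [exact: (subalgD hB)|rewrite mulrDl; apply: PD].
  - by split; [exact: (subalgM hB)|rewrite -mulrA; apply: PMl].
have [_ prP] := hP.
(* For every s, r s still lies in the left ideal that x^n sends into [P], so r B x^n is contained in
   [P]. *)
case: (prP r (x ^+ n) Br (BX n)) => // [s Bs|/XP //].
apply: IP; split; first exact: (subalgM hB).
by apply: step_extMr => //; left.
Qed.

Lemma step_outP r : B r -> P r <-> exists n, step_out P (r * x ^+ n).
Proof.
move=> Br; split=> [Pr|[n [_ /(step_extVr n)]]]; last first.
  by rewrite mulXK; apply: step_ext_inv.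
have [n B'r] := alg_denom Br; exists n; split=> //.
by exists (r * x ^+ n); [apply: PMr|exists 0%N; rewrite invr1 mulr1].
Qed.

Lemma step_out_prime : elt_prime B' (step_out P).
Proof.
have hE := step_ext_subspace.
split.
  split=> [a []//| |a b [Ba Ea] [Bb Eb]|s a Bs [Ba Ea]].
  - by split; [exact (subalg0 hB')|case: hE].
  - by split; [exact: (subalgD hB')|apply: (subspaceD hE)].
  - by split; (split; [exact: (subalgM hB')|]);
      [apply: step_extMl => //; right|apply: step_extMr => //; right].
move=> a b B'a B'b asb.
have [k Ba] := step_denom B'a; have [m Bb] := step_denom B'b.
have [_ prP] := hP.
have ext_of c i : P (c * x ^+ i) -> B' c -> step_out P c.
  move=> Pc B'c; split=> //; exists (c * x ^+ i) => //.
  by exists i; rewrite mulXK.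
case: (prP _ _ Ba Bb) => [s Bs|/ext_of|/ext_of]; [|by left; auto|by right; auto].
apply: step_ext_inv; first by apply: (subalgM hB) => //; apply: (subalgM hB).
have [n B's] := alg_denom Bs.
(* Write s as (s x^n) x^-n, with s x^n in the lower level; replacing [b] by its conjugate by x^n
   then moves x^-n to the far right. *)
pose V := [set y | forall s', B' s' -> step_ext P (a * s' * y)].
have : V (x ^- n * b * x ^+ n).
  apply: (@conj_stableV V b n) => //.
  - split=> [s' _|c u v Vu Vv s' B's'].
      by rewrite mulr0; case: hE.
    by rewrite mulrDr -scalerAr; case: hE => _; apply; [apply: Vu|apply: Vv].
  - move=> y Vy s' B's'; rewrite -[x^-1]/(x ^- 1) mulrA; apply: step_extVr.
    rewrite mulrA -[a * s' * x]mulrA; apply: Vy.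
    exact (subalgM hB' B's' B'x).
  - by move=> s' /asb[].
move=> /(_ (x ^+ k * (s * x ^+ n))) /(_ (subalgM hB' (B'X k) B's)).
move=> /(step_extVr n)/(step_extXr m).
by rewrite !mulrA !mulXK.
Qed.

End Out.

Lemma step_graph_gamma t a b : gamma Y t (a, b) -> exists a' b',
  [/\ gamma Y' t (a', b'), morph_graph setT Y' Y (a', a)
    & morph_graph setT Y' Y (b', b)].
Proof.
have hG := gammaP Y' t; have hg := graphP Y' Y => Gab.
pose S : set (D * D) := [set p | exists a' b', [/\ gamma Y' t (a', b'),
  morph_graph setT Y' Y (a', p.1) & morph_graph setT Y' Y (b', p.2)]].
suff : S (a, b) by [].
apply: graph_sub Gab => [|i]; last first.
  exists (Y' i), (t i *: Y' i); split; first exact (@gamma_gen Y' t i).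
    exact (@graph_gen _ _ _ _ Y' Y i).
  exact (subalgZ (t i) hg (@graph_gen _ _ _ _ Y' Y i)).
apply/is_subalgP; split=> [|c u v [u1 [u2 [Gu g1 g2]]] [v1 [v2 [Gv k1 k2]]]|
  u v [u1 [u2 [Gu g1 g2]]] [v1 [v2 [Gv k1 k2]]]].
- by exists 1, 1; split; [exact (subalg1 hG)|exact (subalg1 hg)..].
- exists (c *: u1 + v1), (c *: u2 + v2); split.
  + exact (subalgD hG (subalgZ c hG Gu) Gv).
  + exact (subalgD hg (subalgZ c hg g1) k1).
  + exact (subalgD hg (subalgZ c hg g2) k2).
- exists (u1 * v1), (u2 * v2); split.
  + exact (subalgM hG Gu Gv).
  + exact (subalgM hg g1 k1).
  + exact (subalgM hg g2 k2).
Qed.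

Lemma step_in_stable t P : is_ideal B P -> P x ->
  gamma_stable Y' t (step_in P) -> gamma_stable Y t P.
Proof.
move=> hP xP st a b /step_graph_gamma[a' [b' [G ga gb]]].
by move=> /(step_inP hP xP ga)/(st _ _ G)/(step_inP hP xP gb).
Qed.

Lemma step_out_stable t P : elt_prime B P -> (forall n, ~ P (x ^+ n)) ->
  (forall i : 'I_N, (i <= j)%N -> t i = 1) ->
  gamma_stable Y' t (step_out P) -> gamma_stable Y t P.
Proof.
move=> hP XP t1 st a b Gab Pa; have [Ba Bb] := gamma_dom Gab.
have [n Gn] := gamma_denom t1 Gab; have [Ba' _] := gamma_dom Gn.
apply/(step_outP hP XP Bb); exists n; apply: st Gn _; split=> //.
exists (a * x ^+ n); last by exists 0%N; rewrite invr1 mulr1.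
by case: hP => -[_ _ _ PM] _; case: (PM _ _ (BX n) Pa).
Qed.

(* As q_k is not a root of unity, stability under T_k |-> q_k T_k expresses that
   an ideal is graded by the degree in T_k. *)
Definition scale_at (k : 'I_N) (i : 'I_N) : K := if i == k then cgl_q C k else 1.

(** * Degrees in x, and components of degree 0 *)

Local Notation q := (cgl_q C j).
Local Notation G := (gamma Y' (scale_at j)).
Local Notation I := (ideal_gen B [set x]).
Local Notation g := (morph_graph setT Y' Y).

Let hG : is_subalg G := gammaP Y' (scale_at j).
Let hg : is_subalg g := graphP Y' Y.
Let hI : is_ideal B I.
Proof. by apply: (ideal_genP hB _).1 => _ ->. Qed.
Let hIs : is_subspace I := ideal_subspace hB hI.
Let Ix : I x.
Proof. by apply: (ideal_genP hB _).2 => // _ ->. Qed.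

(** On deleted coefficients g_j undoes the deletion, since it does so on the generators. *)
Lemma step_graph_theta a : Rm j a -> g (theta a, psi a).
Proof.
have [tlin tM t1] := step_map_morphism D_field j_gt0 hl.
have [plin pM p1] := step_psi_morphism hl.
have hR := initial_subalgP X j => Ra.
suff : [set a | Rm j a /\ g (theta a, psi a)] a by case.
move: a Ra; apply: initial_subalg_sub => [|i ij].
  apply/is_subalgP; split=> [|c u v [Ru gu] [Rv gv]|u v [Ru gu] [Rv gv]].
  - by split; [exact (subalg1 hR)|rewrite t1 p1; exact (subalg1 hg)].
  - split; first exact (subalgD hR (subalgZ c hR Ru) Rv).
    by rewrite tlin // plin //; exact (subalgD hg (subalgZ c hg gu) gv).
  - split; first exact (subalgM hR Ru Rv).
    by rewrite tM // pM //; exact (subalgM hg gu gv).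
split; first exact: initial_subalg_gen.
rewrite -(step_genE hl ij) -(level_gen hl); last exact: leqW.
exact (@graph_gen _ _ _ _ Y' Y i).
Qed.

Lemma scale_at_fixed i : i != j -> scale_at j i = 1.
Proof. by rewrite /scale_at => /negPf ->. Qed.

Lemma gamma_theta a n : Rm j a -> G (theta a * x ^+ n, q ^+ n *: (theta a * x ^+ n)).
Proof.
move=> Ra; have Ft : fixed_alg (scale_at j) (theta a).
  apply: fixed_alg_theta => // i ij; apply: scale_at_fixed.
  by rewrite neq_ltn ij.
elim: n => [|n IHn]; first by rewrite mulr1 scale1r.
have Gx : G (x, q *: x).
  by have := @gamma_gen Y' (scale_at j) j; rewrite /scale_at eqxx Y'j.
have := subalgM hG IHn Gx.
rewrite (_ : _ * _ = (theta a * x ^+ n.+1, q ^+ n.+1 *: (theta a * x ^+ n.+1))) //.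
by congr pair; rewrite /= -?scalerAr -?scalerAl ?scalerA -?exprS -mulrA -exprSr.
Qed.

(** Sums of components of degree other than [n]. Natural exponents suffice, as Laurent polynomials
    are first multiplied by a power of [x]. *)
Definition off_degree n : set D :=
  eigensum G (fun c => exists2 i, i != n & c = q ^+ i).

Lemma off_degreeP n : is_subspace (off_degree n).
Proof. exact: eigensum_subspace (subalg_subspace hG) _. Qed.

Lemma off_degreeX n m y : off_degree n y -> off_degree (n + m) (y * x ^+ m).
Proof.
apply: (eigensum_map (subalg_subspace hG) (h := fun y => y * x ^+ m)).
- by move=> a b; rewrite mulrDl.
- by rewrite mul0r.
move=> _ [i ni ->]; exists (q ^+ (i + m)).
  by exists (i + m)%N; rewrite // eqn_add2r.
move=> v Gv; have Gx : G (x ^+ m, q ^+ m *: x ^+ m).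
  elim: m => [|m IHm]; first by rewrite scale1r; exact (subalg1 hG).
  have Gx : G (x, q *: x).
    by have := @gamma_gen Y' (scale_at j) j; rewrite /scale_at eqxx Y'j.
  have := subalgM hG IHm Gx.
  rewrite (_ : _ * _ = (x ^+ m.+1, q ^+ m.+1 *: x ^+ m.+1)) //.
  by congr pair; rewrite /= -?scalerAr -?scalerAl ?scalerA -?exprS -exprSr.
have := subalgM hG Gv Gx.
rewrite (_ : _ * _ = (v * x ^+ m, q ^+ (i + m) *: (v * x ^+ m))) //.
by congr pair; rewrite /= -scalerAr -scalerAl scalerA exprD mulrC.
Qed.

Lemma off_degreeMl n (u y : D) : G (u, u) -> off_degree n y -> off_degree n (u * y).
Proof.
move=> Gu; apply: (eigensum_map (subalg_subspace hG) (h := fun y => u * y)).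
- by move=> a b; rewrite mulrDr.
- by rewrite mulr0.
move=> c Qc; exists c => // v Gv.
have := subalgM hG Gu Gv.
rewrite (_ : _ * _ = (u * v, c *: (u * v))) //.
by congr pair; rewrite /= -scalerAr.
Qed.

(* Pairs (e, r) such that r is, modulo the ideal I of x, the image under g of
   the component of degree 0 in x of e, where e is a Laurent polynomial in x. *)
Definition deg0 : set (D * D) := [set p | exists n u c, [/\ g (u, c), I (p.2 - c),
  G (u, u) & off_degree n ((p.1 - u) * x ^+ n)]].

Lemma deg0P : is_subspace deg0.
Proof.
have hOff := off_degreeP.
split.
  exists 0%N, 0, 0; rewrite /= !subr0 mul0r; split.
  - exact (subalg0 hg).
  - by case: hIs.
  - exact (subalg0 hG).
  - by case: (hOff 0%N).
move=> k [e r] [e' r'] [n [u [c [/= gu Ic Gu Oe]]]] [n' [u' [c' [/= gu' Ic' Gu' Oe']]]].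
exists (n + n')%N, (k *: u + u'), (k *: c + c'); split=> /=.
- exact (subalgD hg (subalgZ k hg gu) gu').
- by rewrite opprD addrACA -scalerBr; case: hIs => _; apply.
- exact (subalgD hG (subalgZ k hG Gu) Gu').
rewrite opprD addrACA -scalerBr mulrDl -scalerAl.
case: (hOff (n + n')%N) => _; apply.
  by rewrite exprD mulrA; apply: off_degreeX.
by rewrite addnC exprD mulrA; apply: off_degreeX.
Qed.

Lemma deg0_ideal r : I r -> deg0 (0, r).
Proof.
move=> Ir; exists 0%N, 0, 0; rewrite /= !subr0 mul0r; split=> //.
- exact (subalg0 hg).
- exact (subalg0 hG).
- by case: (off_degreeP 0).
Qed.

Lemma deg0Ml (u c e r : D) : B r -> g (u, c) -> G (u, u) -> deg0 (e, r) ->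
  deg0 (u * e, c * r).
Proof.
move=> Br guc Gu [n [v [d [/= gv Id Gv Oe]]]]; exists n, (u * v), (c * d).
split=> /=; first exact (subalgM hg guc gv).
- by rewrite -mulrBr; case: hI => _ _ _ IM; case: (IM c (r - d)) => //;
    case: (graph_dom guc).
- exact (subalgM hG Gu Gv).
- by rewrite -mulrBr -mulrA; apply: off_degreeMl.
Qed.

Lemma delta_in_ideal a : Rm j a -> I (psi (delta j a)).
Proof.
move=> Ra; have [_ _ _ IM] := hI.
have Bpsi b : Rm j b -> B (psi b).
  by move=> /step_graph_theta /graph_dom[].
have -> : psi (delta j a) = x * psi a - psi (sigma j a) * x.
  by rewrite (step_psiX hl) // addrC addKr.
apply: (subspaceB hIs); first by case: (IM _ _ (Bpsi _ Ra) Ix).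
have Bs : B (psi (sigma j a)) by apply: Bpsi; apply: sigma_initial.
by case: (IM _ _ Bs Ix).
Qed.

(** Expand [psi a] as [theta a] plus terms theta (delta b) x^-k with k > 0. For i = 0 the degree 0
    part is [theta a]. For i > 0 it comes from the terms with k = i, which g sends into the ideal of
    [x], where psi a x^i also lies. *)
Lemma deg0_monomial a i : Rm j a -> deg0 (psi a * x ^+ i, psi a * x ^+ i).
Proof.
move=> Ra; have [_ _ _ IM] := hI.
have dR b : Rm j b -> Rm j (delta j b) by case: (delta_der C j) => H _ _; apply: H.
have Gfix b : Rm j b -> G (theta b, theta b).
  by move=> Rb; have := gamma_theta 0 Rb; rewrite mulr1 scale1r.
have Wt b : Rm j b -> forall m, m != 0%N -> deg0 (theta b * x ^+ m, 0).
  move=> Rb m m0; exists 0%N, 0, 0; rewrite /= !subr0 mulr1; split.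
  - exact (subalg0 hg).
  - by case: hIs.
  - exact (subalg0 hG).
  - by apply: (@eigensum1 _ _ _ _ (q ^+ m)); [exists m|exact: gamma_theta].
have inv m : deg0 ((psi a - theta a) * x ^+ m, 0).
  pose V := [set e | deg0 (e * x ^+ m, 0)].
  suff : V (psi a - theta a) by [].
  apply: (step_map_inverse D_field j_gt0 hl) => // [|k b k0 Rb].
    split; first by rewrite /V /= mul0r; case: deg0P.
    move=> c u v Vu Vv; have [_ /(_ c _ _ Vu Vv)] := deg0P.
    rewrite (_ : _ + _ = ((c *: u + v) * x ^+ m, 0)) //.
    by congr pair; rewrite /= ?scaler0 ?addr0 // mulrDl -scalerAl.
  rewrite /V /=; have [->|mk] := eqVneq m k.
    rewrite mulXV; exists 0%N, (theta (delta j b)), (psi (delta j b)).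
    rewrite subrr mul0r sub0r; split=> //=.
    - exact (step_graph_theta (dR _ Rb)).
    - exact (subspaceN hIs (delta_in_ideal Rb)).
    - exact (Gfix _ (dR _ Rb)).
    - by case: (off_degreeP 0).
  exists k, 0, 0; rewrite /= !subr0; split.
  - exact (subalg0 hg).
  - by case: hIs.
  - exact (subalg0 hG).
  rewrite -[_ * x ^+ m * _]mulrA -exprD addnC exprD mulrA mulXV.
  by apply: (@eigensum1 _ _ _ _ (q ^+ m)); [exists m|exact (gamma_theta m (dR _ Rb))].
have [->|i0] := eqVneq i 0%N.
  have W1 : deg0 (theta a, psi a).
    exists 0%N, (theta a), (psi a); rewrite /= !subrr mul0r; split.
    - exact (step_graph_theta Ra).
    - by case: hIs.
    - exact (Gfix _ Ra).
    - by case: (off_degreeP 0).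
  have := subspaceD deg0P (inv 0%N) W1.
  rewrite !mulr1 (_ : _ + _ = (psi a, psi a)) //.
  by congr pair; rewrite /= ?add0r // subrK.
have Ip : I (psi a * x ^+ i).
  case: i i0 => // i _; rewrite exprSr mulrA.
  have Ba : B (psi a * x ^+ i).
    by apply: (subalgM hB) => //; case: (graph_dom (step_graph_theta Ra)).
  by case: (IM _ _ Ba Ix).
have := subspaceD deg0P (subspaceD deg0P (inv i) (Wt a Ra i i0)) (deg0_ideal Ip).
rewrite (_ : _ + _ = (psi a * x ^+ i, psi a * x ^+ i)) //.
by congr pair; rewrite /= ?add0r // addr0 -mulrDl subrK.
Qed.

(** The Ore expansion settles R_(j+1). Each later generator is fixed by the rescaling and by g, so
    it may be multiplied on the left; hence the right coefficients. *)
Lemma deg0_all p : B p -> deg0 (p, p).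
Proof.
suff all l : (l <= N)%N -> (j < l)%N -> forall p, initial_subalg Y l p -> deg0 (p, p).
  by apply: all.
have pair_sum n (F : nat -> D) : (forall k, deg0 (F k, F k)) ->
    deg0 (\sum_(k < n) F k, \sum_(k < n) F k).
  move=> WF; elim: n => [|n IHn]; first by rewrite !big_ord0; case: deg0P.
  by rewrite !big_ord_recr /=; exact (subspaceD deg0P IHn (WF n)).
elim: l => // l IHl lN; rewrite ltnS leq_eqVlt => /predU1P[<-|jl] {}p Lp.
  have /(level_initialP hl)[b Rb ->] := Lp.
  have [_ _ _ span _] := cgl_ore C j; have [n [a [Ra ->]]] := span b Rb.
  have [plin pM p1] := level_morphism hl.
  have up a' : Rm j a' -> Rm j.+1 a' by apply: initial_subalg_le.
  have hR := initial_subalgP X j.+1.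
  have RX : Rm j.+1 (X j) by apply: initial_subalg_gen.
  have RXk k : Rm j.+1 (X j ^+ k) := subalgX k hR RX.
  have pX k : psi (X j ^+ k) = x ^+ k.
    elim: k => [|k IHk]; first by rewrite !expr0.
    by rewrite !exprS pM // IHk (level_gen hl).
  rewrite (linear_on_sum hR plin n (F := fun k => a k * X j ^+ k)); last first.
    by move=> k; apply: (subalgM hR) => //; apply: up.
  apply: (pair_sum n (fun k => psi (a k * X j ^+ k))) => k.
  by rewrite pM ?pX //; [apply: deg0_monomial|apply: up].
pose lo := Ordinal lN.
have lY (i : 'I_N) : (i < lo)%N ->
    exists2 mu : K, mu != 0 & Y lo * Y i = mu *: (Y i * Y lo).
  move=> il; exists (lambda lo i); first exact: cgl_lambda_neq0.
  exact: (level_comm hl).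
have hS := initial_subalgP Y l.
have [s Ss||n [a [Sa ->]]] := @gen_rpoly _ _ (initial_subalg Y l) (Y lo) hS _ p.
- have [[s' Ss' e] _] := normal_initial lY Ss.
  by exists s', 0; rewrite addr0; split=> //; exact (subalg0 hS).
- by have := initial_subalgS Y lo; rewrite [val lo]/= => <-.
apply: (pair_sum n (fun k => Y lo ^+ k * a k)) => k.
have WT : g (Y lo, Y lo) /\ G (Y lo, Y lo).
  have e := step_gen_ge C Y (ltnW jl : (j <= lo)%N).
  split; first by rewrite -{1}e; exact (@graph_gen _ _ _ _ Y' Y lo).
  rewrite -e; apply: gamma_fix; apply: scale_at_fixed.
  by rewrite neq_ltn jl orbT.
have Bl b : initial_subalg Y l b -> B b by apply: initial_subalg_le; apply: ltnW.
elim: k (a k) (Sa k) => [|k IHk] b Sb; first by rewrite mul1r; apply: IHl => //;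
  exact: ltnW.
rewrite exprS -mulrA; case: WT => gT GT; apply: deg0Ml => //; last exact: IHk.
apply: (subalgM hB); last exact: Bl.
by apply: (subalgX k hB); apply: initial_subalg_gen.
Qed.

Lemma step_out_in (P P' : set D) : elt_prime B P -> (forall n, ~ P (x ^+ n)) ->
  is_ideal B P' -> P' x -> gamma_stable Y' (scale_at j) (step_out P) ->
  step_out P `<=` step_in P' -> P `<=` P'.
Proof.
move=> hP XP hP' xP' st QQ' p Pp.
have [[PB _ _ PM] _] := hP.
have IP' : I `<=` P' by apply: ideal_gen_sub => // _ ->.
have [n [u [c [/= guc Ipc Gu Op]]]] := deg0_all (PB _ Pp).
suff Qu : step_out P u.
  have /QQ' /(step_inP hP' xP' guc) P'c := Qu.
  rewrite -(subrK c p); apply: (subspaceD (ideal_subspace hB hP')) => //.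
  exact: IP'.
have Qs : is_subspace (step_out P).
  apply: ideal_subspace hB' _; exact: (step_out_prime hP XP).1.
have [B'u _] := gamma_dom Gu.
have Gun : G (u * x ^+ n, q ^+ n *: (u * x ^+ n)).
  have Gx : G (x ^+ n, q ^+ n *: x ^+ n).
    elim: (n) => [|m IHm]; first by rewrite scale1r; exact (subalg1 hG).
    have Gx : G (x, q *: x).
      by have := @gamma_gen Y' (scale_at j) j; rewrite /scale_at eqxx Y'j.
    have := subalgM hG IHm Gx.
    rewrite (_ : _ * _ = (x ^+ m.+1, q ^+ m.+1 *: x ^+ m.+1)) //.
    by congr pair; rewrite /= -?scalerAr -?scalerAl ?scalerA -?exprS -exprSr.
  have := subalgM hG Gu Gx.
  rewrite (_ : _ * _ = (u * x ^+ n, q ^+ n *: (u * x ^+ n))) //.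
  by congr pair; rewrite /= -scalerAr.
have Qpn : step_out P (u * x ^+ n + (p - u) * x ^+ n).
  rewrite -mulrDl addrC subrK; split.
    rewrite -[p](subrK u) mulrDl; apply: (subalgD hB'); last exact: (subalgM hB').
    case: Op => s [-> hs]; rewrite big_seq.
    apply: (subspace_sum _ (subalg_subspace hB')) => v /hs[_ /gamma_dom[]] //.
  exists (p * x ^+ n); last by exists 0%N; rewrite invr1 mulr1.
  by case: (PM _ _ (BX n) Pp).
(* Distinct degrees have distinct eigenvalues, so u x^n can be separated from the other components
   of p x^n. *)
have nQ : ~ (exists2 i, i != n & q ^+ n = q ^+ i).
  have qi k m : (k < m)%N -> q ^+ m <> q ^+ k.
    move=> km e; have mk : (0 < m - k)%N by rewrite subn_gt0.
    have /negP := cgl_q_not_root_of_unity C j_gt0 mk; apply; apply/eqP.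
    have q0 : q ^+ k != 0 by rewrite expf_neq0 // cgl_q_neq0.
    by apply: (mulIf q0); rewrite mul1r -exprD subnK // ltnW.
  by move=> [i]; rewrite neq_ltn => /orP[/qi|/qi h /esym].
have [_ /(step_extVr n)] := eigensum_separate (subalg_subspace hG) Qs st nQ Gun Op Qpn.
by rewrite mulXK.
Qed.

Lemma step_out_mono (P P' : set D) : elt_prime B P -> (forall n, ~ P (x ^+ n)) ->
  elt_prime B P' -> (forall n, ~ P' (x ^+ n)) ->
  step_out P `<=` step_out P' -> P `<=` P'.
Proof.
move=> hP XP hP' XP' QQ' p Pp; have Bp : B p by case: hP => -[/(_ p Pp)].
have [n Qn] := (step_outP hP XP Bp).1 Pp.
by apply/(step_outP hP' XP' Bp); exists n; apply: QQ'.
Qed.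

Lemma step_in_mono (P P' : set D) : is_ideal B P -> P x ->
  is_ideal B P' -> P' x -> step_in P `<=` step_in P' -> P `<=` P'.
Proof.
move=> hP xP hP' xP' QQ' p Pp; have Bp : B p by case: hP => /(_ p Pp).
have [a gap] := graph_surj Y' Bp.
by apply/(step_inP hP' xP' gap)/QQ'/(step_inP hP xP gap).
Qed.

(** [x] lies in the first set; if it were in the second, dividing by [x] would put 1 in P'. *)
Lemma step_in_out (P P' : set D) : is_ideal B P -> P x ->
  elt_prime B P' -> (forall n, ~ P' (x ^+ n)) ->
  ~ (step_in P `<=` step_out P').
Proof.
move=> hP xP hP' XP' QQ'; apply: (XP' 0%N).
have B1 : B 1 by exact (subalg1 hB).
apply/(step_outP hP' XP' B1); exists 1%N; rewrite mul1r; apply: QQ'.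
have gx : g (x, x) by rewrite -{1}Y'j; exact (@graph_gen _ _ _ _ Y' Y j).
exact/(step_inP hP xP gx).
Qed.

Lemma step_in1 (P : set D) : P 1 -> step_in P 1.
Proof.
move=> P1; split; first exact (subalg1 hB').
exists 1 => //; exists 1; first exact (subalg1 hg).
by rewrite subrr; case: hIs.
Qed.

Lemma step_out1 (P : set D) n : P (x ^+ n) -> step_out P 1.
Proof.
move=> Pn; split; first exact (subalg1 hB').
by exists (x ^+ n) => //; exists n; rewrite mulrV.
Qed.

End Step.

End LevelIdeals.

(** * The chain of ideals *)

Section Chain.
Local Open Scope classical_set_scope.
Local Open Scope ring_scope.
Variables (K : fieldType) (R : algType K) (N : nat) (C : cgl_extension R N).
Variables (D : unitAlgType K) (f : R -> D).
Hypothesis hf : division_ring_of_fractions f.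

Local Notation Y := (cauchon_gen C f).
Local Notation B m := (initial_subalg (Y m) N).

Let D_field (y : D) : y != 0 -> y \is a GRing.unit.
Proof. by case: hf => _ _ H _ _; apply: H. Qed.

Let level_ex m : (0 < m <= N)%N -> exists psi, level C m (Y m) psi.
Proof. by case: hf => -[f_lin f_mon] f_inj _ _ _; apply: cauchon_level. Qed.

Lemma cauchon_algE m : cauchon_alg C f m = B m.
Proof. by rewrite initial_subalgN. Qed.

Lemma cauchon_gen_step (j : 'I_N) : Y j = step_gen C j (Y j.+1).
Proof. exact: cauchon_gen_ord. Qed.

Lemma spec_stepE (j : 'I_N) P : spec_step C f j P =
  if `[< P (Y j.+1 j) >] then step_in C j (Y j.+1) P else step_out C j (Y j.+1) P.
Proof.
by rewrite /spec_step /step_in /step_out /g_coset !cauchon_algE cauchon_gen_step.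
Qed.

(** The intermediate values of [canonical_embedding J], which is [chain J 1] by conversion. *)
Definition chain (J : set R) (m : nat) : set D :=
  foldr (spec_step C f) (f @` J) [seq j : 'I_N <- enum 'I_N | (m <= j)%N].

Lemma chainN J : chain J N = f @` J.
Proof.
rewrite /chain (eq_in_filter (a2 := pred0)) ?filter_pred0 // => j _.
by rewrite leqNgt ltn_ord.
Qed.

Lemma chainS J (j : 'I_N) : chain J j = spec_step C f j (chain J j.+1).
Proof.
rewrite /chain; suff -> : [seq i : 'I_N <- enum 'I_N | (j <= i)%N] =
  j :: [seq i : 'I_N <- enum 'I_N | (j < i)%N] by [].
have srt (p : pred 'I_N) :
    sorted (relpre val ltn) [seq i <- enum 'I_N | p i].
  apply: sorted_filter; first by move=> a b c; apply: ltn_trans.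
  by rewrite -sorted_map val_enum_ord iota_ltn_sorted.
apply: (irr_sorted_eq (leT := relpre val ltn)) => //.
- by move=> a b c; apply: ltn_trans.
- by move=> a; apply: ltnn.
- rewrite /= path_sortedE; last by move=> a b c; apply: ltn_trans.
  by rewrite srt andbT; apply/allP => i; rewrite mem_filter => /andP[].
move=> i; rewrite inE mem_filter [in RHS]mem_filter mem_enum !andbT leq_eqVlt.
by rewrite eq_sym.
Qed.


Lemma chain_one J m : (0 < m <= N)%N -> chain J m 1 -> chain J 1 1.
Proof.
elim: m => // -[//|m] IHm mN c1; apply: IHm; first exact: (ltnW mN).
pose j := Ordinal (mN : (m.+1 < N)%N).
have [psi hl] := level_ex (mN : (0 < j.+1 <= N)%N).
rewrite -[m.+1]/(val j) chainS spec_stepE.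
case: ifP => _; first exact: step_in1.
exact: (step_out1 (n := 0) D_field hl).
Qed.

Lemma top_algP b : B N b <-> exists a, b = f a.
Proof.
have [[f_lin f_mon] f_inj _ _ _] := hf.
have hl := level_top C f_lin f_mon f_inj.
rewrite cauchon_genN; have e := level_initialP hl b.
split=> [Bb|[a ->]]; first by have [a _ ->] := e.1 Bb; exists a.
by apply/(level_initialP hl); exists a; rewrite ?cgl_full.
Qed.

Lemma top_prime J : is_prime_ideal setT J -> elt_prime (B N) (chain J N).
Proof.
have [[f_lin [f1 fM]] f_inj _ _ _] := hf.
have f0 : f 0 = 0.
  by have := f_lin (-1) 0 0; rewrite scaler0 addr0 scaleN1r addNr.
have fD a b : f (a + b) = f a + f b.
  by have := f_lin 1 a b; rewrite !scale1r.
move=> /prime_elt_prime[[_ J0 JD JM] prJ]; rewrite chainN; split.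
  split=> [_ [a _ <-]| |_ _ [a Ja <-] [b Jb <-]|s _ /top_algP[r ->] [a Ja <-]].
  - by apply/top_algP; exists a.
  - by exists 0.
  - by exists (a + b); [exact: JD|rewrite fD].
  - have [] := JM r a I Ja; split; last by exists (a * r); rewrite ?fM.
    by exists (r * a); rewrite ?fM.
move=> _ _ /top_algP[a ->] /top_algP[b ->] asb.
have [s _|Ja|Jb] := prJ a b I I; [|by left; exists a|by right; exists b].
have /asb[c Jc] : B N (f s) by apply/top_algP; exists s.
by rewrite -!fM => /f_inj <-.
Qed.

Lemma chain_neq J (j : 'I_N) : (0 < j)%N -> ~ chain J 1 1 ->
  ~ chain J j.+1 (Y j.+1 j) -> forall n, ~ chain J j.+1 (Y j.+1 j ^+ n).
Proof.
move=> j0 n1 nx n Pn; apply: n1; apply: (@chain_one J j).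
  by rewrite j0 ltnW.
have [psi hl] := level_ex (ltn_ord j : (0 < j.+1 <= N)%N).
rewrite chainS spec_stepE asboolF //.
exact: (step_out1 D_field hl Pn).
Qed.

Lemma chain_prime J m : is_prime_ideal setT J -> ~ chain J 1 1 ->
  (0 < m <= N)%N -> elt_prime (B m) (chain J m).
Proof.
move=> hJ n1 /andP[m0 mN]; rewrite -(subKn mN).
have : (N - m < N)%N by rewrite ltn_subrL m0 (leq_trans m0).
elim: (N - m)%N => [|d IHd] dN; first by rewrite subn0; apply: top_prime.
have jN : (N - d.+1 < N)%N by lia.
pose j := Ordinal jN; have j0 : (0 < j)%N by rewrite /=; lia.
have e : (N - d = j.+1)%N by rewrite /=; lia.
move: (IHd (ltnW dN)); rewrite e -[(N - d.+1)%N]/(val j) => hP.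
have [psi hl] := level_ex (ltn_ord j : (0 < j.+1 <= N)%N).
rewrite chainS spec_stepE cauchon_gen_step; have [Px|Px] := asboolP.
  exact: (step_in_prime D_field j0 hl hP.1 Px hP).
exact: (step_out_prime D_field j0 hl hP (chain_neq j0 n1 Px)).
Qed.

Lemma chain_stable_step J (j k : 'I_N) : is_prime_ideal setT J ->
  ~ chain J 1 1 -> (0 < j < k)%N ->
  gamma_stable (Y j) (scale_at C k) (chain J j) ->
  gamma_stable (Y j.+1) (scale_at C k) (chain J j.+1).
Proof.
move=> hJ n1 /andP[j0 jk].
have hP : elt_prime (B j.+1) (chain J j.+1) :=
  chain_prime hJ n1 (ltn_ord j : (0 < j.+1 <= N)%N).
have [psi hl] := level_ex (ltn_ord j : (0 < j.+1 <= N)%N).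
rewrite chainS spec_stepE cauchon_gen_step; have [Px|Px] := asboolP.
  exact: (step_in_stable D_field j0 hl hP.1 Px).
apply: (step_out_stable D_field j0 hl hP (chain_neq j0 n1 Px)) => i ij.
by rewrite scale_at_fixed // neq_ltn (leq_ltn_trans ij jk).
Qed.

Lemma chain_mono J J' : is_prime_ideal setT J -> is_prime_ideal setT J' ->
  ~ chain J 1 1 -> ~ chain J' 1 1 ->
  (forall k : 'I_N, (0 < k)%N -> gamma_stable (Y 1) (scale_at C k) (chain J 1)) ->
  chain J 1 `<=` chain J' 1 -> chain J N `<=` chain J' N.
Proof.
move=> hJ hJ' n1 n1' st1 mono1.
(* The bound m <= k is what can be carried upward: restoring the derivation at m may destroy
   homogeneity in T_m, right after its use. *)
suff all m : (0 < m <= N)%N -> chain J m `<=` chain J' m /\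
    forall k : 'I_N, (m <= k)%N -> gamma_stable (Y m) (scale_at C k) (chain J m).
  by case: (all N); rewrite // (cgl_N_gt0 C) leqnn.
elim: m => // -[_ _|m IHm mN]; first by split.
have [|mono st] := IHm; first exact: (ltnW mN).
pose j := Ordinal (mN : (m.+1 < N)%N).
rewrite -![m.+2]/(j.+1) -![m.+1]/(val j) in mono st *.
have j0 : (0 < j)%N by [].
have hP : elt_prime (B j.+1) (chain J j.+1) :=
  chain_prime hJ n1 (ltn_ord j : (0 < j.+1 <= N)%N).
have hP' : elt_prime (B j.+1) (chain J' j.+1) :=
  chain_prime hJ' n1' (ltn_ord j : (0 < j.+1 <= N)%N).
have [psi hl] := level_ex (ltn_ord j : (0 < j.+1 <= N)%N).
split; last first.
  by move=> k jk; apply: chain_stable_step => //; apply/st/ltnW.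
have XP := @chain_neq J j j0 n1; have XP' := @chain_neq J' j j0 n1'.
have stj := st j (leqnn j); move: mono stj.
rewrite !chainS !spec_stepE cauchon_gen_step.
have [Px|Px] := asboolP; have [Px'|Px'] := asboolP => mono stj.
- exact: (step_in_mono D_field j0 hl hP.1 Px hP'.1 Px').
- by case: (step_in_out D_field j0 hl hP.1 Px hP' (XP' Px') mono).
- exact: (step_out_in D_field j0 hl hP (XP Px) hP'.1 Px' stj).
- exact: (step_out_mono D_field j0 hl hP (XP Px) hP' (XP' Px')).
Qed.

(** The generators of K_w are only rescaled. Single-valuedness makes [S] an ideal; it is known at
    level 1 for rescalings fixing the generator of index 0, hence the condition on [k]. *)
Lemma K_ideal_stable (w : {set 'I_N}) (k : 'I_N) : (0 < k)%N ->
  gamma_stable (Y 1) (scale_at C k) (K_ideal C f w).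
Proof.
move=> k0; have [psi hl] := level_ex (cgl_N_gt0 C : (0 < 1 <= N)%N).
have hB := initial_subalgP (Y 1) N; have hG := gammaP (Y 1) (scale_at C k).
have t1 (i : 'I_N) : (i < 1)%N -> scale_at C k i = 1.
  by move=> i1; rewrite scale_at_fixed // neq_ltn (leq_trans i1).
have gfun a b b' : gamma (Y 1) (scale_at C k) (a, b) ->
    gamma (Y 1) (scale_at C k) (a, b') -> b = b'.
  exact: (gamma_fun (cgl_N_gt0 C) hl t1).
rewrite /K_ideal /quantum_space cauchon_algE.
set T := (X in ideal_gen _ X).
have TB : T `<=` B 1 by move=> _ [i _ <-]; apply: initial_subalg_gen.
have [hK TK] := ideal_genP hB TB; have [_ K0 KD KM] := hK.
pose S := [set a | B 1 a /\ forall b, gamma (Y 1) (scale_at C k) (a, b) ->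
  ideal_gen (B 1) T b].
move=> a b Gab Ka; suff [_] : S a by apply.
apply: ideal_gen_sub Ka => [|_ [i iw <-]].
  split=> [u []//| |u v [Bu Ku] [Bv Kv]|s u Bs [Bu Ku]].
  - split=> [|u /gfun /(_ (subalg0 hG)) -> //]; exact (subalg0 hB).
  - split; first exact: (subalgD hB).
    have [u' Gu] := gamma_ex (scale_at C k) Bu.
    have [v' Gv] := gamma_ex (scale_at C k) Bv.
    move=> c /gfun /(_ (subalgD hG Gu Gv)) ->.
    by apply: KD; [apply: Ku|apply: Kv].
  - have [u' Gu] := gamma_ex (scale_at C k) Bu.
    have [s' Gs] := gamma_ex (scale_at C k) Bs.
    have [_ Bs'] := gamma_dom Gs; have [Kl Kr] := KM _ _ Bs' (Ku _ Gu).
    split; (split; first exact: (subalgM hB)).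
      by move=> c /gfun /(_ (subalgM hG Gs Gu)) ->.
    by move=> c /gfun /(_ (subalgM hG Gu Gs)) ->.
split; first by apply: initial_subalg_gen.
move=> c /gfun /(_ (@gamma_gen _ _ _ (Y 1) (scale_at C k) i)) ->.
by apply: (subspaceZ _ (ideal_subspace hB hK)); apply: TK; exists i.
Qed.

Lemma final_gen_inj : injective (Y 1).
Proof.
have [psi hl] := level_ex (cgl_N_gt0 C : (0 < 1 <= N)%N).
suff lt (i k : 'I_N) : (i < k)%N -> Y 1 i <> Y 1 k.
  move=> i k e; apply/val_inj; have [ik|ki|//] := ltngtP i k.
    by case: (lt _ _ ik e).
  by case: (lt _ _ ki (esym e)).
move=> ik e.
(* The coefficients of T_i - T_k as a polynomial in T_k. *)
pose u n : D := if n == 0%N then Y 1 i else if n == 1%N then -1 else 0.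
have hk := initial_subalgP (Y 1) k.
have Lu n : initial_subalg (Y 1) k (u n).
  rewrite /u; case: eqP => _; first exact: initial_subalg_gen.
  case: eqP => _; last exact (subalg0 hk).
  exact (subspaceN (subalg_subspace hk) (subalg1 hk)).
have := @level_free _ _ _ _ _ _ _ _ hl k (leq_ltn_trans (leq0n i) ik) 2 u Lu.
rewrite !big_ord_recr big_ord0 /= /u /= add0r mul1r expr1 mulrN1 e subrr.
move=> /(_ erefl 1%N isT) /eqP; rewrite oppr_eq0 oner_eq0 //.
Qed.

(** K_w is contained in a prime of the stratum of [w], which exists because [w] is a diagram, is
    proper, and contains no T_i with i outside [w]. *)
Lemma diagram_proper (w : {set 'I_N}) : cauchon_diagram C f w ->
  ~ K_ideal C f w 1 /\ forall i, K_ideal C f w (Y 1 i) -> i \in w.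
Proof.
move=> [P _ [[[[QB Q0 QD QM] Qn] _] Qw]].
set Q := canonical_embedding C f P in QB Q0 QD QM Qn Qw.
have KQ : K_ideal C f w `<=` Q.
  apply: ideal_gen_sub => // _ [i iw <-].
  have : (Q `&` range (Y 1)) (Y 1 i) by rewrite Qw; exists i.
  by case.
split=> [/KQ Q1|i /KQ Qi].
  apply: Qn; apply/seteqP; split=> // s Bs.
  by have [] := QM s 1 Bs Q1; rewrite mulr1.
have : (Q `&` range (Y 1)) (Y 1 i) by split=> //; exists i.
by rewrite Qw => -[k kw /final_gen_inj <-].
Qed.

End Chain.

Theorem theorem1p4 (K : fieldType) (R : algType K) (N : nat)
    (C : cgl_extension R N) (D : unitAlgType K) (f : R -> D)
    (hf : division_ring_of_fractions f)
    (w w' : {set 'I_N}) (J J' : set R) :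
  cauchon_diagram C f w -> cauchon_diagram C f w' ->
  diagram_ideal C f w J -> diagram_ideal C f w' J' ->
  w \proper w' -> (J `<` J')%classic.
Proof.
move=> hw hw' [_ prJ eJ] [_ prJ' eJ'] /properP[sub [i iw' iw]].
have [n1 mem_w] := diagram_proper hf hw; have [n1' _] := diagram_proper hf hw'.
have cJ : chain C f J 1 = K_ideal C f w := eJ.
have cJ' : chain C f J' 1 = K_ideal C f w' := eJ'.
have T_sub (v : {set 'I_N}) k : k \in v ->
    K_ideal C f v (cauchon_gen C f 1 k).
  by move=> kv M [_]; apply; exists k.
have [_ f_inj _ _ _] := hf.
have JJ' : (J `<=` J')%classic.
  move=> a Ja; have : chain C f J' N (f a).
    apply: (chain_mono hf prJ prJ'); rewrite ?cJ ?cJ' //.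
    - by move=> k k0; apply: K_ideal_stable.
    - move=> b Kb M [hM TM]; apply: Kb; split=> // _ [k kw <-].
      by apply: TM; exists k => //; apply: (fintype.subsetP sub).
    - by rewrite chainN; exists a.
  by rewrite chainN => -[b J'b /f_inj <-].
(* If J' were contained in J they would be equal, and K_w would contain T_i for an i in w' but not
   in w. *)
split=> // J'J; move: iw; rewrite mem_w // -eJ.
have -> : J = J' by apply/seteqP.
by rewrite eJ'; apply: T_sub.
Qed.
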